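(* Let $\mathcal M>0$ and $p\ge1$. Then there exist $m_{\mathcal M,p}>0$ (sufficiently small) and a constant $C(\mathcal M,p)<\infty$ such that for every function $c:\mathbb Z\to\mathbb R$ with $|c(n)|\le\mathcal M$ and $c(n)=c(-n)$ for all $n$, and every integer $N\ge0$, the fourth order chaos $$S_{4,N}=\frac32\sum_{\substack{n_1+n_2=n_3+n_4\\ |n_i|\le N}}c(n_1)c(n_2)c(n_3)c(n_4)\,n_1\,\frac{g_{n_1}g_{n_2}\overline{g_{n_3}}\,\overline{g_{n_4}}}{\langle n_1\rangle\langle n_2\rangle\langle n_3\rangle\langle n_4\rangle}$$ satisfies $$\int_{H^{1/2-}(\mathbb T)}1_{\|u\|_{L^2}^2<m_{\mathcal M,p}}\,e^{pS_{4,N}(u)}\,d\mu\le C(\mathcal M,p).$$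
   Context: $\mathbb T=\mathbb R/2\pi\mathbb Z$, with $\int_{\mathbb T}f\,dx:=\frac1{2\pi}\int_0^{2\pi}f(x)\,dx$, so $\|u\|_{L^2(\mathbb T)}^2=\sum_n|\widehat u(n)|^2$. $\langle n\rangle=(1+n^2)^{1/2}$. $H^{1/2-}(\mathbb T)=\bigcap_{s<1/2}H^s(\mathbb T)$. Let $\{g_n\}_{n\in\mathbb Z}$ be i.i.d. complex Gaussians with mean $0$ and $\mathbb E|g_n|^2=1$ (real and imaginary parts independent $N(0,\frac12)$); $\mu$ is the law on $H^{1/2-}(\mathbb T)$ of $u=\sum_{n}\frac{g_n}{\langle n\rangle}e^{inx}$. On the probability space $(H^{1/2-}(\mathbb T),\mu)$ we write $g_n=g_n(u)=\langle n\rangle\widehat u(n)$, so $S_{4,N}$ is a (real-valued) function of $u$. *)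

(* Defs.v *)
From HB Require Import structures.
From mathcomp Require Import all_boot all_order all_algebra finmap.
From mathcomp Require Import complex.
From mathcomp Require Import all_classical all_reals all_analysis.
From mathcomp Require Import measurable_realfun ring.
Import Order.TTheory GRing.Theory Num.Theory.
Import numFieldNormedType.Exports.

Set Implicit Arguments.
Unset Strict Implicit.
Unset Printing Implicit Defensive.

Local Open Scope classical_set_scope.
Local Open Scope ring_scope.
Local Open Scope complex_scope.

(* The postfix [^*] would denote [Num.conj] or [conjc] depending on the scope;
   complex conjugation is always written [conjc] below. The modulus is the
   real-valued [normc], not the norm [`|z|] with values in [R[i]]. *)
Notation normc := ComplexField.Normc.normc.

Section circle.
Context {R : realType}.

Definition japanese (n : int) : R := Num.sqrt (1 + n%:~R ^+ 2).

Lemma two_pi_gt0 : (0 : R) < pi *+ 2.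
Proof. by rewrite mulrn_wgt0// pi_gt0. Qed.

(* A function on the circle R / 2 pi Z is represented by a function on the
   line, considered almost everywhere for the normalized Lebesgue measure of
   [0, 2 pi]; its values off [0, 2 pi] are irrelevant. *)
Definition circle_measure : probability (measurableTypeR R) R :=
  uniform_prob two_pi_gt0.

Definition expi (t : R) : R[i] := cos t +i* sin t.

Definition circle_integral (f : R -> R[i]) : R[i] :=
  (\int[circle_measure]_x complex.Re (f x)) +i*
  (\int[circle_measure]_x complex.Im (f x)).

Definition fourier (f : R -> R[i]) (n : int) : R[i] :=
  circle_integral (fun x => f x * expi (- (n%:~R * x))).

Definition L2normsq (f : R -> R[i]) : \bar R :=
  (\int[circle_measure]_x ((normc (f x)) ^+ 2)%:E)%E.

Definition sobolev_normsq (s : R) (f : R -> R[i]) : \bar R :=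
  (\esum_(n in [set: int])
    (japanese n `^ (2 * s) * normc (fourier f n) ^+ 2)%:E)%E.

Definition freq (N : nat) (k : 'I_(N.*2.+1)) : int := k%:Z - N%:Z.

(* Symmetric partial sums: [freq N] enumerates the integers n, |n| <= N. *)
Definition trig_poly (a : int -> R[i]) (N : nat) (x : R) : R[i] :=
  \sum_(k < N.*2.+1) a (freq k) * expi ((freq k)%:~R * x).

End circle.

Section zero_class.
Context d (T : measurableType d) (R : realType).
Variable nu : {measure set T -> \bar R}.

Definition zero_class : {mfun_ nu, T >-> measurableTypeR R} :=
  \pi%qT (cst 0 : {mfun T >-> measurableTypeR R}).

Lemma zero_class_ae :
  ae_eq nu setT (zero_class : T -> R) (cst 0).
Proof.
have := @reprK _ {mfun_ nu, T >-> measurableTypeR R} zero_class.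
by move/eqP; rewrite [X in _ == X]/zero_class eqmodE => /asboolP.
Qed.

Lemma zero_class_finite : finite_norm nu 2%:E zero_class.
Proof.
rewrite /finite_norm unlock /Lnorm poweR_lty//.
rewrite (@ae_eq_integral _ _ _ nu setT (cst 0%E))//.
- by rewrite integral0.
- apply: (measurableT_comp (measurable_poweR _)) => //.
  apply: measurableT_comp => //.
  by apply: measurableT_comp => //; exact: (@measurable_funPT _ _ _ _ (repr zero_class)).
- by apply: filterS zero_class_ae => x /(_ I) /= -> _; rewrite normr0 powR0.
Qed.

HB.instance Definition _ :=
  isFinLebesgue.Build _ _ _ nu 2%:E (lee1n 2) zero_class zero_class_finite.

Definition L2zero : LspaceType2 nu := zero_class.

End zero_class.

Section sobolev_space.
Variable R : realType.

(* L^2(T; C) is two copies (real and imaginary part) of the real space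
   L^2(T), whose elements are classes of almost everywhere equal functions. *)
Definition L2class := LspaceType2 (circle_measure (R := R)).

Definition complex_fun (f g : L2class) (x : R) : R[i] :=
  (f : R -> R) x +i* (g : R -> R) x.

Record Hhalf_minus : Type := MkHhalf {
  Hre : L2class;
  Him : L2class;
  HhalfP : forall s : R, s < 2^-1 ->
    (sobolev_normsq s (complex_fun Hre Him) < +oo)%E }.

(* Elements are applied to points through a representative of their class. *)
Definition Hfun (u : Hhalf_minus) : R -> R[i] := complex_fun (Hre u) (Him u).
Coercion Hfun : Hhalf_minus >-> Funclass.

(* The topology of the intersection of the H^s, s < 1/2. One exponent and one
   radius suffice for a neighbourhood since the H^s norms increase with s. *)
Definition Hhalf_open (G : set Hhalf_minus) : Prop :=
  forall u, G u -> exists s e : R, [/\ s < 2^-1, 0 < e &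
    forall v : Hhalf_minus,
      (sobolev_normsq s (fun x => v x - u x)%R < (e ^+ 2)%:E)%E -> G v].

Lemma Hzero_finite (s : R) :
  (sobolev_normsq s
     (complex_fun (L2zero (circle_measure (R := R))) (L2zero _)) < +oo)%E.
Proof.
rewrite /sobolev_normsq esum1// => n _.
suff -> : fourier (complex_fun (L2zero (circle_measure (R := R))) (L2zero _)) n
    = 0 by rewrite ComplexField.Normc.normc0 expr0n mulr0.
have cint0 (h k : R -> R) : measurable_fun setT h -> measurable_fun setT k ->
    Rintegral (circle_measure (R := R)) setT (fun x =>
      (L2zero (circle_measure (R := R)) : R -> R) x * h x +
      (L2zero (circle_measure (R := R)) : R -> R) x * k x) = 0.
  move=> mh mk; rewrite /Rintegral (@ae_eq_integral _ _ _ _ setT (cst 0%E))//.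
  - by rewrite integral0.
  - apply/measurable_EFinP; apply: measurable_funD; apply: measurable_funM => //;
      exact: (@measurable_funPT _ _ _ _ (repr (zero_class _))).
  - apply: filterS (zero_class_ae (circle_measure (R := R))) => x /(_ I) /= z0 _.
    by rewrite /L2zero /= z0 !mul0r addr0.
have mlin : measurable_fun setT (fun x : R => - (n%:~R * x)).
  by apply: measurableT_comp => //; exact: measurable_funM.
have mcos := measurableT_comp (continuous_measurable_fun (@continuous_cos R)) mlin.
have msin := measurableT_comp (continuous_measurable_fun (@continuous_sin R)) mlin.
rewrite /fourier /circle_integral; apply/eqP; rewrite eq_complex /=.
apply/andP; split; apply/eqP.
  rewrite -[RHS](cint0 _ (fun x => - sin (- (n%:~R * x))) mcos).
    by apply: eq_Rintegral => x _; rewrite mulrN.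
  exact: measurableT_comp.
exact: cint0.
Qed.

Definition Hzero : Hhalf_minus :=
  MkHhalf (fun s (_ : s < 2^-1) => Hzero_finite s).

HB.instance Definition _ := gen_eqMixin Hhalf_minus.
HB.instance Definition _ := gen_choiceMixin Hhalf_minus.
HB.instance Definition _ := isPointed.Build Hhalf_minus Hzero.

End sobolev_space.

(* H^{1/2-}(T) with its Borel sigma-algebra. *)
Notation Hhalf_borel R := (g_sigma_algebraType (@Hhalf_open R)).

Section gaussian.
Context {R : realType} {d : measure_display} {Omega : measurableType d}.
Variable P : probability Omega R.

(* Complex-valued random variables are independent as random variables with
   values in the plane R * R with its Borel sigma-algebra. *)
Definition plane (z : R[i]) : measurableTypeR R * measurableTypeR R :=
  (complex.Re z, complex.Im z).

Definition mutually_independent (I : choiceType) (Z : I -> Omega -> R[i]) :=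
  forall (F : {fset I})
    (B : I -> set (measurableTypeR R * measurableTypeR R)),
    (forall i, measurable (B i)) ->
    P (\bigcap_(i in [set` F]) ((plane \o Z i) @^-1` B i)) =
    (\prod_(i <- F) P ((plane \o Z i) @^-1` B i))%E.

(* The second argument of [normal_prob] is the standard deviation. *)
Definition standard_complex_gaussian (Z : Omega -> R[i]) :=
  let X := (fun w => complex.Re (Z w)) : Omega -> measurableTypeR R in
  let Y := (fun w => complex.Im (Z w)) : Omega -> measurableTypeR R in
  let N := normal_prob (0 : R) (Num.sqrt (2^-1)) in
  [/\ measurable_fun setT X, measurable_fun setT Y,
      forall A, measurable A -> P (X @^-1` A) = N A,
      forall B, measurable B -> P (Y @^-1` B) = N B &
      forall A B, measurable A -> measurable B ->
        P (X @^-1` A `&` Y @^-1` B) = (P (X @^-1` A) * P (Y @^-1` B))%E].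

(* Almost surely, the symmetric partial sums of the Fourier series with
   coefficients g_n / <n> converge to U in H^s for every s < 1/2. *)
Definition gaussian_series (g : int -> Omega -> R[i])
    (U : Omega -> Hhalf_borel R) :=
  {ae P, forall w, forall s : R, s < 2^-1 ->
    sobolev_normsq s (fun x => (U w : Hhalf_minus R) x -
      trig_poly (fun n => g n w / (japanese n)%:C) K x) @[K --> \oo]
    --> (0 : \bar R)}.

End gaussian.

Definition gaussian_law (R : realType) (mu : probability (Hhalf_borel R) R) :=
  exists (d : measure_display) (Omega : measurableType d)
    (P : probability Omega R) (g : int -> Omega -> R[i])
    (U : {RV P >-> Hhalf_borel R}),
  [/\ forall n, standard_complex_gaussian P (g n),
      mutually_independent P g,
      gaussian_series P g U &
      forall A, measurable A -> mu A = distribution P U A].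

Section chaos.
Context {R : realType}.

Definition gcoef (u : R -> R[i]) (n : int) : R[i] :=
  (japanese n)%:C * fourier u n.

Definition S4term (c : int -> R) (u : R -> R[i]) (n1 n2 n3 n4 : int) : R[i] :=
  (c n1 * c n2 * c n3 * c n4 * n1%:~R)%:C *
  (gcoef u n1 * gcoef u n2 * conjc (gcoef u n3) * conjc (gcoef u n4) /
   (japanese n1 * japanese n2 * japanese n3 * japanese n4)%:C).

Definition S4C (c : int -> R) (N : nat) (u : R -> R[i]) : R[i] :=
  (3 / 2) * \sum_(k1 < N.*2.+1) \sum_(k2 < N.*2.+1) \sum_(k3 < N.*2.+1)
    \sum_(k4 < N.*2.+1 | freq k1 + freq k2 == freq k3 + freq k4)
      S4term c u (freq k1) (freq k2) (freq k3) (freq k4).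

Definition S4 (c : int -> R) (N : nat) (u : R -> R[i]) : R :=
  complex.Re (S4C c N u).

(* Taking the real part discards nothing. *)
Lemma S4E (c : int -> R) (N : nat) (u : R -> R[i]) :
  S4C c N u = (S4 c N u)%:C.
Proof.
suff S4r : conjc (S4C c N u) = S4C c N u.
  apply/eqP; rewrite eq_complex /= eqxx /=.
  move: S4r; rewrite /S4; case: (S4C c N u) => a b [] /eqP.
  by rewrite eq_sym -addr_eq0 -mulr2n mulrn_eq0.
pose K := N.*2.+1.
pose b (n1 n2 n3 n4 : int) : R[i] :=
  if n1 + n2 == n3 + n4 then
    (c n1 * c n2 * c n3 * c n4)%:C *
    (gcoef u n1 * gcoef u n2 * conjc (gcoef u n3) * conjc (gcoef u n4) /
    (japanese n1 * japanese n2 * japanese n3 * japanese n4)%:C) else 0.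
pose S (f : 'I_K -> 'I_K -> 'I_K -> 'I_K -> R[i]) :=
  \sum_k1 \sum_k2 \sum_k3 \sum_k4 f k1 k2 k3 k4.
have eqS f g : (forall k1 k2 k3 k4, f k1 k2 k3 k4 = g k1 k2 k3 k4) -> S f = S g.
  move=> fg; apply: eq_bigr => k1 _; apply: eq_bigr => k2 _.
  by apply: eq_bigr => k3 _; apply: eq_bigr => k4 _.
have addS f g : S f + S g =
    S (fun k1 k2 k3 k4 => f k1 k2 k3 k4 + g k1 k2 k3 k4).
  rewrite -big_split; apply: eq_bigr => k1 _; rewrite -big_split.
  apply: eq_bigr => k2 _; rewrite -big_split; apply: eq_bigr => k3 _.
  by rewrite -big_split.
have swap12 f : S f = S (fun k1 k2 k3 k4 => f k2 k1 k3 k4).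
  by rewrite /S exchange_big.
have swap34 f : S f = S (fun k1 k2 k3 k4 => f k1 k2 k4 k3).
  by apply: eq_bigr => k1 _; apply: eq_bigr => k2 _; rewrite exchange_big.
have swap23 f : S f = S (fun k1 k2 k3 k4 => f k1 k3 k2 k4).
  by apply: eq_bigr => k1 _; rewrite exchange_big.
pose w (k : 'I_K) : R[i] := (freq k : int)%:~R.
pose B (k1 k2 k3 k4 : 'I_K) := b (freq k1) (freq k2) (freq k3) (freq k4).
have SE : S4C c N u = 3 / 2 * S (fun k1 k2 k3 k4 => w k1 * B k1 k2 k3 k4).
  congr (_ * _); apply: eq_bigr => k1 _; apply: eq_bigr => k2 _.
  apply: eq_bigr => k3 _; rewrite big_mkcond; apply: eq_bigr => k4 _.
  rewrite /B /b /w /S4term; case: ifP => _; last by rewrite mulr0.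
  by rewrite !rmorphM /= rmorph_int; ring.
have B12 k1 k2 k3 k4 : B k2 k1 k3 k4 = B k1 k2 k3 k4.
  rewrite /B /b (addrC (freq k2)); case: ifP => // _; congr (_%:C * (_ / _%:C)).
  - by rewrite (mulrC (c (freq k2))).
  - by rewrite (mulrC (gcoef u (freq k2))).
  - by rewrite (mulrC (japanese (freq k2))).
have B34 k1 k2 k3 k4 : B k1 k2 k4 k3 = B k1 k2 k3 k4.
  rewrite /B /b (addrC (freq k4)); case: ifP => // _; congr (_%:C * (_ / _%:C)).
  - by rewrite mulrAC.
  - by rewrite mulrAC.
  - by rewrite mulrAC.
have Bconj k1 k2 k3 k4 : conjc (B k1 k2 k3 k4) = B k3 k4 k1 k2.
  have conjM (x y : R[i]) : conjc (x * y) = conjc x * conjc y.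
    exact: rmorphM.
  have conjV (x : R[i]) : conjc (x^-1) = (conjc x)^-1 by exact: fmorphV.
  rewrite /B /b [in RHS]eq_sym; case: ifP => _; last exact: rmorph0.
  rewrite !conjM conjV !conjcK !conjc_real.
  have cE : c (freq k1) * c (freq k2) * c (freq k3) * c (freq k4) =
            c (freq k3) * c (freq k4) * c (freq k1) * c (freq k2) by ring.
  have jE : @japanese R (freq k1) * japanese (freq k2) *
              japanese (freq k3) * japanese (freq k4) =
            japanese (freq k3) * japanese (freq k4) *
              japanese (freq k1) * japanese (freq k2) by ring.
  by rewrite cE jE; congr (_ * (_ / _)); rewrite -mulrA mulrC !mulrA.
have S13 : S (fun k1 k2 k3 k4 => w k1 * B k1 k2 k3 k4) =
           S (fun k1 k2 k3 k4 => w k3 * B k1 k2 k3 k4).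
  have two0 : (2 : R[i]) != 0 by rewrite pnatr_eq0.
  apply: (mulfI two0); rewrite ![2 * _]mulr_natl !mulr2n.
  rewrite [X in _ + X = _]swap12 [X in _ = _ + X]swap34 !addS.
  apply: eqS => k1 k2 k3 k4; rewrite (B12 k1 k2) (B34 k1 k2) -!mulrDl /w -!rmorphD /=.
  rewrite /B /b; case: eqP => [->|_]; last by rewrite !mulr0.
  by rewrite (addrC (freq k4)).
have c32 : conjc (3 / 2 : R[i]) = 3 / 2.
  have -> : (3 / 2 : R[i]) = (3 / 2 : R)%:C.
    by rewrite rmorphM fmorphV !rmorph_nat.
  exact: conjc_real.
rewrite SE; move: c32; set q : R[i] := 3 / 2 => c32.
rewrite [LHS]rmorphM [X in X * _]c32; congr (_ * _).
rewrite rmorph_sum.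
transitivity (S (fun k1 k2 k3 k4 => w k1 * B k3 k4 k1 k2)).
  apply: eq_bigr => k1 _; rewrite rmorph_sum; apply: eq_bigr => k2 _.
  rewrite rmorph_sum; apply: eq_bigr => k3 _; rewrite rmorph_sum.
  by apply: eq_bigr => k4 _; rewrite rmorphM /= Bconj /w rmorph_int.
rewrite S13 swap23 swap12 swap34 swap23.
by apply: eqS.
Qed.

End chaos.

(* Main.v *)
Require Import Defs.
From mathcomp Require Import all_boot all_order all_algebra finmap.
From mathcomp Require Import complex.
From mathcomp Require Import all_classical all_reals all_analysis.
From mathcomp Require Import measurable_realfun.
From mathcomp Require Import ring lra zify.
Import Order.TTheory GRing.Theory Num.Theory.
Import numFieldNormedType.Exports.

Set Implicit Arguments.
Unset Strict Implicit.
Unset Printing Implicit Defensive.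

Local Open Scope classical_set_scope.
Local Open Scope ring_scope.

(* The law of the noise (g_n) has Maurey's property (tau): if
   [f x * g y <= K exp (sum_n |x_n - y_n|^2 / 2)] for all x and y, then
   [E f * E g <= K]. It is applied to [f = 1_{mass < m} exp (p S4)] and to the
   indicator g of an event G of probability at least 1/8, so that only a
   pathwise bound of S4 is needed. Write u = a + b, where a is the part of the
   frequencies > L of the point y of G. By conservation of the momentum S4 is
   3/4 of the symmetric form Q(u, u, u, u) with weight n1 + n2, and Q is
   expanded in a and b. The event G controls finitely many norms of a, whose
   second moments are bounded by orthogonality under the symmetries of the
   noise, and it contains the condition Q(a, a, a, a) <= 0, which costs only a
   factor 2 because Q is odd under the reflection n -> -n. The terms containing
   b are bounded by Young, Agmon and Cauchy-Schwarz by a constant plus a small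
   multiple (of order m) of sum_n |x_n - y_n|^2. *)

(** In Q(a, b, b, b) and Q(b, b, b, b) Agmon's inequality leaves the squared H^1 norm of b, which is
    of the same order as the cost, times delta^2 with delta = M sqrt m. Only a small mass can absorb
    this, and that fixes m as a multiple of 1 / (p M^4). Here a must be small in L^2 as well,
    although no mass condition is put on y: this is the reason for the cutoff L, which is chosen
    after m. The low frequencies of y then remain in b, and on G they cost a constant. The bounds
    that define G involve neither m nor L, so the choices are not circular.

    For Q(a, a, b, b) the resonance moves the derivative onto b. In Q(a, a, a, b) and in half of
    Q(a, b, a, b) it stays on a, and random cancellation is needed. The cubic expression in a is
    measured in H^{-1}, dual to the norm given by the cost; its paired terms reduce to the mass and
    momentum of a. The matrix B of Q(a, b, a, b) is measured in a Hilbert-Schmidt norm with weights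
    <n>^{-5/4}: the exponent 5/4 exceeds 1, so these weights are summable, and is below 2, so
    <n>^{5/4} |b_n|^2 is absorbed by the H^1 norm. *)

Section density.
Local Open Scope ereal_scope.
Context d (T : measurableType d) (R : realType).
Variables (mu nu : {measure set T -> \bar R}) (p : T -> R).
Hypotheses (p_ge0 : forall x, (0 <= p x)%R) (mp : measurable_fun setT p).
Hypothesis nuE : forall A, measurable A -> nu A = \int[mu]_(x in A) (p x)%:E.

Import HBNNSimple.

(** The density is known on sets; it passes to indicators, to simple functions by linearity, and to
    [f] by monotone convergence. *)
Lemma ge0_integral_density (f : T -> \bar R) :
  measurable_fun setT f -> (forall x, 0 <= f x) ->
  \int[nu]_x f x = \int[mu]_x (f x * (p x)%:E).
Proof.
move=> mf f0.
have mpE : measurable_fun setT (EFin \o p) by exact/measurable_EFinP.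
pose f_ := nnsfun_approx measurableT mf.
have f_ndE n x : 0 <= (f_ n x)%:E * (p x)%:E by rewrite mule_ge0 ?lee_fin.
have mf_ n : measurable_fun setT (fun x => (f_ n x)%:E * (p x)%:E).
  by apply: emeasurable_funM => //; exact/measurable_EFinP.
have indicE (A : set T) : measurable A ->
    \int[nu]_x (\1_A x)%:E = \int[mu]_x ((\1_A x)%:E * (p x)%:E).
  move=> mA; rewrite integral_indic// setIT nuE// integral_mkcond.
  apply: eq_integral => x _; rewrite patchE indicE.
  by case: ifPn => _; rewrite ?mul1e ?mul0e.
have nnE n : \int[nu]_x (f_ n x)%:E = \int[mu]_x ((f_ n x)%:E * (p x)%:E).
  under [LHS]eq_integral do rewrite fimfunE -fsumEFin//.
  rewrite [LHS]ge0_integral_fsum//; last 2 first.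
    - by move=> r; exact/measurable_EFinP/measurableT_comp.
    - by move=> r x _; rewrite EFinM nnfun_muleindic_ge0.
  under [RHS]eq_integral.
    move=> x _; rewrite fimfunE -fsumEFin// muleC ge0_mule_fsumr; last first.
      by move=> r; rewrite EFinM nnfun_muleindic_ge0.
    over.
  rewrite [RHS]ge0_integral_fsum//; last 2 first.
    - move=> r; apply: emeasurable_funM => //.
      exact/measurable_EFinP/measurableT_comp.
    - by move=> r x _; rewrite mule_ge0 ?lee_fin// -lee_fin EFinM nnfun_muleindic_ge0.
  apply: eq_fsbigr => r _.
  have [r0|r0] := leP 0%R r; last first.
    by rewrite !integral0_eq// => x _; rewrite preimage_nnfun0// indic0 mulr0 ?mule0.
  under eq_integral do rewrite EFinM.
  rewrite ge0_integralZl//; last exact/measurable_EFinP/measurable_indic.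
  under [RHS]eq_integral do rewrite EFinM muleCA (muleC (p _)%:E).
  rewrite ge0_integralZl//; last 2 first.
    - by apply: emeasurable_funM => //; exact/measurable_EFinP/measurable_indic.
    - by move=> x _; rewrite mule_ge0 ?lee_fin.
  by rewrite indicE.
transitivity (lim (\int[nu]_x (f_ n x)%:E @[n --> \oo])).
  rewrite -monotone_convergence//=.
  - apply: eq_integral => ? /[!inE] xD; apply/esym/cvg_lim => //=.
    exact: cvg_nnsfun_approx.
  - by move=> n; exact/measurable_EFinP/measurable_funTS.
  - by move=> n ? _; rewrite lee_fin.
  - by move=> ? _ ? ? mn; rewrite lee_fin; exact/lefP/nd_nnsfun_approx.
under eq_fun do rewrite nnE.
rewrite -monotone_convergence//=; last first.
  move=> x _ m n mn; rewrite lee_pmul ?lee_fin//.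
  exact/lefP/nd_nnsfun_approx.
apply: eq_integral => x _; apply/cvg_lim => //=.
apply: cvgeMr => //; exact: cvg_nnsfun_approx.
Qed.

End density.

(** * Property (tau) of the normal distribution *)

Section normal_tau_1d.
Context {R : realType}.
Local Notation leb := (@lebesgue_measure R).

(** Brunn-Minkowski on the line for a sum contained in a symmetric interval: [A] lies in the
    interval from [- 2 r - inf B] to [2 r - sup B] and [B] in the one from [inf B] to [sup B], and
    these two lengths add up to [4 r]. *)
Lemma lebesgue_measure_add_le (A B : set R) (r : R) :
  measurable A -> measurable B -> A !=set0 -> B !=set0 ->
  (forall x y, A x -> B y -> `|x + y| <= r *+ 2) ->
  (leb A + leb B <= (r *+ 4)%:E)%E.
Proof.
move=> mA mB [x0 Ax0] [y0 By0] AB.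
have ABle x y : A x -> B y -> - (r *+ 2) <= x + y <= r *+ 2.
  by move=> Ax By; rewrite -ler_norml AB.
have ubB : has_sup B.
  split; first by exists y0.
  exists (r *+ 2 - x0) => y By; have /andP[_] := ABle _ _ Ax0 By; lra.
have lbB : has_inf B.
  split; first by exists y0.
  exists (- (r *+ 2) - x0) => y By; have /andP[+ _] := ABle _ _ Ax0 By; lra.
have Asub : A `<=` `[- (r *+ 2) - inf B, r *+ 2 - sup B].
  move=> x Ax /=; rewrite in_itv/=; apply/andP; split.
    rewrite lerBlDr -lerBlDl; apply: lb_le_inf; first by exists y0.
    by move=> y By; have /andP[+ _] := ABle _ _ Ax By; lra.
  rewrite lerBrDr -lerBrDl; apply: ge_sup; first by exists y0.
  by move=> y By; have /andP[_] := ABle _ _ Ax By; lra.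
have Bsub : B `<=` `[inf B, sup B].
  move=> y By /=; rewrite in_itv/= ge_inf ?ub_le_sup//; first exact: ubB.2.
  exact: lbB.2.
have itvE (a b : R) : a <= b -> leb `[a, b]%classic = (b - a)%:E.
  by move=> ab; rewrite lebesgue_measure_itv/= lte_fin lt_neqAle ab andbT;
    case: eqP => //= ->; rewrite subrr.
have LA : (leb A <= (r *+ 2 - sup B - (- (r *+ 2) - inf B))%:E)%E.
  rewrite -itvE; first by apply: le_measure => //; rewrite inE.
  by have := Asub _ Ax0; rewrite /= in_itv/= => /andP[]; exact: le_trans.
have LB : (leb B <= (sup B - inf B)%:E)%E.
  rewrite -itvE; first by apply: le_measure => //; rewrite inE.
  by have := Bsub _ By0; rewrite /= in_itv/= => /andP[]; exact: le_trans.
apply: (le_trans (leeD LA LB)); rewrite -EFinD lee_fin; lra.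
Qed.

Lemma measurable_lt_fun (h : R -> R) : measurable_fun setT h ->
  measurable [set z : R * R | z.1 < h z.2].
Proof.
move=> mh.
have := @measurable_fun_ltr _ _ _ setT (fst : R * R -> R) (h \o snd).
move=> /(_ measurable_fst (measurableT_comp mh measurable_snd)).
by move=> /(_ measurableT [set true] I); rewrite setTI.
Qed.

Lemma measurable_lt_level (h : R -> R) (t : R) : measurable_fun setT h ->
  measurable [set x : R | t < h x].
Proof.
move=> mh; have := measurable_fun_ltr (measurable_cst t) mh.
by move=> /(_ measurableT [set true] I); rewrite setTI.
Qed.

Lemma measurable_level_measure (h : R -> R) : measurable_fun setT h ->
  measurable_fun setT (fun t : R => leb [set x | t < h x]).
Proof.
move=> /measurable_lt_fun mh.
have := measurable_fun_xsection leb mh.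
apply: eq_measurable_fun => t _; rewrite /=; congr (leb _).
by apply/seteqP; split => x /=; rewrite /xsection/= inE.
Qed.

(** Stopping the levels at 1 caps [h] at 1. The cap is inert for functions bounded by 1, and for the
    multiple of the Gaussian density it only decreases the integral, which is the favourable
    direction. *)
Lemma layer_cake01 (h : R -> R) : measurable_fun setT h ->
  (forall x, 0 <= h x) ->
  (\int[leb]_(t in `]0%R, 1%R[) leb [set x | (t < h x)%R] =
   \int[leb]_x (Num.min (h x) 1)%:E)%E.
Proof.
move=> mh h0.
pose D := [set z : R * R | z.1 < h z.2] `&` (`]0%R, 1%R[%classic `*` setT).
have mD : measurable D.
  by apply: measurableI; [exact: measurable_lt_fun|exact: measurableX].
have mind : measurable_fun setT (EFin \o (\1_D : R * R -> R)).
  exact/measurable_EFinP/measurable_indic.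
have := @fubini_tonelli _ _ _ _ R leb leb (EFin \o \1_D) mind.
have -> : (\int[leb]_(t in `]0%R, 1%R[) leb [set x | (t < h x)%R] =
    \int[leb]_x \int[leb]_y (EFin \o \1_D) (x, y))%E.
  rewrite integral_mkcond; apply: eq_integral => t _.
  rewrite patchE /=; case: ifPn => [|] t01.
    rewrite (_ : (fun y => _) = EFin \o \1_[set x | t < h x]); last first.
      apply/funext => y /=; congr (_%:E); rewrite !indicE; congr ((_ : bool)%:R).
      apply/idP/idP; rewrite !inE /D/=; first by case.
      by move=> ->; split => //; split => //; rewrite inE in t01.
    by rewrite integral_indic ?setIT//; exact: measurable_lt_level.
  rewrite integral0_eq// => y _; rewrite indicE memNset// => -[_ [/= ]].
  by rewrite notin_setE in t01.
move=> ->; last by move=> z; rewrite lee_fin.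
apply: eq_integral => x _.
rewrite (_ : (fun x0 => _) = EFin \o \1_(`]0, (Num.min (h x) 1)[%classic : set R));
  last first.
  apply/funext => y /=; congr (_%:E); rewrite !indicE; congr ((_ : bool)%:R).
  apply/idP/idP; rewrite !inE /D/= !in_itv/= lt_min.
    by move=> [-> [/andP[-> ->]]].
  by move=> /and3P[-> -> ->].
rewrite integral_indic// ?setIT.
rewrite [LHS](lebesgue_measure_itv `]0, (Num.min (h x) 1)[)/= lte_fin.
case: ltP; first by rewrite oppr0 adde0.
move=> hx; congr (_%:E); apply/eqP; rewrite eq_le hx andbT.
by rewrite le_min h0 ler01.
Qed.

Variable s : R.
Hypothesis s0 : s != 0.
Local Notation p := (normal_pdf 0 s).
Local Notation pk := (normal_peak s).

Let pE x : p x = pk * expR (- (x ^+ 2 / (s ^+ 2 *+ 2))).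
Proof. by rewrite normal_pdfE// /normal_fun subr0 mulNr. Qed.

Let pk0 : 0 < pk. Proof. exact: normal_peak_gt0. Qed.

Let p0 x : 0 < p x. Proof. by rewrite pE mulr_gt0// expR_gt0. Qed.

Let s20 : 0 < s ^+ 2 *+ 2.
Proof. by rewrite pmulrn_lgt0// exprn_even_gt0. Qed.

(** The parallelogram law in the exponent. The factor left over is the cost for which property (tau)
    will hold. *)
Lemma normal_pdf_midpoint x y :
  p x * p y * expR ((x - y) ^+ 2 / (s ^+ 2 *+ 4)) = p ((x + y) / 2) ^+ 2.
Proof.
rewrite !pE; set e := (X in pk * X * _ * _); set e' := (X in _ * (pk * X) * _).
set q := (X in _ * X = _).
have -> : pk * e * (pk * e') * q = pk ^+ 2 * (e * e' * q) by ring.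
rewrite exprMn -expRM_natl -!expRD; congr (_ * expR _).
by field; exact/s0.
Qed.

(** The superlevel set of the density is a symmetric interval, so the midpoint condition says that
    [x + y] stays within twice its half-length [r]. *)
Lemma normal_pdf_level (A B : set R) (t : R) : 0 < t ->
  measurable A -> measurable B -> A !=set0 -> B !=set0 ->
  (forall x y, A x -> B y -> t < p ((x + y) / 2)) ->
  (leb A + leb B <= 2%:E * leb [set x | (t < p x)%R])%E.
Proof.
move=> t0 mA mB A0 B0 AB.
pose w := - ln (t / pk).
have tE : t = pk * expR (- w).
  by rewrite opprK lnK ?posrE ?divr_gt0// mulrCA mulfV ?mulr1// gt_eqF.
have ltE x : (t < p x) = (x ^+ 2 < w * (s ^+ 2 *+ 2)).
  by rewrite tE pE ltr_pM2l// ltr_expR ltrN2 ltr_pdivrMr.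
have w0 : 0 <= w * (s ^+ 2 *+ 2).
  have [x Ax] := A0; have [y By] := B0; have := AB _ _ Ax By; rewrite ltE.
  by move=> /ltW; apply: le_trans; exact: sqr_ge0.
pose r := Num.sqrt (w * (s ^+ 2 *+ 2)).
have r0 : 0 <= r by exact: sqrtr_ge0.
apply: (@le_trans _ _ (r *+ 4)%:E).
  apply: lebesgue_measure_add_le => // x y Ax By.
  have := AB _ _ Ax By; rewrite ltE => /ltW.
  rewrite -[leLHS]real_normK ?num_real// -[leRHS]sqr_sqrtr// ler_sqr ?nnegrE//.
  by rewrite normrM (@ger0_norm _ 2^-1)// -/r; lra.
have -> : [set x | t < p x] = `]- r, r[%classic.
  apply/seteqP; split => x /=; rewrite ltE in_itv/= -ltr_norml.
    rewrite -[ltLHS]real_normK ?num_real// -[ltRHS]sqr_sqrtr//.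
    by rewrite ltr_sqr ?nnegrE.
  rewrite -[X in _ -> X < _]real_normK ?num_real// -[X in _ -> _ < X]sqr_sqrtr//.
  by rewrite ltr_sqr ?nnegrE.
rewrite lebesgue_measure_itv/= lte_fin; case: ltP => [rr|rr].
  by rewrite -EFinD -EFinM lee_fin; lra.
by rewrite mule0 lee_fin; lra.
Qed.

End normal_tau_1d.

(** The two-function form makes the infimum convolution implicit. The constant [K] is kept free
    because, in the passage to products, it receives the exponential of the cost of the other
    coordinates. *)
Definition property_tau d (T : measurableType d) (R : realType)
    (mu : {measure set T -> \bar R}) (q : T -> T -> R) :=
  forall (K : R) (f g : T -> \bar R), 0 <= K ->
    measurable_fun setT f -> measurable_fun setT g ->
    (forall x, 0 <= f x)%E -> (forall x, 0 <= g x)%E ->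
    (forall x y, f x * g y <= (K * expR (q x y))%:E)%E ->
    (\int[mu]_x f x * \int[mu]_x g x <= K%:E)%E.

Section normal_tau.
Context {R : realType}.
Local Notation leb := (@lebesgue_measure R).
Variable s : R.
Hypothesis s0 : s != 0.
Local Notation p := (normal_pdf 0 s).

Let p0 x : 0 < p x.
Proof. by rewrite normal_pdfE// mulr_gt0 ?expR_gt0// normal_peak_gt0. Qed.

Let mp : measurable_fun setT p. Proof. exact: measurable_normal_pdf. Qed.

(* Once F, G and p are normalized to have supremum 1, their superlevel sets A, B
   and J at a common level satisfy (A + B) / 2 `<=` J, and J is an interval, so
   that |A| + |B| <= 2 |J|. It remains to integrate over the levels and to use
   the inequality of the arithmetic and geometric means. *)
Lemma midpoint_integral_le (K : R) (F G : R -> R) : 0 < K ->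
  measurable_fun setT F -> measurable_fun setT G ->
  (forall x, 0 <= F x) -> (forall x, 0 <= G x) ->
  (exists x, 0 < F x) -> (exists x, 0 < G x) ->
  (forall x y, F x * G y <= K * p ((x + y) / 2) ^+ 2) ->
  (\int[leb]_x (F x)%:E * \int[leb]_x (G x)%:E <= K%:E)%E.
Proof.
move=> K0 mF mG F0 G0 [x0 Fx0] [y0 Gy0] FG.
have FGub x y : F x * G y <= K * normal_peak s ^+ 2.
  apply: (le_trans (FG x y)); rewrite ler_pM2l// ler_sqr ?nnegrE ?(ltW (p0 _))//.
    exact: normal_pdf_ub.
  exact: normal_peak_ge0.
have hsF : has_sup (range F).
  split; first by exists (F x0), x0.
  exists (K * normal_peak s ^+ 2 / G y0) => _ [x _ <-].
  by rewrite ler_pdivlMr.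
have hsG : has_sup (range G).
  split; first by exists (G y0), y0.
  exists (K * normal_peak s ^+ 2 / F x0) => _ [y _ <-].
  by rewrite ler_pdivlMr// mulrC.
pose a := sup (range F); pose b := sup (range G).
have a0 : 0 < a by apply: (lt_le_trans Fx0); apply: ub_le_sup => //; exact: hsF.2.
have b0 : 0 < b by apply: (lt_le_trans Gy0); apply: ub_le_sup => //; exact: hsG.2.
(* With [c ^+ 2 = a * b / K] the hypothesis reads: the product of the normalized functions is at
   most the square of [c^-1 * p] at the midpoint. *)
pose c : R := Num.sqrt (a * b / K).
have c0 : 0 < c by rewrite sqrtr_gt0 divr_gt0// mulr_gt0.
have c2 : c ^+ 2 = a * b / K by rewrite sqr_sqrtr// divr_ge0 ?mulr_ge0 ?ltW.
have level t : 0 < t -> t < 1 ->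
    (leb [set x | (t < a^-1 * F x)%R] + leb [set x | (t < b^-1 * G x)%R] <=
     2%:E * leb [set x | (t < c^-1 * p x)%R])%E.
  move=> t0 t1.
  have E (u : R) (h : R -> R) : 0 < u ->
      [set x | t < u^-1 * h x] = [set x | t * u < h x].
    by move=> u0; apply/seteqP; split=> x /=; rewrite [u^-1 * _]mulrC ltr_pdivlMr.
  rewrite !E//; apply: normal_pdf_level => //.
  - by rewrite mulr_gt0.
  - exact: measurable_lt_level.
  - exact: measurable_lt_level.
  (* As [t < 1], the level [t * a] lies strictly below the supremum, so the superlevel set is not
     empty. *)
  - have [|_ [x _ <-]] := @sup_adherent _ (range F) (a - t * a) _ hsF.
      by rewrite subr_gt0 gtr_pMl.
    by rewrite -/a opprB addrC subrK => ?; exists x.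
  - have [|_ [x _ <-]] := @sup_adherent _ (range G) (b - t * b) _ hsG.
      by rewrite subr_gt0 gtr_pMl.
    by rewrite -/b opprB addrC subrK => ?; exists x.
  - move=> x y /= Fx Gy.
    rewrite -(@ltr_pXn2r _ 2)// ?nnegrE ?ltW ?mulr_gt0//.
    rewrite exprMn c2 mulrA ltr_pdivrMr// [ltRHS]mulrC.
    apply: lt_le_trans (FG x y).
    rewrite expr2 mulrACA ltr_pM// ?mulr_ge0// ltW//.
have mE (u : R) (h : R -> R) : measurable_fun setT h ->
    measurable_fun setT (fun x => u * h x).
  by move=> mh; exact: measurable_funM.
have lc (u : R) (h : R -> R) : measurable_fun setT h -> (forall x, 0 <= h x) ->
    0 < u ->
    (\int[leb]_(t in `]0%R, 1%R[) leb [set x | (t < u^-1 * h x)%R] =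
     \int[leb]_x (Num.min (u^-1 * h x) 1)%:E)%E.
  move=> mh h0 u0; apply: layer_cake01; first exact: mE.
  by move=> x; rewrite mulr_ge0// invr_ge0 ltW.
have mlev (u : R) (h : R -> R) : measurable_fun setT h ->
    measurable_fun (`]0%R, 1%R[%classic : set R) (fun t : R => leb [set x | (t < u^-1 * h x)%R]).
  move=> mh; apply: measurable_funTS.
  by apply: (@measurable_level_measure _ (fun x => u^-1 * h x)); exact: mE.
pose X := (\int[leb]_x (F x)%:E)%E; pose Y := (\int[leb]_x (G x)%:E)%E.
have X0 : (0 <= X)%E by apply: integral_ge0 => x _; rewrite lee_fin.
have Y0 : (0 <= Y)%E by apply: integral_ge0 => x _; rewrite lee_fin.
have XE (u : R) (h : R -> R) : measurable_fun setT h -> (forall x, 0 <= h x) ->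
    0 < u -> (forall x, h x <= u) ->
    (u^-1%:E * \int[leb]_x (h x)%:E = 
     \int[leb]_(t in `]0%R, 1%R[) leb [set x | (t < u^-1 * h x)%R])%E.
  move=> mh h0 u0 hu; rewrite lc// -ge0_integralZl//; first last.
  - by rewrite lee_fin invr_ge0 ltW.
  - by move=> x _; rewrite lee_fin.
  - exact/measurable_EFinP.
  apply: eq_integral => x _; rewrite -EFinM; congr (_%:E).
  by apply/esym/min_idPl; rewrite mulrC ler_pdivrMr// mul1r.
have XY : (a^-1%:E * X + b^-1%:E * Y <= (2 / c)%:E)%E.
  rewrite /X /Y !XE//; first last.
  - by move=> x; apply: ub_le_sup; [exact: hsF.2|exists x].
  - by move=> x; apply: ub_le_sup; [exact: hsG.2|exists x].
  rewrite -ge0_integralD//; try exact: mlev.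
  apply: (@le_trans _ _ (\int[leb]_(t in `]0%R, 1%R[)
      (2%:E * leb [set x | (t < c^-1 * p x)%R]))%E).
    apply: ge0_le_integral => //.
    - by move=> t _; rewrite adde_ge0.
    - by apply: emeasurable_funD; exact: mlev.
    - by apply: measurable_funeM; exact: mlev.
    - by move=> t /=; rewrite in_itv/= => /andP[t0 t1]; exact: level.
  rewrite ge0_integralZl//; last exact: mlev.
  rewrite EFinM; apply: lee_wpmul2l => //.
  rewrite lc//; last by move=> x; exact: ltW.
  rewrite -[X in (_ <= X)%E]mule1 -(integral_normal_pdf 0 s) -ge0_integralZl//; first last.
  - by rewrite lee_fin invr_ge0 ltW.
  - by move=> x _; rewrite lee_fin ltW.
  - exact/measurable_EFinP.
  apply: ge0_le_integral => //.
  - by move=> x _; rewrite lee_fin le_min ler01 andbT mulr_ge0// ?invr_ge0; exact: ltW.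
  - apply/measurable_EFinP; apply: measurable_minr; [exact: mE|exact: measurable_cst].
  - by apply/measurable_EFinP; exact: mE.
  - by move=> x _; rewrite -EFinM lee_fin ge_min lexx.
(* The bound on the weighted sum makes both integrals finite, so that the last inequality is one
   between real numbers. *)
have fin (u : R) (Z W : \bar R) : 0 < u -> (0 <= Z)%E -> (0 <= W)%E ->
    (u^-1%:E * Z + W <= (2 / c)%:E)%E -> Z \is a fin_num.
  move=> u0 Z0 W0 ZW; rewrite ge0_fin_numE//.
  have : (u^-1%:E * Z <= (2 / c)%:E)%E by apply: le_trans ZW; exact: leeDl.
  case: Z Z0 {ZW} => [z _ _|_|//]; first exact: ltry.
  by rewrite gt0_muley ?lte_fin ?invr_gt0// leye_eq.
have iW (u : R) Z : 0 < u -> (0 <= Z)%E -> (0 <= u^-1%:E * Z)%E.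
  by move=> u0 Z0; rewrite mule_ge0// lee_fin invr_ge0 ltW.
have fX := fin _ _ _ a0 X0 (iW _ _ b0 Y0) XY.
have fY : Y \is a fin_num.
  by move: XY; rewrite addeC; exact/fin/iW.
move: XY X0 Y0; rewrite -/X -/Y -(fineK fX) -(fineK fY).
move: (fine X) (fine Y) => {fX fY} x y; rewrite -!EFinM -EFinD !lee_fin => xy x0' y0'.
have : (a^-1 * x) * (b^-1 * y) <= c^-1 ^+ 2.
  have u0 : 0 <= a^-1 * x by rewrite mulr_ge0// invr_ge0 ltW.
  have v0 : 0 <= b^-1 * y by rewrite mulr_ge0// invr_ge0 ltW.
  have w0 : 0 <= c^-1 by rewrite invr_ge0 ltW.
  move: xy u0 v0 w0; move: (a^-1 * x) (b^-1 * y) (c^-1) => u v w uv u0 v0 w0.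
  have : 4 * (u * v) <= (u + v) ^+ 2 by have := sqr_ge0 (u - v); nra.
  have : (u + v) ^+ 2 <= (2 * w) ^+ 2 by rewrite ler_sqr ?nnegrE; lra.
  nra.
rewrite exprVn c2 invf_div mulrACA -invfM.
by rewrite mulrC ler_pdivrMr ?mulr_gt0// divfK// gt_eqF// mulr_gt0.
Qed.

(** The density is absorbed into the functions: [f * p] and [g * p] satisfy the midpoint hypothesis
    by [normal_pdf_midpoint]. *)
Lemma normal_property_tau :
  property_tau (normal_prob 0 s) (fun x y => (x - y) ^+ 2 / (s ^+ 2 *+ 4)).
Proof.
move=> K f g K0 mf mg f0 g0 fg.
have [fz|/existsNP[x0 /eqP fx0]] := pselect (forall x, f x = 0%E).
  by rewrite integral0_eq ?mul0e.
have [gz|/existsNP[y0 /eqP gy0]] := pselect (forall x, g x = 0%E).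
  by rewrite [X in (_ * X)%E]integral0_eq ?mule0.
have {}fx0 : (0 < f x0)%E by rewrite lt_neqAle eq_sym fx0 f0.
have {}gy0 : (0 < g y0)%E by rewrite lt_neqAle eq_sym gy0 g0.
(* An infinite value of [f] against the positive value [g y0] would contradict the finite bound on
   the product. *)
have ff x : f x \is a fin_num.
  rewrite ge0_fin_numE//; move: (f0 x) (fg x y0); case: (f x) => [r|_|//].
    by rewrite ltry.
  by rewrite gt0_mulye// leye_eq.
have gf y : g y \is a fin_num.
  rewrite ge0_fin_numE//; move: (g0 y) (fg x0 y); case: (g y) => [r|_|//].
    by rewrite ltry.
  by rewrite gt0_muley// leye_eq.
have normE h : measurable_fun setT h -> (forall x, 0 <= h x)%E ->
    (forall x, h x \is a fin_num) ->
    (\int[normal_prob 0 s]_x h x = \int[leb]_x (fine (h x) * p x)%:E)%E.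
  move=> mh h0 hf; rewrite (@ge0_integral_density _ _ _ leb _ p)//.
  - by apply: eq_integral => x _; rewrite EFinM fineK.
  - by move=> x; exact: ltW.
rewrite !normE//.
have fg' x y : fine (f x) * fine (g y) <= K * expR ((x - y) ^+ 2 / (s ^+ 2 *+ 4)).
  by rewrite -lee_fin EFinM !fineK.
apply: midpoint_integral_le.
- have : 0 < fine (f x0) * fine (g y0).
    by apply: mulr_gt0; apply: fine_gt0; rewrite ?fx0 ?gy0 ltey_eq ?ff ?gf.
  by move=> /lt_le_trans/(_ (fg' x0 y0)); rewrite pmulr_lgt0// expR_gt0.
- by apply: measurable_funM => //; apply: measurableT_comp mf.
- by apply: measurable_funM => //; apply: measurableT_comp mg.
- by move=> x; rewrite mulr_ge0 ?fine_ge0// ltW.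
- by move=> x; rewrite mulr_ge0 ?fine_ge0// ltW.
- by exists x0; rewrite mulr_gt0// fine_gt0// fx0 ltey_eq ff.
- by exists y0; rewrite mulr_gt0// fine_gt0// gy0 ltey_eq gf.
- move=> x y; rewrite -normal_pdf_midpoint//.
  have := ler_wpM2l (mulr_ge0 (ltW (p0 x)) (ltW (p0 y))) (fg' x y).
  set e := expR _ => h; apply: (le_trans _ (le_trans h _));
    by rewrite le_eqVlt; apply/orP; left; apply/eqP; ring.
Qed.

End normal_tau.

(** * White noise and its symmetries *)

(** Property (tau) of the first factor is applied to the partial integrals. Its hypothesis is
    property (tau) of the second factor at fixed first coordinates, with constant
    [K * expR (q1 x y)]. *)
Lemma property_tau_prod d1 d2 (T1 : measurableType d1) (T2 : measurableType d2)
    (R : realType) (m1 : {sigma_finite_measure set T1 -> \bar R})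
    (m2 : {sigma_finite_measure set T2 -> \bar R}) q1 q2 :
  property_tau m1 q1 -> property_tau m2 q2 ->
  property_tau (m1 \x m2)%E (fun x y => q1 x.1 y.1 + q2 x.2 y.2).
Proof.
move=> tau1 tau2 K f g K0 mf mg f0 g0 fg.
rewrite !fubini_tonelli1//; apply: tau1 => //.
- exact: measurable_fun_fubini_tonelli_F.
- exact: measurable_fun_fubini_tonelli_F.
- by move=> x; exact: integral_ge0.
- by move=> x; exact: integral_ge0.
- move=> x y; apply: tau2.
  + by rewrite mulr_ge0// expR_ge0.
  + exact: (measurableT_comp mf (pair1_measurable x)).
  + exact: (measurableT_comp mg (pair1_measurable y)).
  + by [].
  + by [].
  + by move=> x2 y2; apply: (le_trans (fg _ _)); rewrite expRD mulrA.
Qed.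

Section white_noise.
Context {R : realType}.
Local Notation pl := (measurableTypeR R * measurableTypeR R)%type.

Definition cgauss : probability pl R :=
  (normal_prob 0 (Num.sqrt 2^-1) \x normal_prob 0 (Num.sqrt 2^-1))%E.

Definition cylinder (F : {fset int}) (B : int -> set pl) : set (int -> pl) :=
  \bigcap_(i in [set` F]) (fun x : int -> pl => x i) @^-1` B i.

Definition cylinders : set (set (int -> pl)) :=
  [set A | exists F B, (forall i, measurable (B i)) /\ A = cylinder F B].

Local Notation noise := (g_sigma_algebraType cylinders).

(** Values on cylinders determine the law ([noise_measure_unique]). No infinite product is built:
    the law is obtained in [gaussian_law_white_noise] as an image of the Gaussian measure. *)
Definition is_white_noise (lam : {measure set noise -> \bar R}) :=
  forall F B, (forall i, measurable (B i)) ->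
    lam (cylinder F B) = (\prod_(i <- F) cgauss (B i))%E.

Lemma measurable_cylinder F B : (forall i, measurable (B i)) ->
  measurable (cylinder F B : set noise).
Proof. by move=> mB; apply: sub_sigma_algebra; exists F, B. Qed.

Lemma measurable_coord (i : int) : measurable_fun setT (fun x : noise => x i).
Proof.
move=> _ B mB; rewrite setTI.
rewrite (_ : _ @^-1` _ = cylinder [fset i]%fset (fun=> B)).
  exact: measurable_cylinder.
apply/seteqP; split => x /= => [Bx j /=|/(_ i) /=]; rewrite inE.
  by move=> /eqP ->.
by rewrite eqxx; exact.
Qed.

Lemma measurable_noise d (X : measurableType d) (f : X -> noise) :
  (forall i, measurable_fun setT (fun x => f x i)) -> measurable_fun setT f.
Proof.
move=> mf; apply: (@measurability _ _ _ _ setT f cylinders) => //.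
move=> _ [_ [F [B [mB ->]]] <-]; rewrite setTI preimage_bigcap.
apply: fin_bigcap_measurable; first exact: finite_fset.
by move=> i _; rewrite -[_ @^-1` _]setTI; apply: (mf i).
Qed.

Lemma cylinderI F G B C :
  cylinder F B `&` cylinder G C =
  cylinder (F `|` G)%fset (fun i => (if i \in F then B i else setT) `&`
                                    (if i \in G then C i else setT)).
Proof.
apply/seteqP; split => [x [FB GC] i /= _|x FG]; last split.
- by split; case: ifP => // iF; [exact: FB|exact: GC].
- by move=> i /= iF; have := FG i; rewrite /= inE iF => /(_ isT)[].
- by move=> i /= iG; have := FG i; rewrite /= inE iG orbT => /(_ isT)[].
Qed.

Lemma noise_measure_unique (m1 m2 : {measure set noise -> \bar R}) :
  m1 setT = 1%E ->
  (forall F B, (forall i, measurable (B i)) ->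
     m1 (cylinder F B) = m2 (cylinder F B)) ->
  forall A, measurable A -> m1 A = m2 A.
Proof.
move=> m1T m12; apply: (@measure_unique _ R noise cylinders (fun=> setT)).
- by [].
- move=> _ _ [F [B [mB ->]]] [G [C [mC ->]]]; rewrite cylinderI.
  exists (F `|` G)%fset; eexists; split; last reflexivity.
  by move=> i; apply: measurableI; case: ifP.
- move=> _; exists fset0, (fun=> setT); split=> [_|]; first exact: measurableT.
  by apply/seteqP; split.
- by apply/seteqP; split => // x _; exists 0%N.
- by move=> _ [F [B [mB ->]]]; exact: m12.
- by move=> _; rewrite m1T ltry.
Qed.

(** Replacing one coordinate by an independent copy preserves the law ([law_resample]). This plays
    the role of Fubini in one coordinate of the infinite product. *)
Definition resample (n : int) (z : noise * pl) : noise :=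
  fun i => if i == n then z.2 else z.1 i.

Lemma measurable_resample n : measurable_fun setT (resample n).
Proof.
apply: measurable_noise => i; rewrite /resample; case: eqP => _.
  exact: measurable_snd.
exact: (measurableT_comp (measurable_coord i) measurable_fst).
Qed.

Lemma cylinder_resample n F B : resample n @^-1` cylinder F B =
  cylinder (F `\ n)%fset B `*` (if n \in F then B n else setT).
Proof.
apply/seteqP; split => -[x xi] /=.
  move=> FB; split => [i /=|].
    by rewrite !inE => /andP[/negPf ni iF]; have := FB i iF; rewrite /resample/= ni.
  by case: ifP => // nF; have := FB n nF; rewrite /resample/= eqxx.
move=> [FB nB] i /= iF; rewrite /resample /=; case: eqP => [iE|/eqP ni].
  by move: nB; rewrite -iE iF.
by apply: FB; rewrite /= !inE ni.
Qed.

Section law.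
Variable lam : probability noise R.
Hypothesis lamP : is_white_noise lam.

Lemma noise_transfer d (X : measurableType d) (P : {measure set X -> \bar R})
    (phi : X -> noise) : measurable_fun setT phi ->
  (forall F B, (forall i, measurable (B i)) ->
     P (phi @^-1` cylinder F B) = lam (cylinder F B)) ->
  forall f : noise -> \bar R, measurable_fun setT f -> (forall x, 0 <= f x)%E ->
  (\int[lam]_x f x = \int[P]_x f (phi x))%E.
Proof.
move=> mphi PE f mf f0.
have := ge0_integral_pushforward mphi P measurableT mf (fun x _ => f0 x).
rewrite preimage_setT => <-.
apply: eq_measure_integral => A mA _; apply: noise_measure_unique mA.
  exact: probability_setT.
by move=> F B mB; exact/esym/PE.
Qed.

Lemma law_resample n F B : (forall i, measurable (B i)) ->
  (lam \x cgauss)%E (resample n @^-1` cylinder F B) = lam (cylinder F B).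
Proof.
move=> mB; rewrite cylinder_resample product_measure1E//; last by case: ifP.
  rewrite !lamP//; case: ifPn => [nF|nF].
    by rewrite [RHS](big_fsetD1 n)//= muleC.
  rewrite [X in (_ * X)%E](_ : _ = 1%E) ?mule1; last exact: (probability_setT cgauss).
  by congr bigop.body; rewrite mem_fsetD1.
exact: measurable_cylinder.
Qed.

Lemma integral_resample n (f : noise -> \bar R) : measurable_fun setT f ->
  (forall x, 0 <= f x)%E ->
  (\int[lam]_x f x = \int[lam]_x \int[cgauss]_xi f (resample n (x, xi)))%E.
Proof.
move=> mf f0.
rewrite (@noise_transfer _ _ (lam \x cgauss)%E _ (measurable_resample n) _ _ mf f0).
  by rewrite fubini_tonelli1//; exact: (measurableT_comp mf (measurable_resample n)).
by move=> F B; exact: law_resample.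
Qed.

Lemma measurable_integral_resample n (f : noise -> \bar R) :
  measurable_fun setT f -> (forall x, 0 <= f x)%E ->
  measurable_fun setT (fun x => \int[cgauss]_xi f (resample n (x, xi)))%E.
Proof.
move=> mf f0.
exact: (@measurable_fun_fubini_tonelli_F _ _ _ _ R cgauss _
  (measurableT_comp mf (measurable_resample n)) (fun z => f0 _)).
Qed.

Lemma cgauss_property_tau : property_tau cgauss
  (fun x y => (x.1 - y.1) ^+ 2 / 2 + (x.2 - y.2) ^+ 2 / 2).
Proof.
have s0 : Num.sqrt 2^-1 != 0 :> R by rewrite gt_eqF// sqrtr_gt0 invr_gt0.
have := property_tau_prod (@normal_property_tau R _ s0) (@normal_property_tau R _ s0).
by rewrite (_ : Num.sqrt 2^-1 ^+ 2 *+ 4 = 2 :> R)// sqr_sqrtr//; lra.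
Qed.

(** Induction on the list, integrating out one coordinate at a time as in [property_tau_prod]. The
    functions may depend on all coordinates: for the empty list the hypothesis is the pointwise
    bound [f x * g y <= K], which is integrated against two probability measures. *)
Lemma white_noise_property_tau (s : seq int) : uniq s -> property_tau lam
  (fun x y => \sum_(n <- s) (((x n).1 - (y n).1) ^+ 2 / 2 +
                             ((x n).2 - (y n).2) ^+ 2 / 2)).
Proof.
elim: s => [_|n s IH /= /andP[ns us]] K f g K0 mf mg f0 g0 fg.
  have {}fg x y : (f x * g y <= K%:E)%E.
    by apply: le_trans (fg x y) _; rewrite big_nil expR0 mulr1.
  have fG x : (f x * \int[lam]_y g y <= K%:E)%E.
    rewrite -ge0_integralZl//.
    apply: (@le_trans _ _ (\int[lam]_y cst K%:E y)%E).
      apply: ge0_le_integral => //; first by move=> y _; exact: mule_ge0.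
      exact: measurable_funeM.
    by rewrite integral_cst// [X in (_ * X)%E](_ : _ = 1%E) ?mule1//; exact: (probability_setT lam).
  rewrite -ge0_integralZr//; last exact: integral_ge0.
  apply: (@le_trans _ _ (\int[lam]_y cst K%:E y)%E).
    apply: ge0_le_integral => //.
      by move=> y _; rewrite mule_ge0//; exact: integral_ge0.
    by apply: emeasurable_funM => //; exact: measurable_cst.
  by rewrite integral_cst// [X in (_ * X)%E](_ : _ = 1%E) ?mule1//; exact: (probability_setT lam).
rewrite (integral_resample n mf f0) (integral_resample n mg g0).
apply: (IH us) => //.
- exact: measurable_integral_resample.
- exact: measurable_integral_resample.
- by move=> x; exact: integral_ge0.
- by move=> x; exact: integral_ge0.
move=> x y.
have mpr (z : noise) (h : noise -> \bar R) : measurable_fun setT h ->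
    measurable_fun setT (fun xi => h (resample n (z, xi))).
  move=> mh; apply: (measurableT_comp mh).
  exact: (measurableT_comp (measurable_resample n) (pair1_measurable z)).
apply: cgauss_property_tau => //.
- by rewrite mulr_ge0 ?expR_ge0.
- exact: mpr.
- exact: mpr.
move=> xi eta; apply: le_trans (fg _ _) _.
rewrite big_cons lee_fin {1 2 3 4}/resample /= eqxx.
rewrite (@eq_big_seq _ _ _ _ _ _ (fun m => ((x m).1 - (y m).1) ^+ 2 / 2 +
  ((x m).2 - (y m).2) ^+ 2 / 2)) => [|m ms].
  by rewrite [X in expR X]addrC expRD mulrA.
by rewrite /resample; case: eqP ms => // ->; rewrite (negPf ns).
Qed.

End law.
End white_noise.

(** * Complex-valued random variables *)

Section complex_measurability.
Context d (T : measurableType d) (R : realType).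
Implicit Types f g : T -> R[i].

Definition cmeasurable f := measurable_fun setT (fun x => complex.Re (f x)) /\
  measurable_fun setT (fun x => complex.Im (f x)).

Lemma cmeasurable_cst (z : R[i]) : cmeasurable (fun=> z).
Proof. by split; exact: measurable_cst. Qed.

Lemma cmeasurableM f g : cmeasurable f -> cmeasurable g ->
  cmeasurable (fun x => f x * g x).
Proof.
move=> [f1 f2] [g1 g2]; split.
  rewrite (_ : (fun x => _) = (fun x => complex.Re (f x) * complex.Re (g x) -
      complex.Im (f x) * complex.Im (g x))); last first.
    by apply/funext => x; case: (f x) (g x) => ? ? [].
  by apply: measurable_funB; exact: measurable_funM.
rewrite (_ : (fun x => _) = (fun x => complex.Re (f x) * complex.Im (g x) +
    complex.Im (f x) * complex.Re (g x))); last first.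
  by apply/funext => x; case: (f x) (g x) => ? ? [].
by apply: measurable_funD; exact: measurable_funM.
Qed.

Lemma cmeasurableD f g : cmeasurable f -> cmeasurable g ->
  cmeasurable (fun x => f x + g x).
Proof.
move=> [f1 f2] [g1 g2]; split.
  rewrite (_ : (fun x => _) = (fun x => complex.Re (f x) + complex.Re (g x))).
    exact: measurable_funD.
  by apply/funext => x; case: (f x) (g x) => ? ? [].
rewrite (_ : (fun x => _) = (fun x => complex.Im (f x) + complex.Im (g x))).
  exact: measurable_funD.
by apply/funext => x; case: (f x) (g x) => ? ? [].
Qed.

Lemma cmeasurableJ f : cmeasurable f -> cmeasurable (fun x => conjc (f x)).
Proof.
move=> [f1 f2]; split.
  rewrite (_ : (fun x => _) = (fun x => complex.Re (f x)))//.
  by apply/funext => x; case: (f x).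
rewrite (_ : (fun x => _) = (fun x => - complex.Im (f x))).
  exact: measurableT_comp.
by apply/funext => x; case: (f x).
Qed.

Lemma cmeasurable_sum (I : Type) (r : seq I) (P : pred I) (F : I -> T -> R[i]) :
  (forall i, P i -> cmeasurable (F i)) ->
  cmeasurable (fun x => \sum_(i <- r | P i) F i x).
Proof.
move=> mF; elim: r => [|i r IH].
  by under eq_fun do rewrite big_nil; exact: cmeasurable_cst.
have [Pi|/negPf Pi] := boolP (P i); under eq_fun do rewrite big_cons Pi; last by [].
by apply: cmeasurableD => //; exact: mF.
Qed.

Lemma measurable_normc2 f : cmeasurable f ->
  measurable_fun setT (fun x => normc (f x) ^+ 2).
Proof.
move=> [f1 f2].
rewrite (_ : (fun x => _) = (fun x => complex.Re (f x) ^+ 2 + complex.Im (f x) ^+ 2)).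
  by apply: measurable_funD; exact: measurable_funX.
apply/funext => x; case: (f x) => a b /=.
by rewrite sqr_sqrtr// addr_ge0// sqr_ge0.
Qed.

End complex_measurability.

Section complex_algebra.
Context {R : realType}.
Implicit Types x y z : R[i].

(** The real inner product of the plane, that is, the real part of [x * conjc y]. *)
Definition dotc x y : R :=
  complex.Re x * complex.Re y + complex.Im x * complex.Im y.

Lemma normc_ge0 x : 0 <= normc x.
Proof. by case: x => a b; exact: sqrtr_ge0. Qed.

Lemma normc_sqr x : normc x ^+ 2 = dotc x x.
Proof.
by case: x => a b /=; rewrite sqr_sqrtr ?addr_ge0 ?sqr_ge0// /dotc/= !expr2.
Qed.

Lemma dotc_le x y : `|dotc x y| <= (normc x ^+ 2 + normc y ^+ 2) / 2.
Proof.
rewrite !normc_sqr /dotc ler_norml; case: x y => a b [c d] /=.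
have := sqr_ge0 (a + c); have := sqr_ge0 (b + d).
have := sqr_ge0 (a - c); have := sqr_ge0 (b - d).
by nra.
Qed.

Lemma normc_sqr_sum (I : finType) (F : I -> R[i]) :
  normc (\sum_i F i) ^+ 2 = \sum_i \sum_j dotc (F i) (F j).
Proof.
rewrite normc_sqr {1}/dotc !raddf_sum /= !big_distrlr -big_split /=.
by apply: eq_bigr => i _; rewrite -big_split.
Qed.

Lemma dotcNl x y : dotc (- x) y = - dotc x y.
Proof. by case: x y => a b [c d]; rewrite /dotc/= !mulNr opprD. Qed.

Lemma dotcC x y : dotc x y = dotc y x.
Proof. by rewrite /dotc ![complex.Re x * _]mulrC ![complex.Im x * _]mulrC. Qed.

Lemma dotcNr x y : dotc x (- y) = - dotc x y.
Proof. by rewrite dotcC dotcNl dotcC. Qed.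

Lemma dotc0l x : dotc 0 x = 0.
Proof. by rewrite /dotc !mul0r addr0. Qed.

End complex_algebra.

(** * Orthogonality from symmetries of the noise *)

Section symmetries.
Context {R : realType}.
Local Notation pl := (measurableTypeR R * measurableTypeR R)%type.
Local Notation noise := (g_sigma_algebraType (@cylinders R)).
Variable lam : probability noise R.
Hypothesis lamP : is_white_noise lam.

Definition noise_symmetry (phi : noise -> noise) :=
  measurable_fun setT phi /\ forall F B, (forall i, measurable (B i)) ->
    lam (phi @^-1` cylinder F B) = lam (cylinder F B).

Lemma integral_symmetry phi (f : noise -> \bar R) : noise_symmetry phi ->
  measurable_fun setT f -> (forall x, 0 <= f x)%E ->
  (\int[lam]_x f (phi x) = \int[lam]_x f x)%E.
Proof.
by move=> [mphi lamphi] mf f0; rewrite (noise_transfer mphi lamphi mf f0).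
Qed.

(** A symmetry of the law that reverses the sign of [dotc (X i) (X j)] makes its mean vanish. After
    expansion of the square only [j = i] and [j = s i] survive, hence the factor 2. The map [s]
    records the pairs that no such symmetry separates: the exchange of [n1] and [n2], or the
    reflection of [n]. *)
Lemma orthogonal_second_moment (I : finType) (X : I -> noise -> R[i])
    (s : I -> I) (v : I -> R) :
  (forall i, cmeasurable (X i)) ->
  (forall i, \int[lam]_x (normc (X i x) ^+ 2)%:E <= (v i)%:E)%E ->
  injective s ->
  (forall i j, j != i -> j != s i -> exists2 phi, noise_symmetry phi &
    forall x, dotc (X i (phi x)) (X j (phi x)) = - dotc (X i x) (X j x)) ->
  (\int[lam]_x (normc (\sum_i X i x) ^+ 2)%:E <= (2 * \sum_i v i)%:E)%E.
Proof.
move=> mX Xv sinj ort.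
pose rel (p : I * I) := (p.2 == p.1) || (p.2 == s p.1).
pose D (p : I * I) x := dotc (X p.1 x) (X p.2 x).
have mD p : measurable_fun setT (D p).
  have [[? ?] [? ?]] := (mX p.1, mX p.2).
  by apply: measurable_funD; exact: measurable_funM.
(* Working with positive and negative parts keeps all integrands nonnegative; the symmetry exchanges
   the two parts. *)
pose pos p x := Num.max (D p x) 0; pose neg p x := Num.max (- D p x) 0.
have pos0 p x : 0 <= pos p x by rewrite le_max lexx orbT.
have neg0 p x : 0 <= neg p x by rewrite le_max lexx orbT.
have mpos p : measurable_fun setT (pos p).
  by apply: measurable_maxr; [exact: mD|exact: measurable_cst].
have mneg p : measurable_fun setT (neg p).
  apply: measurable_maxr; last exact: measurable_cst.
  by apply: measurableT_comp => //; exact: mD.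
have posneg p x : D p x = pos p x - neg p x.
  by rewrite /pos /neg; case: leP => ?; case: leP => ?; lra.
have mn2 i : measurable_fun setT (fun x => (normc (X i x) ^+ 2)%:E).
  exact/measurable_EFinP/measurable_normc2.
have posneg_int p : ~~ rel p ->
    (\int[lam]_x (pos p x)%:E = \int[lam]_x (neg p x)%:E)%E.
  rewrite negb_or => /andP[p1 p2]; have [phi phis Dphi] := ort _ _ p1 p2.
  rewrite -(@integral_symmetry _ (EFin \o pos p) phis).
  - by apply: eq_integral => x _; rewrite /= /pos /neg /D Dphi.
  - exact/measurable_EFinP.
  - by move=> x; rewrite lee_fin.
have neg_fin p : (\int[lam]_x (neg p x)%:E < +oo)%E.
  apply: (@le_lt_trans _ _ (\int[lam]_x ((normc (X p.1 x) ^+ 2)%:E +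
     (normc (X p.2 x) ^+ 2)%:E))%E).
    apply: ge0_le_integral => //.
    - by move=> x _; rewrite lee_fin.
    - exact/measurable_EFinP.
    - exact: emeasurable_funD.
    - move=> x _; rewrite -EFinD lee_fin /neg ge_max addr_ge0 ?sqr_ge0// andbT.
      apply: (le_trans (ler_norm _)); rewrite normrN.
      apply: (le_trans (dotc_le _ _)).
      have := sqr_ge0 (normc (X p.1 x)); have := sqr_ge0 (normc (X p.2 x)); lra.
  rewrite ge0_integralD//; try by move=> x _; rewrite lee_fin sqr_ge0.
  by apply: lte_add_pinfty; apply: le_lt_trans (Xv _) (ltry _).
pose L := [seq p <- index_enum (I * I)%type | ~~ rel p].
have LP p : p \in L -> ~~ rel p by rewrite mem_filter => /andP[].
have nn (i : I) x : (0 <= (normc (X i x) ^+ 2)%:E)%E by rewrite lee_fin sqr_ge0.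
have msum : measurable_fun setT (fun x => (normc (\sum_i X i x) ^+ 2)%:E).
  have mS : cmeasurable (fun x => \sum_i X i x) by exact: cmeasurable_sum.
  by apply/measurable_EFinP; exact: (measurable_normc2 mS).
(* By [dotc_le], [W i] bounds the diagonal product plus the one with [s i]: 1 + 1/2 of the square of
   [X i] and 1/2 of that of [X (s i)]. *)
pose W i x := ((normc (X i x) ^+ 2)%:E * (3 / 2)%:E +
        (normc (X (s i) x) ^+ 2)%:E * (1 / 2)%:E)%E.
have W0 i x : (0 <= W i x)%E by rewrite adde_ge0// mule_ge0// lee_fin; lra.
have mW i : measurable_fun setT (W i).
  by apply: emeasurable_funD; apply: emeasurable_funM => //; exact: measurable_cst.
have mposE p : measurable_fun setT (fun x => (pos p x)%:E) by exact/measurable_EFinP.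
have mnegE p : measurable_fun setT (fun x => (neg p x)%:E) by exact/measurable_EFinP.
have key : (\int[lam]_x ((normc (\sum_i X i x) ^+ 2)%:E +
      \sum_(p <- L) (neg p x)%:E) <=
    \int[lam]_x (\sum_(i <- index_enum I) W i x + \sum_(p <- L) (pos p x)%:E))%E.
  apply: ge0_le_integral => //.
  - move=> x _; apply: adde_ge0; first by rewrite lee_fin sqr_ge0.
    by apply: sume_ge0 => p _; rewrite lee_fin.
  - by apply: emeasurable_funD => //; exact: emeasurable_sum.
  - by apply: emeasurable_funD; exact: emeasurable_sum.
  move=> x _; rewrite /W.
  under [X in (_ <= X + _)%E]eq_bigr do rewrite -!EFinM -EFinD.
  rewrite !sumEFin -!EFinD lee_fin.
  rewrite normc_sqr_sum pair_big /= (bigID rel) /= -addrA.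
  have -> : \sum_(p | ~~ rel p) dotc (X p.1 x) (X p.2 x) =
      \sum_(p <- L) pos p x - \sum_(p <- L) neg p x.
    by rewrite -sumrB big_filter; apply: eq_bigr => p _; exact: posneg.
  rewrite subrK lerD2r.
  apply: (@le_trans _ _ (\sum_(p | rel p) `|D p x|)).
    by apply: ler_sum => p _; exact: ler_norm.
  have -> : \sum_(p | rel p) `|D p x| =
      \sum_i \sum_(j | rel (i, j)) `|D (i, j) x|.
    by rewrite pair_big_dep; apply: eq_big => -[].
  apply: ler_sum => i _.
  apply: (@le_trans _ _ (`|D (i, i) x| + `|D (i, s i) x|)).
    rewrite (bigD1 i) /rel ?eqxx//= lerD2l.
    have [si|si] := eqVneq (s i) i.
      by rewrite big1 // => j; rewrite si orbb andbN.
    rewrite (bigD1 (s i)) ?eqxx ?orbT//= big1 ?addr0// => j.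
    by case/andP=> /andP[/orP[]/eqP-> //]; rewrite ?eqxx.
  have := dotc_le (X i x) (X i x); have := dotc_le (X i x) (X (s i) x).
  by rewrite /D /=; lra.
move: key; rewrite ge0_integralD//; first last.
- exact: emeasurable_sum.
- by move=> x _; apply: sume_ge0 => p _; rewrite lee_fin.
- by move=> x _; rewrite lee_fin sqr_ge0.
rewrite ge0_integralD//; first last.
- exact: emeasurable_sum.
- by move=> x _; apply: sume_ge0 => p _; rewrite lee_fin.
- exact: emeasurable_sum.
- by move=> x _; exact: sume_ge0.
rewrite !ge0_integral_sum//; try by move=> *; rewrite lee_fin.
rewrite (eq_big_seq _ (fun p pL => posneg_int p (LP p pL))).
(* The off-diagonal parts have equal integrals on both sides and cancel because these are finite. *)
rewrite leeD2rE; last first.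
  rewrite sum_fin_num; apply/allP => _ /mapP[p pL ->].
  have : (0 <= \int[lam]_x (neg p x)%:E)%E.
    by apply: integral_ge0 => x _; rewrite lee_fin.
  by move=> /ge0_fin_numE h; exact: etrans h (neg_fin p).
move=> /le_trans; apply.
apply: (@le_trans _ _ (\sum_i ((v i)%:E * (3 / 2)%:E + (v (s i))%:E * (1 / 2)%:E)))%E.
  apply: lee_sum => i _; rewrite ge0_integralD//; first last.
  - by apply: emeasurable_funM => //; exact: measurable_cst.
  - by move=> x _; rewrite mule_ge0// lee_fin; lra.
  - by apply: emeasurable_funM => //; exact: measurable_cst.
  - by move=> x _; rewrite mule_ge0// lee_fin; lra.
  by rewrite !ge0_integralZr//; (try by rewrite lee_fin; lra);
    apply: leeD; apply: lee_wpmul2r => //; rewrite lee_fin; lra.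
under eq_bigr do rewrite -!EFinM -EFinD.
rewrite sumEFin lee_fin big_split/= -!mulr_suml.
have <- : \sum_i v i = \sum_i v (s i) by rewrite (reindex_inj sinj).
lra.
Qed.

End symmetries.

Section gaussian_symmetry.
Context {R : realType}.
Local Notation leb := (@lebesgue_measure R).
Local Notation pl := (measurableTypeR R * measurableTypeR R)%type.

Lemma normal_probN (s : R) (A : set (measurableTypeR R)) : s != 0 ->
  measurable A ->
  normal_prob 0 s (-%R @^-1` A) = normal_prob 0 s A.
Proof.
move=> s0 mA; rewrite /normal_prob.
have mN : measurable_fun setT (-%R : measurableTypeR R -> measurableTypeR R).
  exact: measurable_funN.
have mp : measurable_fun A (fun x => (normal_pdf 0 s x)%:E).
  by apply: measurable_funTS; apply/measurable_EFinP; exact: measurable_normal_pdf.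
have p0 : {in A, forall y, (0 <= (normal_pdf 0 s y)%:E)%E}.
  by move=> y _; rewrite lee_fin normal_pdf_ge0.
have := ge0_integral_pushforward mN leb mA mp p0.
move=> h; transitivity (\int[leb]_(x in -%R @^-1` A)
    ((fun y => (normal_pdf 0 s y)%:E) \o -%R) x)%E.
  apply: eq_integral => x _; rewrite /= !normal_pdfE// /normal_fun !subr0.
  by rewrite sqrrN.
rewrite -h; apply: eq_measure_integral => B mB _; exact: lebesgue_measureN.
Qed.

Definition flip (b : bool) (z : pl) : pl := if b then (- z.1, - z.2) else z.

Lemma measurable_flip b : measurable_fun setT (flip b).
Proof.
case: b; last exact: measurable_id.
by apply: measurable_fun_pair; apply: measurable_funN.
Qed.

Lemma cgauss_flip b (A : set pl) : measurable A ->
  cgauss (flip b @^-1` A) = cgauss A.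
Proof.
case: b => mA; last by [].
have s0 : Num.sqrt 2^-1 != 0 :> R by rewrite gt_eqF// sqrtr_gt0 invr_gt0.
pose f : {mfun pl >-> pl} := mfun_Sub (mem_set (measurable_flip true)).
pose N := normal_prob (0 : R) (Num.sqrt 2^-1).
have mN (B : set (measurableTypeR R)) : measurable B -> measurable (-%R @^-1` B).
  by move=> mB; rewrite -[_ @^-1` _]setTI; apply: measurable_funN.
have h := @product_measure_unique _ _ _ _ R N N (pushforward (N \x N)%E f).
apply/esym/h => // A1 A2 mA1 mA2.
transitivity ((N \x N)%E ((-%R @^-1` A1) `*` (-%R @^-1` A2))); first by [].
rewrite product_measure1E; [|exact: mN|exact: mN].
by congr (_ * _)%E; exact: normal_probN.
Qed.

End gaussian_symmetry.

Section noise_symmetries.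
Context {R : realType}.
Local Notation pl := (measurableTypeR R * measurableTypeR R)%type.
Local Notation noise := (g_sigma_algebraType (@cylinders R)).
Variable lam : probability noise R.
Hypothesis lamP : is_white_noise lam.

(** All symmetries in use are of this type. Sign changes detect only how often, modulo 2, a
    frequency occurs in a monomial, which is why [triad_parity] is a statement about parities. *)
Lemma noise_symmetry_signed_perm (p q : int -> int) (e : int -> bool) :
  cancel p q -> cancel q p ->
  noise_symmetry lam (fun x i => flip (e i) (x (p i))).
Proof.
move=> pq qp; split.
  apply: measurable_noise => i.
  exact: (measurableT_comp (measurable_flip (e i)) (measurable_coord (p i))).
move=> F B mB.
pose C j := flip (e (q j)) @^-1` B (q j).
have mC j : measurable (C j).
  by rewrite -[C j]setTI; apply: measurable_flip.
have -> : (fun (x : noise) i => flip (e i) (x (p i))) @^-1` cylinder F B =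
    cylinder [fset p i | i in F]%fset C.
  apply/seteqP; split => x /= FB.
    by move=> _ /= /imfsetP[i /= iF ->]; rewrite /C /= pq; exact: FB.
  move=> i /= iF; have := FB (p i); rewrite /C /= pq; apply.
  by apply/imfsetP; exists i.
rewrite (lamP _ mB) (lamP _ mC) big_imfset /=; last by move=> i j _ _ /(can_inj pq).
by apply: eq_bigr => i _; rewrite /C pq cgauss_flip.
Qed.

Definition flip_at (j : int) (x : noise) : noise := fun i => flip (i == j) (x i).

Lemma noise_symmetry_flip_at j : noise_symmetry lam (flip_at j).
Proof. exact: (@noise_symmetry_signed_perm id id (fun i => i == j)). Qed.

Definition swap_at (j : int) (x : noise) : noise :=
  fun i => x (if `|i|%N == `|j|%N then - i else i).

Lemma noise_symmetry_swap_at j : noise_symmetry lam (swap_at j).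
Proof.
pose p (i : int) := if `|i|%N == `|j|%N then - i else i.
have pp : involutive p.
  by move=> i; rewrite /p; case ij : (`|i|%N == `|j|%N); rewrite ?abszN ij ?opprK.
exact: (@noise_symmetry_signed_perm p p (fun=> false)).
Qed.

Definition reflect_noise (x : noise) : noise := fun i => x (- i).

Lemma noise_symmetry_reflect : noise_symmetry lam reflect_noise.
Proof.
exact: (@noise_symmetry_signed_perm -%R -%R (fun=> false) (@opprK _) (@opprK _)).
Qed.

Lemma integral_coord (n : int) (f : pl -> \bar R) : measurable_fun setT f ->
  (forall z, 0 <= f z)%E -> (\int[lam]_x f (x n) = \int[cgauss]_z f z)%E.
Proof.
move=> mf f0.
have mfn : measurable_fun setT (fun x : noise => f (x n)).
  exact: (measurableT_comp mf (measurable_coord n)).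
rewrite (integral_resample lamP n mfn) => [|x]; last exact: f0.
under eq_integral => x _.
  rewrite (_ : (\int[cgauss]_xi f (resample n (x, xi) n))%E =
      (\int[cgauss]_z f z)%E).
  over.
  by apply: eq_integral => z _; rewrite /resample eqxx.
rewrite integral_cst// [X in (_ * X)%E](_ : _ = 1%E) ?mule1//.
exact: (probability_setT lam).
Qed.

Definition zc (n : int) (x : noise) : R[i] := Complex (x n).1 (x n).2.

Lemma cmeasurable_zc n : cmeasurable (zc n).
Proof.
split; first exact: (measurableT_comp measurable_fst (measurable_coord n)).
exact: (measurableT_comp measurable_snd (measurable_coord n)).
Qed.

Lemma normc_zc n x : normc (zc n x) ^+ 2 = (x n).1 ^+ 2 + (x n).2 ^+ 2.
Proof. by rewrite normc_sqr /dotc /= !expr2. Qed.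

(** For variance 1/2 the density decays like [expR (- x ^+ 2)]; the product with [expR (x ^+ 2 / 2)]
    is a multiple of the standard normal density. *)
Lemma normal_expR_moment :
  (\int[normal_prob (0 : R) (Num.sqrt 2^-1)]_x (expR (x ^+ 2 / 2))%:E < +oo)%E.
Proof.
have s0 : Num.sqrt 2^-1 != 0 :> R by rewrite gt_eqF// sqrtr_gt0 invr_gt0.
set s : R := Num.sqrt 2^-1.
have s2 : s ^+ 2 = 2^-1 by rewrite sqr_sqrtr// invr_ge0.
have mexp : measurable_fun setT (fun x : R => (expR (x ^+ 2 / 2))%:E).
  apply/measurable_EFinP; apply: measurableT_comp => //.
  by apply: measurable_funM => //; exact: measurable_funX.
rewrite (@ge0_integral_density _ _ _ lebesgue_measure _ (normal_pdf 0 s))//.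
- have E (x : R) : ((expR (x ^+ 2 / 2))%:E * (normal_pdf 0 s x)%:E =
     (normal_peak s / normal_peak 1)%:E * (normal_pdf 0 1 x)%:E)%E.
    rewrite -!EFinM !normal_pdfE ?oner_eq0// /normal_fun !subr0 s2 expr1n.
    congr (_%:E); have p1 : normal_peak (1 : R) != 0.
      by rewrite gt_eqF// normal_peak_gt0 ?oner_eq0.
    rewrite [RHS]mulrA divfK// [LHS]mulrCA -expRD; congr (_ * expR _).
    by field.
  under eq_integral do rewrite E.
  rewrite ge0_integralZl//; last 3 first.
  + by apply/measurable_EFinP; exact: measurable_normal_pdf.
  + by move=> x _; rewrite lee_fin normal_pdf_ge0.
  + by rewrite lee_fin divr_ge0// normal_peak_ge0.
  by rewrite integral_normal_pdf mule1 ltry.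
- by move=> x; exact: normal_pdf_ge0.
- exact: measurable_normal_pdf.
Qed.

(** The cube is what the square of a cubic monomial requires after the inequality of the arithmetic
    and geometric means. It is dominated through [1 + t <= 6 * expR (t / 6)], whose cube splits over
    the real and imaginary parts. *)
Lemma noise_moment : exists2 C : R, 0 < C & forall n,
  (\int[lam]_x ((1 + normc (zc n x) ^+ 2) ^+ 3)%:E <= C%:E)%E.
Proof.
pose E := (\int[normal_prob (0:R) (Num.sqrt 2^-1)]_x (expR (x ^+ 2 / 2))%:E)%E.
have mexpR : measurable_fun setT (fun x : R => expR (x ^+ 2 / 2)).
  apply: measurableT_comp => //.
  by apply: measurable_funM => //; exact: measurable_funX.
have mexp : measurable_fun setT (fun x : R => (expR (x ^+ 2 / 2))%:E).
  exact/measurable_EFinP.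
have E0 : (0 <= E)%E by apply: integral_ge0 => x _; rewrite lee_fin expR_ge0.
have EE : E = (fine E)%:E by rewrite fineK// ge0_fin_numE//; exact: normal_expR_moment.
have e0 : 0 <= fine E by exact: fine_ge0.
exists (6 ^+ 3 * (fine E * fine E) + 1).
  by rewrite ltr_wpDl ?mulr_ge0 ?exprn_ge0.
move=> n.
pose g (z : pl) : \bar R := (6 ^+ 3 * (expR (z.1 ^+ 2 / 2) * expR (z.2 ^+ 2 / 2)))%:E.
have mexp1 : measurable_fun setT (fun z : pl => expR (z.1 ^+ 2 / 2)).
  exact: (measurableT_comp mexpR measurable_fst).
have mexp2 : measurable_fun setT (fun z : pl => expR (z.2 ^+ 2 / 2)).
  exact: (measurableT_comp mexpR measurable_snd).
have mg : measurable_fun setT g.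
  by apply/measurable_EFinP; apply: measurable_funM => //; exact: measurable_funM.
have g0 z : (0 <= g z)%E by rewrite lee_fin !mulr_ge0 ?exprn_ge0 ?expR_ge0.
apply: (@le_trans _ _ (\int[lam]_x g (x n))%E).
  apply: ge0_le_integral => //.
  - by move=> x _; rewrite lee_fin exprn_ge0// addr_ge0// sqr_ge0.
  - apply/measurable_EFinP; apply: measurable_funX; apply: measurable_funD => //.
    exact: (measurable_normc2 (cmeasurable_zc n)).
  - exact: (measurableT_comp mg (measurable_coord n)).
  move=> x _; rewrite lee_fin normc_zc -expRD.
  set t := _ ^+ 2 + _; have t0 : 0 <= t by rewrite addr_ge0// sqr_ge0.
  have -> : (x n).1 ^+ 2 / 2 + (x n).2 ^+ 2 / 2 = 3%:R * (t / 6) by rewrite /t; field.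
  rewrite expRM_natl.
  have te : 1 + t <= 6 * expR (t / 6) by have := expR_ge1Dx (t / 6); lra.
  rewrite -exprMn; apply: lerXn2r => //; rewrite nnegrE; first by rewrite addr_ge0.
  by apply: le_trans te; rewrite addr_ge0.
rewrite (integral_coord n mg g0) /cgauss fubini_tonelli1//.
have -> : (\int[normal_prob (0 : R) (Num.sqrt 2^-1)]_x
    fubini_F (normal_prob (0 : R) (Num.sqrt 2^-1)) g x =
    \int[normal_prob (0 : R) (Num.sqrt 2^-1)]_x ((6 ^+ 3)%:E * E * (expR (x ^+ 2 / 2))%:E))%E.
  apply: eq_integral => x _; rewrite /fubini_F /g /=.
  under eq_integral do rewrite mulrA EFinM.
  rewrite ge0_integralZl//.
  by rewrite -/E EFinM muleAC.
rewrite ge0_integralZl//; last by rewrite mule_ge0// lee_fin exprn_ge0.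
by rewrite -/E EE -!EFinM lee_fin -mulrA lerDl.
Qed.

End noise_symmetries.

(** * Bounds on the quartic form *)

Section normc_lemmas.
Context {R : realType}.
Implicit Types x y z : R[i].

Lemma normcJ x : normc (conjc x) = normc x.
Proof. by case: x => a b /=; rewrite sqrrN. Qed.

Lemma normc_real (r : R) : normc (r%:C)%C = `|r|.
Proof. by rewrite /= expr0n addr0 sqrtr_sqr. Qed.

Lemma normc_int (n : int) : normc (n%:~R : R[i]) = `|n%:~R|.
Proof. by rewrite -(rmorph_int (real_complex R)) normc_real. Qed.

Lemma Re_le_normc x : complex.Re x <= normc x.
Proof.
case: x => a b /=; apply: (le_trans (ler_norm a)).
by rewrite -sqrtr_sqr ler_wsqrtr// lerDl sqr_ge0.
Qed.

Lemma normc_sum (J : Type) (r : seq J) (P : pred J) (F : J -> R[i]) :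
  normc (\sum_(j <- r | P j) F j) <= \sum_(j <- r | P j) normc (F j).
Proof.
elim/big_rec2: _ => [|j u v _ IH]; first by rewrite ComplexField.Normc.normc0.
by apply: (le_trans (le_normcD _ _)); rewrite lerD2l.
Qed.

Lemma mulc_conj x : x * conjc x = ((normc x ^+ 2)%:C)%C.
Proof.
rewrite normc_sqr /dotc; case: x => a b; apply/eqP; rewrite eq_complex /=.
by apply/andP; split; apply/eqP; ring.
Qed.

Lemma normc_sqrD x y : normc (x + y) ^+ 2 <= 2 * normc x ^+ 2 + 2 * normc y ^+ 2.
Proof.
have : normc (x + y) ^+ 2 <= (normc x + normc y) ^+ 2.
  by rewrite ler_sqr ?nnegrE ?addr_ge0 ?normc_ge0 ?le_normcD.
by have := sqr_ge0 (normc x - normc y); lra.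
Qed.

End normc_lemmas.

Section finite_sums.
Context {R : realType}.

Lemma sum_cauchy_schwarz (J : finType) (P : pred J) (f g : J -> R) :
  (\sum_(j | P j) f j * g j) ^+ 2 <=
  (\sum_(j | P j) f j ^+ 2) * (\sum_(j | P j) g j ^+ 2).
Proof.
set C := \sum_(j | P j) f j * g j; set A := \sum_(j | P j) f j ^+ 2.
set B := \sum_(j | P j) g j ^+ 2.
have B0 : 0 <= B by apply: sumr_ge0 => j _; exact: sqr_ge0.
have key : 0 <= B * (A * B - C ^+ 2).
  have -> : B * (A * B - C ^+ 2) = \sum_(j | P j) (B * f j - C * g j) ^+ 2.
    have -> : \sum_(j | P j) (B * f j - C * g j) ^+ 2 =
        \sum_(j | P j) (B ^+ 2 * f j ^+ 2 - (2 * B * C) * (f j * g j) +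
                        C ^+ 2 * g j ^+ 2).
      by apply: eq_bigr => j _; ring.
    by rewrite big_split sumrB /= -!mulr_sumr -/A -/B -/C; ring.
  by apply: sumr_ge0 => j _; exact: sqr_ge0.
move: B0; rewrite le_eqVlt => /orP[/eqP B0|B0].
  have g0 j : P j -> g j = 0.
    move=> Pj; apply/eqP; rewrite -sqrf_eq0; move/esym/eqP: B0.
    by rewrite psumr_eq0 => [/allP/(_ j (mem_index_enum j))|? _]; rewrite ?Pj ?sqr_ge0.
  by rewrite /C big1 ?expr0n ?mulr_ge0 ?sumr_ge0// => j Pj; rewrite ?g0 ?mulr0 ?sqr_ge0.
by move: key; rewrite pmulr_rge0// subr_ge0.
Qed.

Variable I : finType.
Implicit Types x y z t : I -> R.

Definition l1 x : R := \sum_i x i.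
Definition l2 x : R := Num.sqrt (\sum_i x i ^+ 2).

Lemma l2_ge0 x : 0 <= l2 x. Proof. exact: sqrtr_ge0. Qed.

Lemma l1_ge0 x : (forall i, 0 <= x i) -> 0 <= l1 x.
Proof. by move=> x0; apply: sumr_ge0. Qed.

Lemma sqr_l2 x : l2 x ^+ 2 = \sum_i x i ^+ 2.
Proof. by rewrite sqr_sqrtr// sumr_ge0// => i _; exact: sqr_ge0. Qed.

Lemma l2_le x (c : R) : 0 <= c -> \sum_i x i ^+ 2 <= c ^+ 2 -> l2 x <= c.
Proof. by move=> c0 xc; rewrite -(ger0_norm c0) -sqrtr_sqr ler_wsqrtr. Qed.

Lemma sum_mul_le_l2 x y : \sum_i x i * y i <= l2 x * l2 y.
Proof.
rewrite -sqrtrM ?sumr_ge0// => [|i _]; last exact: sqr_ge0.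
by apply: (le_trans (ler_norm _)); rewrite -sqrtr_sqr ler_wsqrtr// sum_cauchy_schwarz.
Qed.

(** The relation is a partial matching, so Cauchy-Schwarz over its edges counts each index at most
    once on either side. *)
Lemma sum_matching_le (e : rel I) x z :
  (forall i k k', e i k -> e i k' -> k = k') ->
  (forall i i' k, e i k -> e i' k -> i = i') ->
  \sum_i \sum_(k | e i k) x i * z k <= l2 x * l2 z.
Proof.
move=> e1 e2; rewrite pair_big_dep /=.
apply: (le_trans (ler_norm _)); rewrite -sqrtr_sqr.
apply: (@le_trans _ _ (Num.sqrt ((\sum_(p : I * I | e p.1 p.2) x p.1 ^+ 2) *
    (\sum_(p : I * I | e p.1 p.2) z p.2 ^+ 2)))).
  exact/ler_wsqrtr/sum_cauchy_schwarz.
rewrite -sqrtrM ?sumr_ge0// => [|i _]; last exact: sqr_ge0.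
apply: ler_wsqrtr; apply: ler_pM; try by apply: sumr_ge0 => *; exact: sqr_ge0.
  rewrite -(pair_big_dep xpredT e (fun i k => x i ^+ 2)) /=.
  apply: ler_sum => i _; case: (pickP (e i)) => [k0 ek0|e0].
    rewrite (big_pred1 k0)// => k; apply/idP/eqP => [ek|-> //].
    exact: e1 ek ek0.
  by rewrite big_pred0// sqr_ge0.
rewrite -(pair_big_dep xpredT e (fun i k => z k ^+ 2)) /= (exchange_big_dep xpredT)//=.
apply: ler_sum => k _; case: (pickP (e^~ k)) => [i0 ei0|e0].
  rewrite (big_pred1 i0)// => i; apply/idP/eqP => [ei|-> //].
  exact: e2 ei ei0.
by rewrite big_pred0// sqr_ge0.
Qed.

Variable fr : I -> int.
Hypothesis fr_inj : injective fr.

Definition resonant (p : I * I * (I * I)) :=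
  fr p.1.1 + fr p.1.2 == fr p.2.1 + fr p.2.2.

(** One sum over nested pairs turns the symmetries of the resonance relation into reindexings.
    Values in any [nmodType] serve both the complex form and its real majorants. *)
Definition quad_sum (V : nmodType) (F : I -> I -> I -> I -> V) : V :=
  \sum_(p : I * I * (I * I) | resonant p) F p.1.1 p.1.2 p.2.1 p.2.2.

Lemma quad_sumE (V : nmodType) (F : I -> I -> I -> I -> V) :
  quad_sum F = \sum_i \sum_j \sum_k \sum_(l | fr i + fr j == fr k + fr l) F i j k l.
Proof.
under eq_bigr => i _ do under eq_bigr => j _ do rewrite pair_big_dep /=.
rewrite pair_big /= pair_big_dep /=; apply: eq_big => [[[i j] [k l]]|[[i j] [k l]]] //.
Qed.

Lemma quad_sum_swap12 (V : nmodType) (F : I -> I -> I -> I -> V) :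
  quad_sum F = quad_sum (fun i j k l => F j i k l).
Proof.
have inj : injective (fun p : I * I * (I * I) => ((p.1.2, p.1.1), p.2)).
  by move=> [[i j] [k l]] [[i' j'] [k' l']] [-> -> -> ->].
rewrite /quad_sum (reindex_inj inj) /=; apply: eq_bigl => -[[i j] [k l]].
by rewrite /resonant /= (addrC (fr j)).
Qed.

Lemma quad_sum_swap34 (V : nmodType) (F : I -> I -> I -> I -> V) :
  quad_sum F = quad_sum (fun i j k l => F i j l k).
Proof.
have inj : injective (fun p : I * I * (I * I) => (p.1, (p.2.2, p.2.1))).
  by move=> [[i j] [k l]] [[i' j'] [k' l']] [-> -> -> ->].
rewrite /quad_sum (reindex_inj inj) /=; apply: eq_bigl => -[[i j] [k l]].
by rewrite /resonant /= (addrC (fr l)).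
Qed.

Lemma quad_sum_swap (V : nmodType) (F : I -> I -> I -> I -> V) :
  quad_sum F = quad_sum (fun i j k l => F k l i j).
Proof.
have inj : injective (fun p : I * I * (I * I) => (p.2, p.1)).
  by move=> [[i j] [k l]] [[i' j'] [k' l']] [-> -> -> ->].
rewrite /quad_sum (reindex_inj inj) /=; apply: eq_bigl => -[[i j] [k l]].
by rewrite /resonant /= eq_sym.
Qed.

Lemma quad_sum_le (F G : I -> I -> I -> I -> R) :
  (forall i j k l, fr i + fr j = fr k + fr l -> F i j k l <= G i j k l) ->
  quad_sum F <= quad_sum G.
Proof. by move=> FG; apply: ler_sum => p /eqP; exact: FG. Qed.

(** For fixed [j] and [l] the resonance matches [i] with [k], since [fr] is injective. The two
    matched slots take l2 norms and the two fixed ones l1 norms. *)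
Lemma young13 x y z t : (forall i, 0 <= y i) -> (forall i, 0 <= t i) ->
  quad_sum (fun i j k l => x i * y j * z k * t l) <= l2 x * l2 z * l1 y * l1 t.
Proof.
move=> y0 t0; rewrite quad_sumE exchange_big /=.
under eq_bigr => j _ do under eq_bigr => i _ do
  rewrite (exchange_big_dep xpredT)//=.
under eq_bigr => j _ do rewrite exchange_big /=.
rewrite -[leRHS]mulrA [X in _ <= _ * X]mulr_suml mulr_sumr.
apply: ler_sum => j _; rewrite mulr_sumr mulr_sumr; apply: ler_sum => l _.
have -> : \sum_i \sum_(k | fr i + fr j == fr k + fr l) x i * y j * z k * t l =
    (\sum_i \sum_(k | fr i + fr j == fr k + fr l) x i * z k) * (y j * t l).
  rewrite mulr_suml; apply: eq_bigr => i _; rewrite mulr_suml.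
  by apply: eq_bigr => k _; ring.
apply: ler_wpM2r; first exact: mulr_ge0.
apply: sum_matching_le => [i k k'|i i' k] /eqP h /eqP h'; apply: fr_inj.
  by apply: (addIr (fr l)); rewrite -h.
by apply: (addIr (fr j)); rewrite h.
Qed.

Lemma young12 x y z t : (forall i, 0 <= z i) -> (forall i, 0 <= t i) ->
  quad_sum (fun i j k l => x i * y j * z k * t l) <= l2 x * l2 y * l1 z * l1 t.
Proof.
move=> z0 t0; rewrite quad_sum_swap quad_sumE.
rewrite -[leRHS]mulrA [X in _ <= _ * X]mulr_suml mulr_sumr.
apply: ler_sum => k _; rewrite mulr_sumr mulr_sumr; apply: ler_sum => l _.
have -> : \sum_i \sum_(j | fr k + fr l == fr i + fr j) x i * y j * z k * t l =
    (\sum_i \sum_(j | fr k + fr l == fr i + fr j) x i * y j) * (z k * t l).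
  rewrite mulr_suml; apply: eq_bigr => i _; rewrite mulr_suml.
  by apply: eq_bigr => j _; ring.
apply: ler_wpM2r; first exact: mulr_ge0.
apply: sum_matching_le => [i j j'|i i' j] /eqP h /eqP h'; apply: fr_inj.
  by apply: (addrI (fr i)); rewrite -h.
by apply: (addIr (fr j)); rewrite -h.
Qed.

End finite_sums.

(** * The symmetrized quartic form *)

Section quartic_form.
Context {R : realType}.
Variables (I : finType) (fr : I -> int).
Hypothesis fr_inj : injective fr.
Implicit Types x y z t a b : I -> R[i].
Local Notation qs := (quad_sum fr).

(** The weight is symmetric in the first two slots and on the resonant set equals [fr k + fr l].
    Hence exchanging the two pairs of slots amounts to conjugation, and the real part has all the
    symmetries behind [Qform_expand]. *)
Definition Qform x y z t : R[i] := qs (fun i j k l =>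
  (fr i + fr j)%:~R * (x i * y j * conjc (z k) * conjc (t l))).

Lemma Qform12 x y z t : Qform x y z t = Qform y x z t.
Proof.
rewrite /Qform quad_sum_swap12; apply: eq_bigr => p _.
by rewrite addrC (mulrC (x _)).
Qed.

Lemma Qform34 x y z t : Qform x y z t = Qform x y t z.
Proof.
by rewrite /Qform quad_sum_swap34; apply: eq_bigr => p _; rewrite mulrAC.
Qed.

Lemma Qform_conj x y z t : Qform x y z t = conjc (Qform z t x y).
Proof.
rewrite /Qform quad_sum_swap /quad_sum rmorph_sum; apply: eq_bigr => p /eqP h /=.
have cM (u v : R[i]) : conjc (u * v) = conjc u * conjc v by exact: rmorphM.
have ci (n : int) : conjc (n%:~R : R[i]) = n%:~R by exact: rmorph_int.
by rewrite !cM ci !conjcK h; ring.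
Qed.

Let q x y z t := complex.Re (Qform x y z t).

Let q12 x y z t : q x y z t = q y x z t. Proof. by rewrite /q Qform12. Qed.
Let q34 x y z t : q x y z t = q x y t z. Proof. by rewrite /q Qform34. Qed.
Let qc x y z t : q x y z t = q z t x y.
Proof. by rewrite /q Qform_conj; case: (Qform _ _ _ _). Qed.

Let qD1 x x' y z t : q (fun i => x i + x' i) y z t = q x y z t + q x' y z t.
Proof.
rewrite /q -raddfD /=; congr complex.Re; rewrite /Qform /quad_sum -big_split.
by apply: eq_bigr => p _ /=; rewrite !mulrDl mulrDr.
Qed.

Let qD2 x x' y z t : q y (fun i => x i + x' i) z t = q y x z t + q y x' z t.
Proof. by rewrite q12 qD1 q12 (q12 x'). Qed.

Let qD3 x x' y z t : q y z (fun i => x i + x' i) t = q y z x t + q y z x' t.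
Proof. by rewrite qc qD1 qc (qc x'). Qed.

Let qD4 x x' y z t : q y z t (fun i => x i + x' i) = q y z t x + q y z t x'.
Proof. by rewrite q34 qD3 q34 (q34 _ _ x'). Qed.

(** Sixteen terms, grouped by the swaps inside each pair of slots and the exchange of the two
    pairs. *)
Lemma Qform_expand a b (v := fun i => a i + b i) :
  complex.Re (Qform v v v v) = complex.Re (Qform a a a a) +
    4 * complex.Re (Qform a a a b) + 2 * complex.Re (Qform a a b b) +
    4 * complex.Re (Qform a b a b) + 4 * complex.Re (Qform a b b b) +
    complex.Re (Qform b b b b).
Proof.
rewrite -![complex.Re (Qform _ _ _ _)]/(q _ _ _ _) /v !(qD1, qD2, qD3, qD4).
rewrite (q34 a a b a) (q12 b a a a) (qc a b a a) (q34 a b b a).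
rewrite (q12 b a a b) (q12 b a b a) (q34 a b b a) (qc b b a a) (q12 b a b b).
by rewrite (qc b b b a) (qc b b a b) (q12 b a b b); ring.
Qed.

Let w i : R := japanese (fr i).

Lemma japanese_ge1 n : 1 <= japanese n :> R.
Proof. by rewrite -sqrtr1 ler_wsqrtr// lerDl sqr_ge0. Qed.

Lemma japanese_sqr n : japanese n ^+ 2 = 1 + n%:~R ^+ 2 :> R.
Proof. by rewrite sqr_sqrtr// addr_ge0// sqr_ge0. Qed.

Lemma int_le_japanese n : `|n%:~R| <= japanese n :> R.
Proof. by rewrite -sqrtr_sqr ler_wsqrtr// lerDr. Qed.

Let w0 i : 0 <= w i. Proof. exact: le_trans ler01 (japanese_ge1 _). Qed.

Let normc_weight (m n : int) : normc ((m + n)%:~R : R[i]) <= japanese m + japanese n.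
Proof.
rewrite normc_int intrD; apply: (le_trans (ler_normD _ _)).
by rewrite lerD// int_le_japanese.
Qed.

Let nrm x i : R := normc (x i).
Let nrm0 x i : 0 <= nrm x i. Proof. exact: normc_ge0. Qed.
Let wnrm x i : R := w i * nrm x i.

Lemma Qform_le x y z t :
  normc (Qform x y z t) <= qs (fun i j k l => normc ((fr i + fr j)%:~R : R[i]) *
    (nrm x i * nrm y j * nrm z k * nrm t l)).
Proof.
apply: (le_trans (normc_sum _ _ _)); apply: ler_sum => p _.
by rewrite !ComplexField.Normc.normcM !normcJ.
Qed.

(** On the resonant set the weight is [fr k + fr l], so the derivative can be placed on the last two
    slots. These are occupied by b in all uses, and b is the function with a controlled H^1 norm. *)
Lemma Qform_le34 x y z : normc (Qform x y z z) <=
  2 * qs (fun i j k l => nrm x i * nrm y j * wnrm z k * nrm z l).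
Proof.
apply: (le_trans (Qform_le _ _ _ _)).
apply: (@le_trans _ _ (qs (fun i j k l => nrm x i * nrm y j * wnrm z k * nrm z l) +
   qs (fun i j k l => nrm x i * nrm y j * nrm z k * wnrm z l))).
  rewrite -big_split; apply: ler_sum => p /eqP h /=; rewrite h.
  rewrite /wnrm; have := normc_weight (fr p.2.1) (fr p.2.2).
  move=> /ler_wpM2r => /(_ (nrm x p.1.1 * nrm y p.1.2 * nrm z p.2.1 * nrm z p.2.2)).
  rewrite !mulr_ge0 // => /(_ isT)/le_trans; apply; rewrite -/(w _) -/(w _).
  by rewrite le_eqVlt; apply/orP; left; apply/eqP; ring.
rewrite [X in _ + X]quad_sum_swap34 mulr_natl mulr2n lerD2l.
by rewrite le_eqVlt; apply/orP; left; apply/eqP; apply: eq_bigr => p _; ring.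
Qed.

Lemma Qform_abbb_le a b :
  normc (Qform a b b b) <= 2 * (l2 (nrm a) * l2 (wnrm b) * l1 (nrm b) ^+ 2).
Proof.
apply: (le_trans (Qform_le34 _ _ _)); rewrite ler_pM2l//.
by rewrite expr2 mulrA; apply: young13.
Qed.

Variable rho : I -> R.
Hypothesis rho_gt0 : forall i, 0 < rho i.

Let rnrm x i := rho i * nrm x i.
Let inrm x i := (rho i)^-1 * nrm x i.

Let inrm0 x i : 0 <= inrm x i. Proof. by rewrite mulr_ge0// invr_ge0 ltW. Qed.
Let rnrm0 x i : 0 <= rnrm x i. Proof. by rewrite mulr_ge0// ltW. Qed.
Let wnrm0 x i : 0 <= wnrm x i. Proof. by rewrite mulr_ge0. Qed.

(** The l1 norm of coefficients of size 1 / <n> diverges logarithmically, so [a] cannot be put in l1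
    directly. The factor with the smaller weight receives [rho^-1] and the other one [rho], which
    loses nothing; then the l1 sum converges and the l2 norm is still finite for [rho] =
    <n>^{1/4}. *)
Lemma split_weight a i j :
  nrm a i * nrm a j <= rnrm a i * inrm a j + inrm a i * rnrm a j.
Proof.
have wl i' j' : rho i' <= rho j' -> nrm a i' * nrm a j' <= inrm a i' * rnrm a j'.
  move=> ij; rewrite /inrm /rnrm mulrACA ler_peMl ?mulr_ge0//.
  by rewrite mulrC ler_pdivlMr// mul1r.
have [ij|/ltW ji] := leP (rho i) (rho j).
  by apply: (le_trans (wl _ _ ij)); rewrite lerDr mulr_ge0.
rewrite mulrC; apply: (le_trans (wl _ _ ji)).
by rewrite [X in X <= _]mulrC lerDl mulr_ge0.
Qed.

Lemma Qform_aabb_le a b : normc (Qform a a b b) <=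
  4 * (l2 (rnrm a) * l2 (wnrm b) * l1 (inrm a) * l1 (nrm b)).
Proof.
apply: (le_trans (Qform_le34 _ _ _)).
rewrite [4](_ : _ = 2 * 2); last by ring.
rewrite -mulrA ler_pM2l//.
apply: (@le_trans _ _ (qs (fun i j k l => rnrm a i * inrm a j * wnrm b k * nrm b l) +
   qs (fun i j k l => inrm a i * rnrm a j * wnrm b k * nrm b l))).
  rewrite -big_split; apply: ler_sum => p _ /=.
  rewrite -!mulrDl; do 2!(apply: ler_wpM2r => //); exact: split_weight.
rewrite [X in _ + X]quad_sum_swap12 mulr_natl mulr2n; apply: lerD.
  exact: young13.
apply: le_trans (young13 fr_inj (rnrm a) (wnrm b) (inrm0 a) (nrm0 b)).
by apply: quad_sum_le => i j k l _; rewrite [inrm a j * _]mulrC.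
Qed.

(** The Fourier coefficient at [fr l - fr j] of the product of [- i] times the derivative of [a]
    with the conjugate of [a]. *)
Definition Bform a j l : R[i] := \sum_(p : I * I | fr p.1 + fr j == fr p.2 + fr l)
  (fr p.1)%:~R * (a p.1 * conjc (a p.2)).

Variable om : I -> R.
Hypothesis om_gt0 : forall i, 0 < om i.

(** The weight is split. Its part [fr j] falls on [b] and is treated by [young12], [young13] and
    [split_weight]. Its part [fr i] falls on [a] and gives the sesquilinear form of the matrix
    [Bform], bounded by a Hilbert-Schmidt norm weighted by [om^-1] in both indices. *)
Lemma Qform_abab_le a b : normc (Qform a b a b) <=
  Num.sqrt (\sum_j \sum_l (om j)^-1 * (om l)^-1 * normc (Bform a j l) ^+ 2) *
    \sum_j om j * nrm b j ^+ 2 +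
  2 * (l2 (rnrm a) * l2 (wnrm b) * l1 (inrm a) * l1 (nrm b)).
Proof.
have -> : Qform a b a b = (\sum_(p : I * I) b p.1 * conjc (b p.2) * Bform a p.1 p.2) +
    qs (fun i j k l => (fr j)%:~R * (a i * b j * conjc (a k) * conjc (b l))).
  have -> : Qform a b a b =
      qs (fun i j k l => (fr i)%:~R * (a i * b j * conjc (a k) * conjc (b l))) +
      qs (fun i j k l => (fr j)%:~R * (a i * b j * conjc (a k) * conjc (b l))).
    rewrite -big_split; apply: eq_bigr => p _ /=.
    by rewrite intrD mulrDl.
  congr (_ + _); rewrite quad_sumE exchange_big /= -(pair_bigA _ (fun j l =>
    b j * conjc (b l) * Bform a j l)) /=; apply: eq_bigr => j _.
  under eq_bigr => i _ do rewrite (exchange_big_dep xpredT)//=.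
  rewrite exchange_big /=; apply: eq_bigr => l _.
  rewrite /Bform -(pair_big_dep xpredT (fun i k => fr i + fr j == fr k + fr l)
    (fun i k => (fr i)%:~R * (a i * conjc (a k)))) /= mulr_sumr.
  apply: eq_bigr => i _; rewrite mulr_sumr; apply: eq_bigr => k _; ring.
apply: (le_trans (le_normcD _ _)); apply: lerD.
  apply: (le_trans (normc_sum _ _ _)).
  pose s i := Num.sqrt (om i).
  have s0 i : 0 < s i by rewrite sqrtr_gt0.
  have s2 i : s i ^+ 2 = om i by rewrite sqr_sqrtr// ltW.
  apply: (@le_trans _ _ (\sum_(p : I * I)
     ((s p.1)^-1 * (s p.2)^-1 * normc (Bform a p.1 p.2)) *
     ((s p.1 * nrm b p.1) * (s p.2 * nrm b p.2)))).
    apply: ler_sum => p _; rewrite !ComplexField.Normc.normcM normcJ -/(nrm b _) -/(nrm b _).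
    rewrite le_eqVlt; apply/orP; left; apply/eqP; field.
    by rewrite !gt_eqF.
  apply: (le_trans (sum_mul_le_l2 _ _)).
  apply: ler_pM; rewrite ?l2_ge0//.
    rewrite ler_wsqrtr// pair_big /=; apply: ler_sum => p _.
    by rewrite !exprMn !exprVn !s2.
  apply: l2_le.
    by apply: sumr_ge0 => j _; rewrite mulr_ge0 ?sqr_ge0// ltW.
  rewrite expr2 big_distrlr /= pair_big /=; apply: ler_sum => p _.
  by rewrite !exprMn !s2.
apply: (@le_trans _ _ (qs (fun i j k l => nrm a i * wnrm b j * nrm a k * nrm b l))).
  apply: (le_trans (normc_sum _ _ _)); apply: ler_sum => p _.
  rewrite !ComplexField.Normc.normcM !normcJ normc_int /wnrm.
  rewrite [leRHS](_ : _ = w p.1.2 *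
    (nrm a p.1.1 * nrm b p.1.2 * nrm a p.2.1 * nrm b p.2.2)); last by ring.
  apply: ler_wpM2r; last exact: int_le_japanese.
  by rewrite !mulr_ge0 ?normc_ge0.
apply: (@le_trans _ _ (qs (fun i j k l => rnrm a i * wnrm b j * inrm a k * nrm b l) +
   qs (fun i j k l => inrm a i * wnrm b j * rnrm a k * nrm b l))).
  rewrite -big_split; apply: ler_sum => p _ /=.
  rewrite -mulrDl; apply: ler_wpM2r => //.
  rewrite mulrAC [X in _ <= X + _]mulrAC [X in _ <= _ + X]mulrAC -mulrDl.
  by apply: ler_wpM2r => //; exact: split_weight.
rewrite mulr_natl mulr2n; apply: lerD; first exact: young12.
rewrite quad_sum_swap12.
rewrite [l2 (rnrm a) * _]mulrC.
apply: le_trans (young13 fr_inj (wnrm b) (rnrm a) (inrm0 a) (nrm0 b)).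
by apply: quad_sum_le => i j k l _; rewrite [inrm a j * _]mulrC.
Qed.

End quartic_form.

(** * The term linear in b *)

Section linear_term.
Context {R : realType}.
Variables (I : finType) (fr : I -> int).
Hypothesis fr_inj : injective fr.
Implicit Types a b : I -> R[i].
Local Notation w i := (japanese (fr i) : R).
Local Notation nrm a i := (normc (a i)).

Definition triad l (p : I * I * I) := fr p.1.1 + fr p.1.2 == fr p.2 + fr l.

(** The conjugated frequency then occurs exactly once in the monomial, so a sign change there gives
    it mean zero. *)
Definition nonpaired (p : I * I * I) := (p.2 != p.1.1) && (p.2 != p.1.2).

Definition Aterm a (p : I * I * I) : R[i] :=
  (fr p.1.1 + fr p.1.2)%:~R * (a p.1.1 * a p.1.2 * conjc (a p.2)).

Definition Aform a l : R[i] := \sum_(p | triad l p) Aterm a p.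

Definition Anonpaired a l : R[i] := \sum_(p | triad l p && nonpaired p) Aterm a p.

Definition momentum a : R := \sum_i (fr i)%:~R * nrm a i ^+ 2.

Let w1 i : 1 <= w i. Proof. exact: japanese_ge1. Qed.
Let w0 i : 0 < w i. Proof. exact: lt_le_trans ltr01 (w1 i). Qed.

(** Duality between H^{-1} and H^1. The negative weight on the cubic expression will compensate the
    derivative that remains on [a]. *)
Lemma Qform_aaab_le a b : normc (Qform fr a a a b) <=
  l2 (fun l => normc (Aform a l) / w l) * l2 (fun i => w i * nrm b i).
Proof.
have -> : Qform fr a a a b = \sum_l Aform a l * conjc (b l).
  rewrite /Qform quad_sumE.
  under eq_bigr => i _ do under eq_bigr => j _ do
    rewrite (exchange_big_dep xpredT)//=.
  under eq_bigr => i _ do rewrite exchange_big /=.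
  rewrite exchange_big /=; apply: eq_bigr => l _.
  rewrite /Aform mulr_suml pair_bigA /=.
  rewrite (pair_big_dep xpredT (fun p k => fr p.1 + fr p.2 == fr k + fr l)
    (fun p k => (fr p.1 + fr p.2)%:~R * (a p.1 * a p.2 * conjc (a k) * conjc (b l)))) /=.
  apply: eq_bigr => p _; rewrite /Aterm; ring.
apply: (le_trans (normc_sum _ _ _)); apply: le_trans (sum_mul_le_l2 _ _).
apply: ler_sum => l _; rewrite ComplexField.Normc.normcM normcJ.
by rewrite mulrA divfK// gt_eqF.
Qed.

(* The paired terms (n3 = n1 or n3 = n2) only involve the momentum and the mass. *)
Lemma Aform_le a l : normc (Aform a l) <= normc (Anonpaired a l) +
  w l * nrm a l * (2 * `|momentum a| + 4 * \sum_i nrm a i ^+ 2).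
Proof.
set n2 := \sum_i nrm a i ^+ 2.
have aJ i : a i * conjc (a i) = ((nrm a i ^+ 2)%:C)%C by exact: mulc_conj.
have n20 : 0 <= n2 by apply: sumr_ge0 => i _; exact: sqr_ge0.
have nrm_n2 : nrm a l ^+ 2 <= n2.
  by rewrite /n2 (bigD1 l)//= lerDl; apply: sumr_ge0 => i _; exact: sqr_ge0.
have fl : `|(fr l)%:~R| <= w l := int_le_japanese _.
pose T := a l * ((\sum_i (fr i + fr l)%:~R * nrm a i ^+ 2)%:C)%C.
have Tle : normc T <= nrm a l * (`|momentum a| + w l * n2).
  rewrite ComplexField.Normc.normcM ler_wpM2l ?normc_ge0// normc_real.
  have -> : \sum_i (fr i + fr l)%:~R * nrm a i ^+ 2 = momentum a + (fr l)%:~R * n2.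
    by rewrite mulr_sumr -big_split; apply: eq_bigr => i _ /=; rewrite intrD mulrDl.
  apply: (le_trans (ler_normD _ _)); rewrite lerD2l normrM (ger0_norm n20).
  exact: ler_wpM2r.
have S1 : \sum_(p | triad l p && (p.2 == p.1.1)) Aterm a p = T.
  rewrite (reindex_onto (fun i => ((i, l), i)) (fun p => p.1.1)) /=; last first.
    move=> [[i j] k] /= /andP[/eqP h /eqP kE]; move: h; rewrite kE /= => /addrI/fr_inj.
    by move=> ->.
  rewrite /T rmorph_sum mulr_sumr; apply: eq_big => [i|i _].
    by rewrite /triad /= !eqxx.
  by rewrite /Aterm /= rmorphM /= -aJ rmorph_int; ring.
(* The triad with all three frequencies equal to [fr l] was already counted in [S1], hence the
   subtracted term. *)
have S2 : \sum_(p | triad l p && (p.2 != p.1.1) && (p.2 == p.1.2)) Aterm a p =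
    T - (fr l + fr l)%:~R * (a l * (a l * conjc (a l))).
  rewrite (reindex_onto (fun i => ((l, i), i)) (fun p => p.2)) /=; last first.
    move=> [[i j] k] /= /andP[/andP[/eqP h _] /eqP kE]; move: h; rewrite kE /=.
    by rewrite addrC => /addrI/fr_inj ->.
  rewrite /T rmorph_sum mulr_sumr [in RHS](bigD1 l)//=.
  rewrite [X in _ = X + _ - _](_ : _ =
      (fr l + fr l)%:~R * (a l * (a l * conjc (a l)))); last first.
    by rewrite aJ rmorphM /= rmorph_int; ring.
  rewrite addrC addKr; apply: eq_big => [i|i _].
    by rewrite /triad /= addrC !eqxx !andbT.
  by rewrite /Aterm /= rmorphM /= -aJ rmorph_int (addrC (fr l)); ring.
have -> : Aform a l = Anonpaired a l + (T + (T - (fr l + fr l)%:~R * (a l * (a l * conjc (a l))))).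
  rewrite -{1}S1 -S2 /Aform (bigID (fun p : I * I * I => p.2 == p.1.1)) /=.
  rewrite addrCA; congr (_ + _).
  rewrite (bigID (fun p : I * I * I => p.2 == p.1.2)) /= addrC; congr (_ + _).
  by apply: eq_bigl => p; rewrite /nonpaired andbA.
apply: (le_trans (le_normcD _ _)); rewrite lerD2l.
apply: (le_trans (le_normcD _ _)).
apply: (le_trans (lerD Tle (le_normcD _ _))); rewrite normcN.
apply: (le_trans (lerD (lexx _) (lerD Tle (lexx _)))).
rewrite aJ !ComplexField.Normc.normcM normc_real normc_int (ger0_norm (sqr_ge0 _)).
have f2 : `|(fr l + fr l)%:~R| <= 2 * w l :> R.
  by rewrite intrD; apply: (le_trans (ler_normD _ _)); lra.
have := ler_pM (normr_ge0 _) (sqr_ge0 _) f2 nrm_n2.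
move=> /(ler_wpM2l (normc_ge0 (a l))).
have : nrm a l * `|momentum a| <= w l * (nrm a l * `|momentum a|).
  by rewrite ler_peMl// mulr_ge0 ?normc_ge0.
move: (`|(fr l + fr l)%:~R|) (nrm a l) (`|momentum a|) (w l) => f x m y; nra.
Qed.

Lemma sum_Aform_le a :
  \sum_l (normc (Aform a l) / w l) ^+ 2 <=
  2 * (\sum_l (normc (Anonpaired a l) / w l) ^+ 2) +
  2 * ((\sum_i nrm a i ^+ 2) *
       (2 * `|momentum a| + 4 * \sum_i nrm a i ^+ 2) ^+ 2).
Proof.
set n2 := \sum_i nrm a i ^+ 2; set m := 2 * `|_| + _.
have n20 : 0 <= n2 by apply: sumr_ge0 => i _; exact: sqr_ge0.
have m0 : 0 <= m by rewrite addr_ge0// mulr_ge0.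
rewrite /n2 mulr_suml !mulr_sumr -big_split; apply: ler_sum => l _ /=.
apply: (@le_trans _ _ ((normc (Anonpaired a l) / w l + nrm a l * m) ^+ 2)).
  rewrite ler_sqr ?nnegrE.
  - rewrite ler_pdivrMr// mulrDl divfK ?gt_eqF//.
    by apply: (le_trans (Aform_le a l)); rewrite lerD2l -/n2 -/m; lra.
  - by rewrite divr_ge0 ?normc_ge0// ltW.
  - by rewrite addr_ge0 ?divr_ge0 ?mulr_ge0 ?normc_ge0// ltW.
have := sqr_ge0 (normc (Anonpaired a l) / w l - nrm a l * m); lra.
Qed.

End linear_term.

(** * The deterministic bound of the quartic form *)

Section quartic_bound.
Context {R : realType}.
Variables (I : finType) (fr : I -> int).
Hypothesis fr_inj : injective fr.
Implicit Types a b : I -> R[i].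
Local Notation w i := (japanese (fr i) : R).
Local Notation nrm a i := (normc (a i)).

Hypothesis sum_resolvent : forall r : R, 1 <= r ->
  \sum_i (r ^+ 2 + (fr i)%:~R ^+ 2)^-1 <= 5 / r.

(** Cauchy-Schwarz against [r ^+ 2 + n ^+ 2]. The resolvent sum gives [5 / r] and the weighted
    square sum is at most [2 * X ^+ 2]; with [r = X / L] the product is [10 * L * X]. *)
Lemma agmon b :
  l1 (fun i => nrm b i) ^+ 2 <=
  10 * (l2 (fun i => nrm b i) * l2 (fun i => w i * nrm b i)).
Proof.
set L := l2 (fun i => nrm b i); set X := l2 _.
have L0 : 0 <= L := l2_ge0 _.
have L2 : L ^+ 2 = \sum_i nrm b i ^+ 2 := sqr_l2 _.
have X2 : X ^+ 2 = \sum_i nrm b i ^+ 2 + \sum_i (fr i)%:~R ^+ 2 * nrm b i ^+ 2.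
  rewrite sqr_l2 -big_split; apply: eq_bigr => i _ /=.
  by rewrite exprMn japanese_sqr mulrDl mul1r.
have F0 : 0 <= \sum_i (fr i)%:~R ^+ 2 * nrm b i ^+ 2.
  by apply: sumr_ge0 => i _; rewrite mulr_ge0 ?sqr_ge0.
have LX : L <= X.
  by rewrite -(ler_sqr (x := L)) ?nnegrE ?l2_ge0// X2 L2 lerDl.
move: (L0); rewrite le_eqVlt => /orP[/eqP L00|Lgt0].
  have b0 i : nrm b i = 0.
    apply/eqP; rewrite -sqrf_eq0; move/eqP: L2; rewrite -L00 expr0n eq_sym.
    by rewrite psumr_eq0 => [/allP/(_ i (mem_index_enum i))|? _]; rewrite ?sqr_ge0.
  have -> : l1 (fun i => nrm b i) = 0 by rewrite /l1 big1.
  by rewrite -L00 mul0r mulr0 expr0n.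
have Xgt0 : 0 < X by exact: lt_le_trans LX.
(* This scale balances the two parts of the weight, and [L <= X] puts it in the range where
   [sum_resolvent] holds. The case [L = 0] was treated apart because of this division. *)
pose r := X / L.
have r1 : 1 <= r by rewrite ler_pdivlMr// mul1r.
have r0 : 0 < r by exact: lt_le_trans r1.
pose g i := r ^+ 2 + (fr i)%:~R ^+ 2 : R.
have g0 i : 0 < g i by rewrite ltr_pwDl ?sqr_ge0// exprn_gt0.
have -> : l1 (fun i => nrm b i) =
    \sum_i (Num.sqrt (g i) * nrm b i) * (Num.sqrt (g i))^-1.
  by apply: eq_bigr => i _; rewrite mulrAC divff ?mul1r// gt_eqF// sqrtr_gt0.
apply: (le_trans (sum_cauchy_schwarz _ _ _)).
have -> : \sum_i (Num.sqrt (g i))^-1 ^+ 2 = \sum_i (g i)^-1.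
  by apply: eq_bigr => i _; rewrite exprVn sqr_sqrtr// ltW.
have -> : \sum_i (Num.sqrt (g i) * nrm b i) ^+ 2 =
    r ^+ 2 * L ^+ 2 + \sum_i (fr i)%:~R ^+ 2 * nrm b i ^+ 2.
  rewrite L2 mulr_sumr -big_split; apply: eq_bigr => i _ /=.
  by rewrite exprMn sqr_sqrtr ?mulrDl// ltW.
apply: (@le_trans _ _ (2 * X ^+ 2 * (5 / r))).
  apply: ler_pM.
  - by rewrite addr_ge0// mulr_ge0 ?sqr_ge0.
  - by apply: sumr_ge0 => i _; rewrite invr_ge0 ltW.
  - have -> : r ^+ 2 * L ^+ 2 = X ^+ 2 by rewrite -exprMn divfK// gt_eqF.
    by rewrite mulr_natl mulr2n lerD2l X2 lerDr sumr_ge0// => i _; exact: sqr_ge0.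
  - exact: sum_resolvent.
rewrite /r le_eqVlt; apply/orP; left; apply/eqP; field.
by rewrite !gt_eqF.
Qed.

Let q4 i : R := Num.sqrt (Num.sqrt (w i)).

Let w0 i : 0 < w i. Proof. exact: lt_le_trans ltr01 (japanese_ge1 _). Qed.
Let q40 i : 0 < q4 i. Proof. by rewrite 2!sqrtr_gt0 w0. Qed.
Let q41 i : 1 <= q4 i.
Proof.
rewrite -sqrtr1 ler_wsqrtr// -[X in X <= _]sqrtr1 ler_wsqrtr//.
exact: japanese_ge1.
Qed.
Let q4E i : q4 i ^+ 4 = w i.
Proof. by rewrite (exprM _ 2 2) !sqr_sqrtr ?sqrtr_ge0 ?ltW. Qed.

(** Let [X] be the H^1 norm of [b]. Only Q(a, b, b, b) and Q(b, b, b, b) are of order [X ^+ 2]: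
    Agmon gives them the coefficient [20 * delta ^+ 2 * (4 * 2 + 2 * 2) = 240 * delta ^+ 2]. The
    other terms grow more slowly than [X ^+ 2] and are absorbed at the price of four times
    [eps * X ^+ 2] and a constant. *)
Lemma Qform_bound a b (delta kappa eps : R) :
  0 <= kappa -> 0 < eps ->
  l2 (fun i => nrm a i) <= delta -> l2 (fun i => nrm b i) <= 2 * delta ->
  complex.Re (Qform fr a a a a) <= 0 ->
  l2 (fun l => normc (Aform fr a l) / w l) <= kappa ->
  l2 (fun i => q4 i * nrm a i) * l1 (fun i => (q4 i)^-1 * nrm a i) <= kappa ->
  Num.sqrt (\sum_j \sum_l (q4 j ^+ 5)^-1 * (q4 l ^+ 5)^-1 *
    normc (Bform fr a j l) ^+ 2) <= kappa ->
  complex.Re (Qform fr (fun i => a i + b i) (fun i => a i + b i)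
                       (fun i => a i + b i) (fun i => a i + b i)) <=
  (240 * delta ^+ 2 + 4 * eps) * l2 (fun i => w i * nrm b i) ^+ 2 +
  (4 * kappa ^+ 2 / eps + (1280 * kappa ^+ 2 * delta / eps) ^+ 2 / (4 * eps) +
   16 * kappa * delta ^+ 2 * ((4 * kappa + 1) / eps) ^+ 2).
Proof.
move=> k0 e0 ad bd Qa A1 A2 A3.
pose ql := @Re_le_normc R.
rewrite Qform_expand.
set X := l2 (fun i => w i * nrm b i).
pose Y := l1 (fun i => nrm b i); pose L := l2 (fun i => nrm b i).
have X0 : 0 <= X := l2_ge0 _.
have L0 : 0 <= L := l2_ge0 _.
have Y0 : 0 <= Y by apply: l1_ge0 => i; exact: normc_ge0.
have d0 : 0 <= delta := le_trans (l2_ge0 _) ad.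
have Y2 : Y ^+ 2 <= 10 * (L * X) := agmon b.
have Y2d : Y ^+ 2 <= 20 * delta * X.
  apply: (le_trans Y2); have := ler_wpM2r X0 bd; rewrite -/L; lra.
have T1 : normc (Qform fr a a a b) <= kappa * X.
  by apply: (le_trans (Qform_aaab_le _ _ _)); exact: ler_wpM2r.
have K2 : l2 (fun i => q4 i * nrm a i) * X * l1 (fun i => (q4 i)^-1 * nrm a i) * Y <=
    kappa * (X * Y).
  rewrite mulrAC -mulrA [leLHS](_ : _ =
    (l2 (fun i => q4 i * nrm a i) * l1 (fun i => (q4 i)^-1 * nrm a i)) * (X * Y));
    last by ring.
  by rewrite ler_wpM2r// mulr_ge0.
have T2 : normc (Qform fr a a b b) <= 4 * (kappa * (X * Y)).
  by apply: (le_trans (Qform_aabb_le fr_inj q40 a b)); rewrite ler_pM2l.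
have om0 i : 0 < q4 i ^+ 5 by rewrite exprn_gt0.
have T3 : normc (Qform fr a b a b) <= kappa * (\sum_j q4 j ^+ 5 * nrm b j ^+ 2) +
    2 * (kappa * (X * Y)).
  apply: (le_trans (Qform_abab_le fr_inj q40 om0 a b)).
  apply: lerD; last by rewrite ler_pM2l.
  by apply: ler_wpM2r => //; apply: sumr_ge0 => j _; rewrite mulr_ge0 ?sqr_ge0 ?ltW.
have T4 : normc (Qform fr a b b b) <= 2 * (delta * X * Y ^+ 2).
  apply: (le_trans (Qform_abbb_le fr_inj a b)); rewrite ler_pM2l//.
  by do 2!(apply: ler_wpM2r; rewrite ?sqr_ge0//).
have T5 : normc (Qform fr b b b b) <= 2 * (2 * delta * X * Y ^+ 2).
  apply: (le_trans (Qform_abbb_le fr_inj b b)); rewrite ler_pM2l//.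
  by do 2!(apply: ler_wpM2r; rewrite ?sqr_ge0//).
(* Chosen so that [4 * kappa * e' <= eps]; the added 1 keeps the denominator positive when [kappa]
   is 0. *)
pose e' := eps / (4 * kappa + 1).
have k1 : 0 < 4 * kappa + 1 by lra.
have e'0 : 0 < e' by rewrite divr_gt0.
(* Interpolation of <n>^{5/4} between L^2 and H^1: for [t] = <n>^{1/4},
   [t ^+ 5 <= e' * t ^+ 8 + e' ^- 2], by the first summand if [e' * t ^+ 3 >= 1] and by the second
   one otherwise. *)
have omle : \sum_j q4 j ^+ 5 * nrm b j ^+ 2 <= e' * X ^+ 2 + e' ^- 2 * (4 * delta ^+ 2).
  apply: (@le_trans _ _ (e' * X ^+ 2 + e' ^- 2 * L ^+ 2)); last first.
    rewrite lerD2l ler_wpM2l// ?invr_ge0 ?sqr_ge0//.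
    have -> : 4 * delta ^+ 2 = (2 * delta) ^+ 2 by ring.
    by rewrite ler_sqr ?nnegrE// mulr_ge0.
  rewrite /X /L !sqr_l2 !mulr_sumr -big_split; apply: ler_sum => j _ /=.
  rewrite -q4E [leRHS](_ : _ = (e' * (q4 j ^+ 4) ^+ 2 + e' ^- 2) * nrm b j ^+ 2);
    last by ring.
  rewrite ler_wpM2r ?sqr_ge0//.
  move: (q41 j); move: (q4 j) => t t1.
  have t0 : 0 <= t by lra.
  have E : (t ^+ 4) ^+ 2 = t ^+ 3 * t ^+ 5 by ring.
  have [te|te] := leP 1 (e' * t ^+ 3).
    rewrite E mulrA ler_wpDr ?invr_ge0 ?sqr_ge0//.
    by rewrite ler_peMl// exprn_ge0.
  have e'1 : 0 <= e' := ltW e'0.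
  apply: (@le_trans _ _ (e' ^- 2)); last by rewrite lerDr mulr_ge0 ?sqr_ge0.
  apply: (@le_trans _ _ (t ^+ 6)).
    by rewrite [leRHS]exprS ler_peMl// exprn_ge0.
  rewrite (exprM _ 3 2) -exprVn ler_sqr ?nnegrE ?exprn_ge0 ?invr_ge0 ?(ltW e'0)//.
  by rewrite -[leRHS]mul1r ler_pdivlMr// mulrC ltW.
(* The coefficient is [2 * 4] from Q(a, a, b, b) plus [4 * 2] from Q(a, b, a, b). Agmon then makes
   the [Y ^+ 2] term linear in [X], and [lin] absorbs it. *)
have XY : 16 * (kappa * (X * Y)) <= eps * X ^+ 2 + 64 * kappa ^+ 2 / eps * Y ^+ 2.
  have := sqr_ge0 (eps * X - 8 * kappa * Y).
  move=> /(mulr_ge0 (ltW (_ : 0 < eps^-1))) => /(_ (_ : 0 < eps^-1)).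
  rewrite invr_gt0 => /(_ e0).
  have -> : eps^-1 * (eps * X - 8 * kappa * Y) ^+ 2 =
     eps * X ^+ 2 - 16 * (kappa * (X * Y)) + 64 * kappa ^+ 2 / eps * Y ^+ 2.
    by field; rewrite gt_eqF.
  lra.
have lin c : c * X <= eps * X ^+ 2 + c ^+ 2 / (4 * eps).
  have := sqr_ge0 (eps * X - c / 2).
  move=> /(mulr_ge0 (ltW (_ : 0 < eps^-1))) => /(_ (_ : 0 < eps^-1)).
  rewrite invr_gt0 => /(_ e0).
  have -> : eps^-1 * (eps * X - c / 2) ^+ 2 =
     eps * X ^+ 2 - c * X + c ^+ 2 / (4 * eps).
    by field; rewrite gt_eqF.
  lra.
have L1 := lin (4 * kappa).
have L2 := lin (1280 * kappa ^+ 2 * delta / eps).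
have Y3 : 64 * kappa ^+ 2 / eps * Y ^+ 2 <= 1280 * kappa ^+ 2 * delta / eps * X.
  have -> : 1280 * kappa ^+ 2 * delta / eps * X =
    64 * kappa ^+ 2 / eps * (20 * delta * X) by ring.
  by rewrite ler_wpM2l// divr_ge0 ?(ltW e0)// mulr_ge0 ?sqr_ge0.
have O1 : 4 * (kappa * \sum_j q4 j ^+ 5 * nrm b j ^+ 2) <=
   eps * X ^+ 2 + 16 * kappa * delta ^+ 2 * ((4 * kappa + 1) / eps) ^+ 2.
  have : 4 * kappa * e' <= eps.
    rewrite /e' mulrA ler_pdivrMr// [leRHS]mulrC ler_wpM2r// ?(ltW e0)//; lra.
  move=> /(ler_wpM2r (sqr_ge0 X)).
  have := ler_wpM2l k0 omle.
  have -> : ((4 * kappa + 1) / eps) ^+ 2 = e' ^- 2.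
    by rewrite /e' -exprVn invf_div.
  lra.
have D1 : delta * X * Y ^+ 2 <= 20 * delta ^+ 2 * X ^+ 2.
  have -> : 20 * delta ^+ 2 * X ^+ 2 = delta * X * (20 * delta * X) by ring.
  by rewrite ler_wpM2l// mulr_ge0.
have -> : 4 * kappa ^+ 2 / eps = (4 * kappa) ^+ 2 / (4 * eps).
  by field; rewrite gt_eqF.
have := ql (Qform fr a a a b); have := ql (Qform fr a a b b).
have := ql (Qform fr a b a b); have := ql (Qform fr a b b b).
have := ql (Qform fr b b b b).
lra.
Qed.

End quartic_bound.

(** * Second moments *)

(** Two non-paired triads with the same value of [n1 + n2 - n3] that no sign change distinguishes
    agree up to the order of the first two entries. This supplies the hypothesis of
    [orthogonal_second_moment] for the cubic sums. *)
Lemma triad_parity (n1 n2 n3 m1 m2 m3 : int) :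
  n3 != n1 -> n3 != n2 -> m3 != m1 -> m3 != m2 -> n1 + n2 + m3 = m1 + m2 + n3 ->
  (forall j, (n1 == j) (+) (n2 == j) (+) (n3 == j) =
    (m1 == j) (+) (m2 == j) (+) (m3 == j)) ->
  (m1 = n1 /\ m2 = n2 /\ m3 = n3) \/ (m1 = n2 /\ m2 = n1 /\ m3 = n3).
Proof.
move=> n31 n32 m31 m32 nm par.
have n13 : n1 == n3 = false by rewrite eq_sym; exact/negbTE.
have n23 : n2 == n3 = false by rewrite eq_sym; exact/negbTE.
have m13 : m1 == m3 = false by rewrite eq_sym; exact/negbTE.
have m23 : m2 == m3 = false by rewrite eq_sym; exact/negbTE.
case: (eqVneq m3 n3) => [E|mn3].
  have {}nm : n1 + n2 = m1 + m2 by lia.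
  have := par n1; have := par m1.
  subst m3; rewrite !eqxx (negPf n31) (negPf m31).
  clear par; case: (eqVneq n2 n1) => ?; case: (eqVneq m2 m1) => ?;
    case: (eqVneq m1 n1) => ?; case: (eqVneq m2 n1) => ?; lia.
have := par n3; have := par m3; rewrite !eqxx n13 n23 m13 m23 (negPf mn3).
rewrite (eq_sym n3 m3) (negPf mn3) /=.
(* If [m3] differs from [n3], parity puts [n3] among [m1], [m2] and [m3] among [n1], [n2]. The two
   entries left over agree, and the linear relation becomes [2 n3 = 2 m3], a contradiction. *)
case: (eqVneq m1 n3) => [m1E|m1n3]; case: (eqVneq m2 n3) => [m2E|m2n3];
  case: (eqVneq n1 m3) => [n1E|n1m3]; case: (eqVneq n2 m3) => [n2E|n2m3]  // _ _.
- have /eqP : m2 == n2.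
    have := par n2; rewrite n1E m1E eqxx (negPf n32) (eq_sym m3) (negPf n2m3).
    by case: (m2 == n2).
  clear -m1E n1E nm n31; lia.
- have /eqP : m2 == n1.
    have := par n1; rewrite n2E m1E eqxx (negPf n31) (eq_sym m3) (negPf n1m3).
    by case: (m2 == n1).
  clear -m1E n2E nm n32; lia.
- have /eqP : m1 == n2.
    have := par n2; rewrite n1E m2E eqxx (negPf n32) (eq_sym m3) (negPf n2m3).
    by case: (m1 == n2).
  clear -m2E n1E nm n31; lia.
- have /eqP : m1 == n1.
    have := par n1; rewrite n2E m2E eqxx (negPf n31) (eq_sym m3) (negPf n1m3).
    by case: (m1 == n1).
  clear -m2E n2E nm n32; lia.
Qed.

(** * Sums over frequencies, uniformly in [N] *)

Section frequency_sums.
Context {R : realType}.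

Lemma freq_inj N : injective (@freq N).
Proof. by move=> i j /addIr [] /val_inj. Qed.

Lemma sum_freq (N : nat) (g : int -> R) :
  \sum_(k < N.*2.+1) g (freq k) =
  g 0 + \sum_(n < N) (g n.+1%:Z + g (- n.+1%:Z)).
Proof.
rewrite -(big_mkord xpredT (fun k : nat => g (k%:Z - N%:Z))).
rewrite (@big_cat_nat _ _ _ N) //=; last by rewrite -addnn -addnS leq_addr.
have := big_addn 0 N.*2.+1 N xpredT (fun k : nat => g (k%:Z - N%:Z)).
rewrite add0n => ->.
rewrite (_ : (N.*2.+1 - N = N.+1)%N); last by rewrite -addnn -addnS addKn.
rewrite big_nat_recl// add0n subrr addrCA; congr (_ + _).
rewrite big_nat_rev /= addrC -big_split /= big_mkord; apply: eq_bigr => n _.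
rewrite add0n; congr (g _ + g _); first by rewrite PoszD addrK.
by have := ltn_ord n; lia.
Qed.

(** A discrete integral test: the differences of [f] telescope, so the bound does not depend on
    [N]. *)
Lemma sum_freq_even_le (N : nat) (g : int -> R) (f : nat -> R) (c : R) :
  (forall n, g (- n) = g n) -> 0 <= c -> (forall n, 0 <= f n) ->
  (forall n : nat, g n.+1%:Z <= c * (f n - f n.+1)) ->
  \sum_(k < N.*2.+1) g (freq k) <= g 0 + 2 * c * f 0%N.
Proof.
move=> ge c0 f0 gf; rewrite sum_freq lerD2l.
apply: (@le_trans _ _ (\sum_(n < N) (2 * c * (f n - f n.+1)))).
  by apply: ler_sum => n _; rewrite ge; have := gf n; lra.
rewrite -mulr_sumr ler_wpM2l ?mulr_ge0//.
have -> : \sum_(n < N) (f n - f n.+1) = f 0%N - f N.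
  elim: N => [|N IH]; first by rewrite big_ord0 subrr.
  by rewrite big_ord_recr IH /=; ring.
by rewrite gerBl.
Qed.

(** Comparison with the telescoping differences of [(r + n)^-1], with constant 2. The total
    [r ^- 2 + 4 / r] is at most [5 / r] because [r >= 1]. *)
Lemma sum_resolvent_freq (N : nat) (r : R) : 1 <= r ->
  \sum_(k < N.*2.+1) (r ^+ 2 + (freq k)%:~R ^+ 2)^-1 <= 5 / r.
Proof.
move=> r1; have r0 : 0 < r by lra.
pose f (n : nat) : R := (r + n%:R)^-1.
have pos (n : nat) : 0 < r + n%:R by rewrite ltr_wpDr.
apply: (@le_trans _ _ ((r ^+ 2 + (0 : int)%:~R ^+ 2)^-1 + 2 * 2 * f 0%N)).
  apply: (@sum_freq_even_le N (fun n => (r ^+ 2 + n%:~R ^+ 2)^-1) f 2) => //.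
  - by move=> n; rewrite rmorphN sqrrN.
  - by move=> n; rewrite invr_ge0 ltW.
  move=> n; rewrite /f -pmulrn.
  have p1 := pos n; have p2 := pos n.+1.
  have E : n.+1%:R = n%:R + 1 :> R by rewrite -addn1 natrD.
  have q0 : 0 < r ^+ 2 + n.+1%:R ^+ 2 by rewrite ltr_wpDr ?sqr_ge0// exprn_gt0.
  have -> : (r + n%:R)^-1 - (r + n.+1%:R)^-1 = ((r + n%:R) * (r + n.+1%:R))^-1.
    by rewrite E in p2 *; field; rewrite !gt_eqF.
  rewrite ler_pdivlMr ?mulr_gt0// mulrC ler_pdivrMr//.
  have n0 : 0 <= n%:R :> R by [].
  rewrite E; have := sqr_ge0 (r - (n%:R + 1)); nra.
rewrite /f mulr0n expr0n addr0 addr0.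
have ri : r^-1 ^+ 2 <= r^-1.
  by rewrite expr2 ler_piMr ?invr_ge0 ?(ltW r0)// invf_le1.
by rewrite -exprVn; lra.
Qed.

Definition bracket4 (n : int) : R := Num.sqrt (Num.sqrt (japanese n)).

Lemma bracket4_ge1 n : 1 <= bracket4 n.
Proof.
rewrite -sqrtr1 ler_wsqrtr// -[X in X <= _]sqrtr1 ler_wsqrtr//.
exact: japanese_ge1.
Qed.

Lemma bracket4_gt0 n : 0 < bracket4 n.
Proof. exact: lt_le_trans ltr01 (bracket4_ge1 n). Qed.

Lemma bracket4X4 n : bracket4 n ^+ 4 = japanese n.
Proof.
rewrite (exprM _ 2 2) sqr_sqrtr ?sqrtr_ge0// sqr_sqrtr//.
exact: le_trans ler01 (japanese_ge1 n).
Qed.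

Lemma japaneseN (n : int) : japanese (- n) = japanese n :> R.
Proof. by rewrite /japanese rmorphN sqrrN. Qed.

(** The discrete form of the fact that [- 4 x^{-1/4}] is a primitive of [x^{-5/4}]. The constant is
    3 * 4: consecutive brackets differ by at least 1/3, and a difference of fourth powers is at most
    [4 * (s' - s) * s' ^+ 3]. *)
Lemma bracket4_step (n : nat) : (bracket4 n.+1%:Z ^+ 5)^-1 <=
  12 * ((bracket4 n%:Z)^-1 - (bracket4 n.+1%:Z)^-1).
Proof.
have E : n.+1%:R = n%:R + 1 :> R by rewrite -addn1 natrD.
have n0 : 0 <= n%:R :> R by [].
have jle (m : nat) : japanese m%:Z <= m%:R + 1 :> R.
  rewrite -(@ger0_norm _ (m%:R + 1)) ?addr_ge0// -sqrtr_sqr ler_wsqrtr//.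
  by rewrite -pmulrn; have : 0 <= m%:R :> R by []; nra.
have := jle n; have := jle n.+1; rewrite E.
have := @japanese_sqr R n; have := @japanese_sqr R n.+1; rewrite -!pmulrn E.
have := @japanese_ge1 R n; have := @japanese_ge1 R n.+1.
rewrite -!bracket4X4.
have := bracket4_ge1 n; have := bracket4_ge1 n.+1.
move: (bracket4 n) (bracket4 n.+1) (n%:R : R) n0 => s s' m m0 s'1 s1 j1' j1 e' e l' l.
have d : 1 <= 3 * (s' ^+ 4 - s ^+ 4).
  have : (s' ^+ 4 - s ^+ 4) * (s' ^+ 4 + s ^+ 4) = 2 * m + 1.
    have -> : (s' ^+ 4 - s ^+ 4) * (s' ^+ 4 + s ^+ 4) = (s' ^+ 4) ^+ 2 - (s ^+ 4) ^+ 2.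
      by ring.
    by rewrite e e'; ring.
  move: (s' ^+ 4) (s ^+ 4) l l' j1 j1' => u v l l' j1 j1'; nra.
have ss' : s <= s'.
  rewrite leNgt; apply/negP => lt.
  have : s' ^+ 4 <= s ^+ 4 by rewrite lerXn2r// ?nnegrE; lra.
  lra.
have d2 : 1 <= 12 * ((s' - s) * s' ^+ 3).
  have -> : 12 * ((s' - s) * s' ^+ 3) = 3 * ((s' - s) * (4 * s' ^+ 3)) by ring.
  apply: (le_trans d); rewrite ler_pM2l//.
  have -> : s' ^+ 4 - s ^+ 4 = (s' - s) * (s' ^+ 3 + s' ^+ 2 * s + s' * s ^+ 2 + s ^+ 3).
    by ring.
  apply: ler_wpM2l; first by lra.
  have h2 : s ^+ 2 <= s' ^+ 2 by rewrite lerXn2r// ?nnegrE; lra.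
  have h3 : s ^+ 3 <= s' ^+ 3 by rewrite lerXn2r// ?nnegrE; lra.
  have h4 : s' ^+ 2 * s <= s' ^+ 3 by rewrite [leRHS]exprSr ler_wpM2l ?sqr_ge0.
  have h5 : s' * s ^+ 2 <= s' ^+ 3 by rewrite [leRHS]exprS ler_wpM2l//; lra.
  lra.
have sp : 0 < s by lra. have s'p : 0 < s' by lra.
have -> : s^-1 - s'^-1 = (s' - s) / (s * s') by field; rewrite !gt_eqF.
rewrite mulrA ler_pdivlMr ?mulr_gt0// mulrC ler_pdivrMr ?exprn_gt0//.
apply: (@le_trans _ _ (s' ^+ 2)); first by rewrite expr2 ler_wpM2r// ltW.
rewrite -[X in X <= _]mul1r.
have -> : 12 * (s' - s) * s' ^+ 5 = 12 * ((s' - s) * s' ^+ 3) * s' ^+ 2 by ring.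
by rewrite ler_wpM2r// sqr_ge0.
Qed.

Lemma sum_bracket4_freq (N : nat) :
  \sum_(k < N.*2.+1) (bracket4 (freq k) ^+ 5)^-1 <= 25.
Proof.
have b0 : bracket4 0 = 1.
  by rewrite /bracket4 /japanese expr0n addr0 !sqrtr1.
apply: (@le_trans _ _ ((bracket4 0 ^+ 5)^-1 + 2 * 12 * (bracket4 0%N%:Z)^-1)).
  apply: (@sum_freq_even_le N (fun n => (bracket4 n ^+ 5)^-1)
     (fun n => (bracket4 n%:Z)^-1) 12) => //.
  - by move=> n; rewrite /bracket4 japaneseN.
  - by move=> n; rewrite invr_ge0 ltW// bracket4_gt0.
  - exact: bracket4_step.
by rewrite b0 expr1n invr1; lra.
Qed.

End frequency_sums.

(** * Moments of the bilinear form *)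

Section second_moments.
Context {R : realType}.
Local Notation noise := (g_sigma_algebraType (@cylinders R)).
Variable lam : probability noise R.
Hypothesis lamP : is_white_noise lam.
Variable C : R.
Hypothesis momentC : forall n,
  (\int[lam]_x ((1 + normc (zc n x) ^+ 2) ^+ 3)%:E <= C%:E)%E.
Local Notation h n x := (normc (zc n x) ^+ 2).

Lemma measurable_zc2 n : measurable_fun setT (fun x : noise => h n x).
Proof. exact: (measurable_normc2 (cmeasurable_zc n)). Qed.

Lemma moment_cubes_le (c : R) (F : noise -> R) (i j k : int) :
  0 <= c -> measurable_fun setT F ->
  (forall x, 0 <= F x <= c / 3 *
     ((1 + h i x) ^+ 3 + ((1 + h j x) ^+ 3 + (1 + h k x) ^+ 3))) ->
  (\int[lam]_x (F x)%:E <= (c * C)%:E)%E.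
Proof.
move=> c0 mF Fle.
have m3 n : measurable_fun setT (fun x : noise => ((1 + h n x) ^+ 3)%:E).
  apply/measurable_EFinP; apply: measurable_funX; apply: measurable_funD => //.
  exact: measurable_zc2.
have p3 n x : 0 <= (1 + h n x) ^+ 3 by rewrite exprn_ge0// addr_ge0// sqr_ge0.
have c3 : 0 <= c / 3 by rewrite divr_ge0.
apply: (@le_trans _ _ (\int[lam]_x ((c / 3)%:E * (((1 + h i x) ^+ 3)%:E +
    (((1 + h j x) ^+ 3)%:E + ((1 + h k x) ^+ 3)%:E))))%E).
  apply: ge0_le_integral => //.
  - by move=> x _; rewrite lee_fin; case/andP: (Fle x).
  - exact/measurable_EFinP.
  - by apply: measurable_funeM; do 2!(apply: emeasurable_funD => //).
  move=> x _; rewrite -!EFinD -EFinM lee_fin.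
  by case/andP: (Fle x).
have mjk : measurable_fun setT (fun x : noise =>
    (((1 + h j x) ^+ 3)%:E + ((1 + h k x) ^+ 3)%:E)%E) by exact: emeasurable_funD.
have pjk (x : noise) : setT x -> (0 <= ((1 + h j x) ^+ 3)%:E + ((1 + h k x) ^+ 3)%:E)%E.
  by move=> _; rewrite -EFinD lee_fin addr_ge0.
rewrite ge0_integralZl ?lee_fin//; last 2 first.
- exact: emeasurable_funD.
- by move=> x _; rewrite -!EFinD lee_fin; apply: addr_ge0; rewrite ?addr_ge0 ?p3.
rewrite (ge0_integralD _ measurableT _ _ pjk mjk)//; last first.
  by move=> x _; rewrite lee_fin p3.
rewrite ge0_integralD//; try by move=> x _; rewrite lee_fin p3.
apply: (@le_trans _ _ ((c / 3)%:E * (C%:E + (C%:E + C%:E)))%E).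
  by apply: lee_wpmul2l; rewrite ?lee_fin//; do 2!(apply: leeD => //).
by rewrite -!EFinD -EFinM lee_fin; lra.
Qed.

(** The arithmetic-geometric mean inequality reduces a product over three coordinates to moments of
    single coordinates, so [i], [j], [k] may coincide. *)
Lemma moment3_le (c : R) (F : noise -> R) (i j k : int) :
  0 <= c -> measurable_fun setT F ->
  (forall x, 0 <= F x <= c * ((1 + h i x) * (1 + h j x) * (1 + h k x))) ->
  (\int[lam]_x (F x)%:E <= (c * C)%:E)%E.
Proof.
move=> c0 mF Fle; apply: (@moment_cubes_le _ _ i j k) => // x.
case/andP: (Fle x) => -> /le_trans; apply.
rewrite -[leRHS]mulrA ler_wpM2l//.
have : 0 <= 1 + h i x by rewrite addr_ge0// sqr_ge0.
have : 0 <= 1 + h j x by rewrite addr_ge0// sqr_ge0.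
have : 0 <= 1 + h k x by rewrite addr_ge0// sqr_ge0.
move: (1 + h i x) (1 + h j x) (1 + h k x) => u v w w0 v0 u0.
have := mulr_ge0 (addr_ge0 (addr_ge0 u0 v0) w0)
  (addr_ge0 (addr_ge0 (sqr_ge0 (u - v)) (sqr_ge0 (v - w))) (sqr_ge0 (w - u))).
lra.
Qed.

Lemma zc_flip_at n j (x : noise) :
  zc n (flip_at j x) = if n == j then - zc n x else zc n x.
Proof. by rewrite /zc /flip_at /flip; case: eqP. Qed.

Variables (I : finType) (fr : I -> int) (rv : I -> I).
Hypotheses (fr_inj : injective fr) (frN : forall i, fr (rv i) = - fr i).
Variables (M Z : R) (al : int -> R).
Hypotheses (M0 : 0 <= M) (alM : forall n, `|al n| <= M / japanese n)
  (alN : forall n, al (- n) = al n).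
Local Notation w i := (japanese (fr i) : R).
Hypothesis sumZ : \sum_i (bracket4 (fr i) ^+ 5)^-1 <= Z.

Definition noise_coef (x : noise) (i : I) : R[i] := ((al (fr i))%:C)%C * zc (fr i) x.

Let w0 i : 0 < w i. Proof. exact: lt_le_trans ltr01 (japanese_ge1 _). Qed.

Lemma cmeasurable_noise_coef i : cmeasurable (noise_coef^~ i).
Proof. by apply: cmeasurableM; [exact: cmeasurable_cst|exact: cmeasurable_zc]. Qed.

Lemma noise_coef_flip_at j x i : noise_coef (flip_at (fr j) x) i =
  if i == j then - noise_coef x i else noise_coef x i.
Proof.
rewrite /noise_coef zc_flip_at (inj_eq fr_inj); case: eqP => // _.
by rewrite mulrN.
Qed.

Lemma al2_le i : al (fr i) ^+ 2 <= M ^+ 2 / w i ^+ 2.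
Proof.
rewrite -expr_div_n -real_normK ?num_real//.
by rewrite ler_sqr ?nnegrE// divr_ge0// ltW.
Qed.

Lemma normc_noise_coef x i : normc (noise_coef x i) ^+ 2 = al (fr i) ^+ 2 * h (fr i) x.
Proof.
by rewrite /noise_coef ComplexField.Normc.normcM normc_real exprMn real_normK ?num_real.
Qed.

Lemma sum_invw2_le : \sum_i (w i ^+ 2)^-1 <= Z.
Proof.
apply: le_trans sumZ; apply: ler_sum => i _.
have b0 := bracket4_gt0 (fr i) : 0 < bracket4 (fr i) :> R.
rewrite lef_pV2 ?posrE ?exprn_gt0//.
rewrite -bracket4X4 -exprM ler_weXn2l//; exact: bracket4_ge1.
Qed.

Let Z0 : 0 <= Z.
Proof.
by apply: le_trans sum_invw2_le; apply: sumr_ge0 => i _; rewrite invr_ge0 sqr_ge0.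
Qed.

Lemma fr2_le i : (fr i)%:~R ^+ 2 * al (fr i) ^+ 2 <= M ^+ 2.
Proof.
have f2 : (fr i)%:~R ^+ 2 <= w i ^+ 2 by rewrite japanese_sqr lerDr.
apply: (le_trans (ler_pM (sqr_ge0 _) (sqr_ge0 _) f2 (al2_le i))).
by rewrite mulrC divfK// gt_eqF// exprn_gt0.
Qed.

(** As [j != l], each summand has two different coordinates, and distinct summands are orthogonal
    under a sign change. One symbol absorbs the derivative; the other leaves <n>^{-2}, summed over
    [k] because [k] determines [i]. *)
Lemma Bform_offdiag_moment j l : j != l ->
  (\int[lam]_x (normc (Bform fr (noise_coef x) j l) ^+ 2)%:E <=
   (2 * (M ^+ 4 * C * Z))%:E)%E.
Proof.
move=> jl.
have frjl : fr j != fr l by rewrite (inj_eq fr_inj).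
pose good (p : I * I) := fr p.1 + fr j == fr p.2 + fr l.
pose term i k (x : noise) : R[i] :=
  (fr i)%:~R * (noise_coef x i * conjc (noise_coef x k)).
pose X (p : I * I) (x : noise) : R[i] := if good p then term p.1 p.2 x else 0.
pose v (p : I * I) := if good p then M ^+ 4 / w p.2 ^+ 2 * C else 0.
have Bx x : Bform fr (noise_coef x) j l = \sum_p X p x by rewrite /Bform big_mkcond.
have C0 : 0 <= C.
  rewrite -lee_fin; apply: le_trans (momentC 0); apply: integral_ge0 => x _.
  by rewrite lee_fin exprn_ge0// addr_ge0// sqr_ge0.
have mX p : cmeasurable (X p).
  have [gp|/negPf gp] := boolP (good p); rewrite /X gp; last exact: cmeasurable_cst.
  apply: cmeasurableM; first exact: cmeasurable_cst.
  apply: cmeasurableM; first exact: cmeasurable_noise_coef.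
  exact/cmeasurableJ/cmeasurable_noise_coef.
under eq_integral do rewrite Bx.
apply: le_trans (@orthogonal_second_moment _ lam _ X id v mX _ (@inj_id _) _) _.
- move=> p; have := measurable_normc2 (mX p).
  have [gp|/negPf gp] := boolP (good p); rewrite /v /X gp => mXp; last first.
    by rewrite ComplexField.Normc.normc0 expr0n integral0.
  (* Only two coordinates occur; the frequency 0 fills the third place with a factor at least 1. *)
  apply: (@moment3_le _ _ (fr p.1) (fr p.2) 0).
  + by rewrite divr_ge0 ?exprn_ge0// ltW.
  + exact: mXp.
  move=> x; rewrite sqr_ge0 andTb 2!ComplexField.Normc.normcM normcJ normc_int.
  rewrite !exprMn real_normK ?num_real// !normc_noise_coef.
  have h1 : 0 <= h (fr p.1) x := sqr_ge0 _.
  have h2 : 0 <= h (fr p.2) x := sqr_ge0 _.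
  have h3 : 0 <= h 0 x := sqr_ge0 _.
  rewrite [leLHS](_ : _ = ((fr p.1)%:~R ^+ 2 * al (fr p.1) ^+ 2) * al (fr p.2) ^+ 2 *
    (h (fr p.1) x * h (fr p.2) x)); last by ring.
  apply: ler_pM.
  + by apply: mulr_ge0; [apply: mulr_ge0|]; exact: sqr_ge0.
  + exact: (mulr_ge0 h1 h2).
  + have -> : M ^+ 4 / w p.2 ^+ 2 = M ^+ 2 * (M ^+ 2 / w p.2 ^+ 2) by ring.
    apply: (ler_pM _ _ (fr2_le _) (al2_le _)); last exact: sqr_ge0.
    by apply: mulr_ge0; exact: sqr_ge0.
  move: h1 h2 h3; move: (h (fr p.1) x) (h (fr p.2) x) (h 0 x) => a b c a0 b0 c0.
  have ab : a * b <= (1 + a) * (1 + b) by rewrite ler_pM//; lra.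
  apply: (le_trans ab); rewrite ler_peMr ?mulr_ge0//; lra.
- move=> p p' p'p _.
  have [gp|gp] := boolP (good p); last first.
    exists (flip_at 0); first exact: noise_symmetry_flip_at.
    by move=> x; rewrite /X (negPf gp) !dotc0l oppr0.
  have [gp'|gp'] := boolP (good p'); last first.
    exists (flip_at 0); first exact: noise_symmetry_flip_at.
    by move=> x; rewrite /X (negPf gp') ![dotc _ 0]dotcC !dotc0l oppr0.
  move: gp gp' p'p; rewrite /X; case: p p' => [i k] [i' k']; rewrite /good /=.
  move=> /[dup] /eqP e gp /[dup] /eqP e' gp' ne; rewrite gp gp'.
  have ik : i != k by apply: contraNneq frjl => ik; move: e; rewrite ik => /addrI ->.
  have ik' : i' != k' by apply: contraNneq frjl => ik'; move: e'; rewrite ik' => /addrI ->.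
  have ii' : i != i'.
    apply: contraNneq ne => ii'; move: e'; rewrite -ii' e => /addIr/fr_inj ->.
    by rewrite eqxx.
  have kk' : k != k'.
    apply: contraNneq ne => kk'; move: e'; rewrite -kk' -e => /addIr/fr_inj ->.
    by rewrite eqxx.
  (* The sign change at [fr i] separates the two summands unless [i = k']. In that case [k] works:
     [k = i'] would give [fr j - fr l] two opposite values, hence [j = l]. *)
  have [ik2|ik2] := eqVneq i k'.
    have i'k : i' != k.
      apply: contraNneq frjl => i'k; move: e e'; rewrite i'k -ik2 => e e'.
      by apply/eqP; clear -e e'; lia.
    exists (flip_at (fr k)); first exact: noise_symmetry_flip_at.
    move=> x; rewrite /term !noise_coef_flip_at eqxx (negPf ik) (negPf i'k).
    rewrite (eq_sym k' k) (negPf kk').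
    by rewrite rmorphN !mulrN dotcNl.
  exists (flip_at (fr i)); first exact: noise_symmetry_flip_at.
  move=> x; rewrite /term !noise_coef_flip_at eqxx (eq_sym k) (negPf ik) (eq_sym i') (negPf ii').
  by rewrite (eq_sym k') (negPf ik2) mulNr mulrN dotcNl.
have -> : \sum_p v p = \sum_i \sum_(k | fr i + fr j == fr k + fr l)
    (M ^+ 4 / w k ^+ 2 * C).
  by rewrite pair_big_dep /= [RHS]big_mkcond; apply: eq_bigr => p _.
rewrite lee_fin ler_pM2l// (exchange_big_dep xpredT)//=.
apply: (@le_trans _ _ (\sum_k M ^+ 4 / w k ^+ 2 * C)).
  apply: ler_sum => k _; case: (pickP (fun i => fr i + fr j == fr k + fr l)) => [i0 ei0|e0].
    rewrite (big_pred1 i0)// => i; apply/idP/eqP => [/eqP|-> //].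
    by rewrite -(eqP ei0) => /addIr/fr_inj.
  by rewrite big_pred0// mulr_ge0// divr_ge0 ?exprn_ge0// ltW.
rewrite -mulr_suml -mulr_sumr mulrAC ler_wpM2l//; first by rewrite mulr_ge0 ?exprn_ge0.
exact: sum_invw2_le.
Qed.

(* The summands of the diagonal have non-zero mean; since al is even, pairing n
   with -n makes them orthogonal under the swap of the coordinates n and -n. *)
Lemma Bform_diag_moment j :
  (\int[lam]_x (normc (Bform fr (noise_coef x) j j) ^+ 2)%:E <=
   (2 * (M ^+ 4 * C * Z))%:E)%E.
Proof.
have C0 : 0 <= C.
  rewrite -lee_fin; apply: le_trans (momentC 0); apply: integral_ge0 => x _.
  by rewrite lee_fin exprn_ge0// addr_ge0// sqr_ge0.
pose Y i x := 2^-1 * ((fr i)%:~R * al (fr i) ^+ 2) * (h (fr i) x - h (fr (rv i)) x).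
pose X i (x : noise) : R[i] := ((Y i x)%:C)%C.
have Bx x : Bform fr (noise_coef x) j j = \sum_i X i x.
  have -> : Bform fr (noise_coef x) j j =
      \sum_i (((fr i)%:~R * al (fr i) ^+ 2 * h (fr i) x)%:C)%C.
    rewrite /Bform (reindex_onto (fun i => (i, i)) fst) /=; last first.
      by move=> [i k] /= /eqP/addIr/fr_inj ->.
    apply: eq_big => [i|i _]; first by rewrite !eqxx.
    by rewrite -mulrA -normc_noise_coef rmorphM mulc_conj; congr (_ * _);
      rewrite rmorph_int.
  rewrite -!rmorph_sum /=; congr (_ %:C)%C.
  pose G (i : I) := (fr i)%:~R * al (fr i) ^+ 2 * h (fr i) x.
  have rvK : involutive rv by move=> i; apply: fr_inj; rewrite !frN opprK.
  have E : \sum_i G i = - \sum_i (fr i)%:~R * al (fr i) ^+ 2 * h (fr (rv i)) x.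
    rewrite (reindex_inj (inv_inj rvK)) -sumrN; apply: eq_bigr => i _.
    by rewrite /G frN alN rmorphN !mulNr.
  have -> : \sum_i Y i x = 2^-1 * (\sum_i G i -
      \sum_i (fr i)%:~R * al (fr i) ^+ 2 * h (fr (rv i)) x).
    by rewrite -sumrB mulr_sumr; apply: eq_bigr => i _; rewrite /Y /G; ring.
  rewrite -[LHS]/(\sum_i G i); move: E; lra.
have mY i : measurable_fun setT (Y i).
  apply: measurable_funM => //; apply: measurable_funB; exact: measurable_zc2.
have mX i : cmeasurable (X i).
  by split; [exact: mY|exact: measurable_cst].
under eq_integral do rewrite Bx.
pose v i := M ^+ 4 / w i ^+ 2 * C.
have rvinj : injective rv.
  by move=> i k /(congr1 fr); rewrite !frN => /oppr_inj/fr_inj.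
apply: le_trans (@orthogonal_second_moment _ lam _ X rv v mX _ rvinj _) _.
- move=> i; have XE x : normc (X i x) ^+ 2 = Y i x ^+ 2.
    by rewrite normc_real real_normK ?num_real.
  under eq_integral do rewrite XE.
  apply: (@moment_cubes_le _ _ (fr i) (fr (rv i)) (fr i)).
  + by rewrite divr_ge0 ?exprn_ge0// ltW.
  + exact: measurable_funX.
  move=> x; rewrite sqr_ge0 andTb /Y !exprMn.
  have h1 : 0 <= h (fr i) x := sqr_ge0 _.
  have h2 : 0 <= h (fr (rv i)) x := sqr_ge0 _.
  have f1 := fr2_le i; have f2 := al2_le i.
  have f3 : ((fr i)%:~R ^+ 2 * al (fr i) ^+ 2) * al (fr i) ^+ 2 <= M ^+ 2 * (M ^+ 2 / w i ^+ 2).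
    by apply: (ler_pM _ _ f1 f2); [apply: mulr_ge0|]; exact: sqr_ge0.
  have E : M ^+ 2 * (M ^+ 2 / w i ^+ 2) = M ^+ 4 / w i ^+ 2 by ring.
  rewrite E in f3.
  have q0 : 0 <= M ^+ 4 / w i ^+ 2 by rewrite divr_ge0 ?exprn_ge0// ltW.
  rewrite [leLHS](_ : _ = ((fr i)%:~R ^+ 2 * al (fr i) ^+ 2 * al (fr i) ^+ 2) *
     ((h (fr i) x - h (fr (rv i)) x) ^+ 2 / 4)); last by field.
  rewrite -[leRHS]mulrA.
  apply: (ler_pM _ _ f3); first by apply: mulr_ge0; [apply: mulr_ge0|]; exact: sqr_ge0.
    by rewrite divr_ge0// sqr_ge0.
  move: h1 h2; move: (h (fr i) x) (h (fr (rv i)) x) => a b a0 b0.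
  have := mulr_ge0 (mulr_ge0 a0 a0) a0; have := mulr_ge0 (mulr_ge0 b0 b0) b0.
  by have := mulr_ge0 a0 b0; have := sqr_ge0 a; have := sqr_ge0 b; lra.
- move=> i k ki kri.
  exists (swap_at (fr i)); first exact: noise_symmetry_swap_at.
  have hs n x : h n (swap_at (fr i) x) =
     h (if `|n|%N == `|fr i|%N then - n else n) x by [].
  have ki' : `|fr k|%N == `|fr i|%N = false.
    apply/negbTE/eqP => e; have [] : fr k = fr i \/ fr k = - fr i by clear -e; lia.
      by move=> /fr_inj/eqP; exact/negP.
    by rewrite -frN => /fr_inj/eqP; exact/negP.
  move=> x; rewrite /X /dotc /= !mulr0 !addr0 /Y !hs !frN !abszN eqxx ki' opprK.
  by ring.
rewrite lee_fin ler_pM2l// /v -mulr_suml -mulr_sumr mulrAC ler_wpM2l//.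
  by rewrite mulr_ge0 ?exprn_ge0.
exact: sum_invw2_le.
Qed.

Lemma Bform_moment j l :
  (\int[lam]_x (normc (Bform fr (noise_coef x) j l) ^+ 2)%:E <=
   (2 * (M ^+ 4 * C * Z))%:E)%E.
Proof.
have [->|] := eqVneq j l; first exact: Bform_diag_moment.
exact: Bform_offdiag_moment.
Qed.

End second_moments.

(** * Moments of the non-paired cubic sums *)

Section cubic_moment.
Context {R : realType}.
Local Notation noise := (g_sigma_algebraType (@cylinders R)).
Variable lam : probability noise R.
Hypothesis lamP : is_white_noise lam.
Variable C : R.
Hypothesis momentC : forall n,
  (\int[lam]_x ((1 + normc (zc n x) ^+ 2) ^+ 3)%:E <= C%:E)%E.
Variables (I : finType) (fr : I -> int).
Hypotheses (fr_inj : injective fr).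
Variables (M Z : R) (al : int -> R).
Hypotheses (M0 : 0 <= M) (alM : forall n, `|al n| <= M / japanese n).
Local Notation w i := (japanese (fr i) : R).
Local Notation coef := (noise_coef fr al).
Local Notation h n x := (normc (zc n x) ^+ 2).
Hypothesis sumZ : \sum_i (bracket4 (fr i) ^+ 5)^-1 <= Z.

Let w0 i : 0 < w i. Proof. exact: lt_le_trans ltr01 (japanese_ge1 _). Qed.

Let C0 : 0 <= C.
Proof.
rewrite -lee_fin; apply: le_trans (momentC 0); apply: integral_ge0 => x _.
by rewrite lee_fin exprn_ge0// addr_ge0// sqr_ge0.
Qed.

Let P (p : I * I * I) (j : int) :=
  (fr p.1.1 == j) (+) (fr p.1.2 == j) (+) (fr p.2 == j).

Lemma cmeasurable_Aterm p : cmeasurable (fun x : noise => Aterm fr (coef x) p).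
Proof.
rewrite /Aterm; apply: cmeasurableM; first exact: cmeasurable_cst.
apply: cmeasurableM; last exact/cmeasurableJ/cmeasurable_noise_coef.
by apply: cmeasurableM; exact: cmeasurable_noise_coef.
Qed.

Lemma Aterm_flip_at p j x : Aterm fr (coef (flip_at j x)) p =
  if P p j then - Aterm fr (coef x) p else Aterm fr (coef x) p.
Proof.
have E i : coef (flip_at j x) i = if fr i == j then - coef x i else coef x i.
  by rewrite /noise_coef zc_flip_at; case: eqP => // _; rewrite mulrN.
rewrite /Aterm /P !E; case: eqP => _; case: eqP => _; case: eqP => _;
  by rewrite ?rmorphN ?mulrN ?mulNr ?mulrN ?opprK //= ?mulrN ?opprK.
Qed.

(** The map [s] exchanges the first two frequencies, which give the same monomial. Any other two
    non-paired triads with the same [l] are separated by a sign change, by [triad_parity]. *)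
Lemma Anonpaired_moment l :
  (\int[lam]_x (normc (Anonpaired fr (coef x) l) ^+ 2)%:E <=
   (2 * \sum_(p | triad fr l p) (fr p.1.1 + fr p.1.2)%:~R ^+ 2 *
      (M ^+ 6 * ((w p.1.1 ^+ 2)^-1 * (w p.1.2 ^+ 2)^-1 * (w p.2 ^+ 2)^-1)) * C)%:E)%E.
Proof.
pose good p := triad fr l p && nonpaired p.
pose X p (x : noise) : R[i] := if good p then Aterm fr (coef x) p else 0.
pose V (p : I * I * I) : R := (fr p.1.1 + fr p.1.2)%:~R ^+ 2 *
      (M ^+ 6 * ((w p.1.1 ^+ 2)^-1 * (w p.1.2 ^+ 2)^-1 * (w p.2 ^+ 2)^-1)).
have V0 p : 0 <= V p.
  by rewrite mulr_ge0 ?sqr_ge0// mulr_ge0 ?exprn_ge0// !mulr_ge0 ?invr_ge0 ?sqr_ge0.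
pose v p := if good p then V p * C else 0.
have Ax x : Anonpaired fr (coef x) l = \sum_p X p x by rewrite /Anonpaired big_mkcond.
have mX p : cmeasurable (X p).
  have [gp|/negPf gp] := boolP (good p); rewrite /X gp; last exact: cmeasurable_cst.
  exact: cmeasurable_Aterm.
pose s (p : I * I * I) := ((p.1.2, p.1.1), p.2).
have sinj : injective s by move=> [[i j] k] [[i' j'] k'] [-> -> ->].
have eqp (q q' : I * I * I) :
    q.1.1 = q'.1.1 -> q.1.2 = q'.1.2 -> q.2 = q'.2 -> q = q'.
  by case: q q' => [[? ?] ?] [[? ?] ?] /= -> -> ->.
under eq_integral do rewrite Ax.
apply: le_trans (@orthogonal_second_moment _ lam _ X s v mX _ sinj _) _.
- move=> p; have := measurable_normc2 (mX p).
  have [gp|/negPf gp] := boolP (good p); rewrite /v /X gp => mXp; last first.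
    by rewrite ComplexField.Normc.normc0 expr0n integral0.
  apply: (@moment3_le _ _ _ momentC _ _ (fr p.1.1) (fr p.1.2) (fr p.2)) => // x.
  rewrite sqr_ge0 andTb /Aterm 3!ComplexField.Normc.normcM normcJ normc_int.
  rewrite !exprMn real_normK ?num_real// !normc_noise_coef.
  have a1 := al2_le fr M0 alM p.1.1; have a2 := al2_le fr M0 alM p.1.2.
  have a3 := al2_le fr M0 alM p.2.
  have h1 : 0 <= h (fr p.1.1) x := sqr_ge0 _.
  have h2 : 0 <= h (fr p.1.2) x := sqr_ge0 _.
  have h3 : 0 <= h (fr p.2) x := sqr_ge0 _.
  rewrite [leLHS](_ : _ = ((fr p.1.1 + fr p.1.2)%:~R ^+ 2 *
    (al (fr p.1.1) ^+ 2 * al (fr p.1.2) ^+ 2 * al (fr p.2) ^+ 2)) *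
    (h (fr p.1.1) x * h (fr p.1.2) x * h (fr p.2) x)); last by ring.
  have q1 := sqr_ge0 (al (fr p.1.1)); have q2 := sqr_ge0 (al (fr p.1.2)).
  have q3 := sqr_ge0 (al (fr p.2)).
  apply: ler_pM.
  + by apply: mulr_ge0; [exact: sqr_ge0|apply: mulr_ge0; [exact: mulr_ge0|]].
  + by apply: mulr_ge0; [exact: mulr_ge0|].
  + apply: ler_wpM2l; first exact: sqr_ge0.
    have -> : M ^+ 6 * ((w p.1.1 ^+ 2)^-1 * (w p.1.2 ^+ 2)^-1 * (w p.2 ^+ 2)^-1) =
      (M ^+ 2 / w p.1.1 ^+ 2) * (M ^+ 2 / w p.1.2 ^+ 2) * (M ^+ 2 / w p.2 ^+ 2) by ring.
    apply: (ler_pM _ q3 _ a3); first exact: mulr_ge0.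
    exact: (ler_pM q1 q2 a1 a2).
  move: h1 h2 h3; move: (h (fr p.1.1) x) (h (fr p.1.2) x) (h (fr p.2) x).
  move=> a b c a0 b0 c0; apply: ler_pM => //; rewrite ?mulr_ge0//; last by lra.
  by apply: ler_pM => //; lra.
- move=> p p' p'p p'sp.
  have [gp|gp] := boolP (good p); last first.
    exists (flip_at 0); first exact: noise_symmetry_flip_at.
    by move=> x; rewrite /X (negPf gp) !dotc0l oppr0.
  have [gp'|gp'] := boolP (good p'); last first.
    exists (flip_at 0); first exact: noise_symmetry_flip_at.
    by move=> x; rewrite /X (negPf gp') ![dotc _ 0]dotcC !dotc0l oppr0.
  have [j Pj] : exists j, P p j != P p' j.
    apply/not_existsP => Pall.
    have {}Pall j : P p j = P p' j by apply/eqP; apply: contra_notT (Pall j).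
    case/andP: gp => /eqP e /andP[n1 n2]; case/andP: gp' => /eqP e' /andP[n1' n2'].
    have := @triad_parity (fr p.1.1) (fr p.1.2) (fr p.2) (fr p'.1.1) (fr p'.1.2) (fr p'.2).
    rewrite !(inj_eq fr_inj) => /(_ n1 n2 n1' n2').
    have key : fr p.1.1 + fr p.1.2 + fr p'.2 = fr p'.1.1 + fr p'.1.2 + fr p.2.
      by rewrite e e' addrAC [RHS]addrAC; congr (_ + _); exact: addrC.
    move=> /(_ key Pall); case.
      move=> [/fr_inj e1 [/fr_inj e2 /fr_inj e3]].
      by case/eqP: p'p; exact: eqp.
    move=> [/fr_inj e1 [/fr_inj e2 /fr_inj e3]].
    by case/eqP: p'sp; exact: eqp.
  exists (flip_at j); first exact: noise_symmetry_flip_at.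
  move=> x; rewrite /X gp gp' !Aterm_flip_at; move: Pj.
  by case: (P p j); case: (P p' j) => // _; rewrite ?dotcNl ?dotcNr.
rewrite lee_fin ler_pM2l// [leRHS]big_mkcond; apply: ler_sum => p _.
rewrite /v /good; case: (triad fr l p) => //=; case: (nonpaired p) => //.
exact: (mulr_ge0 (V0 p) C0).
Qed.

(** With the weight <l>^{-2}, the bound [(n3 + l) ^+ 2 <= 2 * (<n3> ^+ 2 + <l> ^+ 2)] cancels one of
    four inverse squares. Three remain, and they determine the fourth frequency, whence the cube of
    [Z]. The constant 8 is 2 from orthogonality, 2 from this inequality and 2 for its two terms. *)
Lemma sum_Anonpaired_moment :
  (\int[lam]_x (\sum_l (normc (Anonpaired fr (coef x) l) / w l) ^+ 2)%:E <=
   (8 * (M ^+ 6 * C * Z ^+ 3))%:E)%E.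
Proof.
have mA l : measurable_fun setT (fun x : noise => normc (Anonpaired fr (coef x) l) ^+ 2).
  have mA : cmeasurable (fun x : noise => Anonpaired fr (coef x) l).
    by apply: cmeasurable_sum => p _; exact: cmeasurable_Aterm.
  exact: (measurable_normc2 mA).
have E x : (\sum_l (normc (Anonpaired fr (coef x) l) / w l) ^+ 2)%:E =
   (\sum_(l <- index_enum I) (w l ^+ 2)^-1%:E *
     (normc (Anonpaired fr (coef x) l) ^+ 2)%:E)%E.
  by rewrite -sumEFin; apply: eq_bigr => l _; rewrite -EFinM expr_div_n mulrC.
under eq_integral do rewrite E.
have wi l : 0 <= (w l ^+ 2)^-1 by rewrite invr_ge0 sqr_ge0.
rewrite ge0_integral_sum//; last 2 first.
- by move=> l; apply: measurable_funeM; exact/measurable_EFinP.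
- by move=> l x _; rewrite -EFinM lee_fin mulr_ge0// sqr_ge0.
pose g i := (w i ^+ 2)^-1.
pose T l (p : I * I * I) := g p.1.1 * g p.1.2 * g p.2 + g p.1.1 * g p.1.2 * g l.
apply: (@le_trans _ _ (\sum_l (4 * (M ^+ 6 * C) * \sum_(p | triad fr l p) T l p)%:E)%E).
  apply: lee_sum => l _.
  have mAE : measurable_fun setT
      (fun x : noise => (normc (Anonpaired fr (coef x) l) ^+ 2)%:E).
    exact/measurable_EFinP.
  have A0 (x : noise) : setT x -> (0 <= (normc (Anonpaired fr (coef x) l) ^+ 2)%:E)%E.
    by move=> _; rewrite lee_fin sqr_ge0.
  rewrite (ge0_integralZl lam measurableT mAE A0); last by rewrite lee_fin.
  apply: (le_trans (lee_wpmul2l _ (Anonpaired_moment l))); first by rewrite lee_fin.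
  rewrite -EFinM lee_fin !mulr_sumr; apply: ler_sum => p /eqP tr.
  rewrite tr /T /g.
  have k2 : (fr p.2 + fr l)%:~R ^+ 2 <= 2 * (w p.2 ^+ 2 + w l ^+ 2) :> R.
    rewrite !japanese_sqr intrD; have := sqr_ge0 ((fr p.2)%:~R - (fr l)%:~R : R); lra.
  have q0 : 0 <= M ^+ 6 * ((w p.1.1 ^+ 2)^-1 * (w p.1.2 ^+ 2)^-1 * (w p.2 ^+ 2)^-1) *
     (w l ^+ 2)^-1 * C.
    by rewrite !mulr_ge0// exprn_ge0.
  have := ler_wpM2r q0 k2.
  rewrite [X in _ <= X](_ : _ = 2 * (M ^+ 6 * C *
    ((w p.1.1 ^+ 2)^-1 * (w p.1.2 ^+ 2)^-1 * (w p.2 ^+ 2)^-1 +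
     (w p.1.1 ^+ 2)^-1 * (w p.1.2 ^+ 2)^-1 * (w l ^+ 2)^-1))); last first.
    field; rewrite !gt_eqF//.
  lra.
rewrite sumEFin lee_fin -mulr_sumr.
have gZ : \sum_i g i <= Z by apply: sum_invw2_le.
have g0 i : 0 <= g i by exact: wi.
have sg0 : 0 <= \sum_i g i by apply: sumr_ge0.
have Z3 : (\sum_i g i) ^+ 3 <= Z ^+ 3 by rewrite lerXn2r// nnegrE// (le_trans sg0).
have S3 : \sum_(p : I * I * I) g p.1.1 * g p.1.2 * g p.2 = (\sum_i g i) ^+ 3.
  transitivity ((\sum_(q : I * I) g q.1 * g q.2) * (\sum_k g k)).
    by rewrite big_distrlr /= pair_big.
  by rewrite exprSr expr2; congr (_ * _); rewrite big_distrlr /= pair_big.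
have U1 : \sum_l \sum_(p | triad fr l p) g p.1.1 * g p.1.2 * g p.2 <= (\sum_i g i) ^+ 3.
  rewrite (exchange_big_dep xpredT)//= -S3; apply: ler_sum => p _.
  case: (pickP (fun l => triad fr l p)) => [l0 tl0|e0].
    rewrite (big_pred1 l0)// => l; apply/idP/eqP => [|-> //].
    by rewrite /triad (eqP tl0) => /eqP/addrI/fr_inj.
  by rewrite big_pred0// !mulr_ge0.
have U2 : \sum_l \sum_(p | triad fr l p) g p.1.1 * g p.1.2 * g l <= (\sum_i g i) ^+ 3.
  rewrite exprSr mulr_sumr; apply: ler_sum => l _; rewrite -mulr_suml ler_wpM2r//.
  rewrite exprS expr1 big_distrlr /= pair_big /=.
  rewrite -(pair_big_dep xpredT (fun q k => fr q.1 + fr q.2 == fr k + fr l)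
    (fun q k => g q.1 * g q.2)) /=.
  apply: ler_sum => q _.
  case: (pickP (fun k => fr q.1 + fr q.2 == fr k + fr l)) => [k0 tk0|e0].
    rewrite (big_pred1 k0)// => k; apply/idP/eqP => [|-> //].
    by rewrite (eqP tk0) => /eqP/addIr/fr_inj.
  by rewrite big_pred0// !mulr_ge0.
have U : \sum_l \sum_(p | triad fr l p) T l p <= 2 * Z ^+ 3.
  under eq_bigr do rewrite /T big_split.
  by rewrite big_split /=; lra.
have := ler_wpM2l (_ : 0 <= 4 * (M ^+ 6 * C)) U.
rewrite mulr_ge0 ?mulr_ge0 ?exprn_ge0// => /(_ isT)/le_trans; apply.
by rewrite le_eqVlt; apply/orP; left; apply/eqP; ring.
Qed.

End cubic_moment.

(** * The pathwise bound *)

Section pathwise_bound.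
Context {R : realType}.
Local Notation noise := (g_sigma_algebraType (@cylinders R)).
Variables (I : finType) (fr : I -> int) (i0 : I).
Hypotheses (fr_inj : injective fr) (fr0 : fr i0 = 0).
Hypothesis sum_resolvent : forall r : R, 1 <= r ->
  \sum_i (r ^+ 2 + (fr i)%:~R ^+ 2)^-1 <= 5 / r.
Variables (M Z : R).
Hypothesis M0 : 0 < M.
Hypothesis sumZ : \sum_i (bracket4 (fr i) ^+ 5)^-1 <= Z.
Variable c : int -> R.
Hypothesis cM : forall n, `|c n| <= M.
Local Notation w i := (japanese (fr i) : R).
Local Notation q i := (bracket4 (fr i) : R).
Local Notation h n x := (normc (zc n x) ^+ 2).
Variable L : nat.

Definition full_symbol (n : int) : R := c n / japanese n.
(** The cutoff keeps the symbol even and bounded by [M] / <n>, so the moment bounds are uniform in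
    [L]. *)
Definition high_symbol (n : int) : R := if (`|n| <= L)%N then 0 else c n / japanese n.

Definition weighted_mass (x : noise) : R := \sum_i (q i ^+ 5)^-1 * h (fr i) x.
Definition Bform_norm (al : int -> R) (x : noise) : R :=
  \sum_j \sum_l (q j ^+ 5)^-1 * (q l ^+ 5)^-1 *
     normc (Bform fr (noise_coef fr al x) j l) ^+ 2.
Definition Anonpaired_norm (al : int -> R) (x : noise) : R :=
  \sum_l (normc (Anonpaired fr (noise_coef fr al x) l) / w l) ^+ 2.
Definition Qnoise (al : int -> R) (x : noise) : R :=
  complex.Re (Qform fr (noise_coef fr al x) (noise_coef fr al x)
                       (noise_coef fr al x) (noise_coef fr al x)).

Let w0 i : 0 < w i. Proof. exact: lt_le_trans ltr01 (japanese_ge1 _). Qed.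
Let q0 i : 0 < q i. Proof. exact: bracket4_gt0. Qed.
Let q1 i : 1 <= q i. Proof. exact: bracket4_ge1. Qed.
Let h0 i (x : noise) : 0 <= h (fr i) x. Proof. exact: sqr_ge0. Qed.

Lemma high_symbol_le n : `|high_symbol n| <= M / japanese n.
Proof.
have j0 : 0 < japanese n :> R by exact: lt_le_trans ltr01 (japanese_ge1 _).
rewrite /high_symbol; case: ifP => _; first by rewrite normr0 divr_ge0// ltW.
by rewrite normrM normfV (gtr0_norm j0) ler_wpM2r// invr_ge0 ltW.
Qed.

(** The momentum is the entry of [Bform] at frequencies (0, 0), which has weight 1 in the norm.
    Bounding the matrix thus also bounds the paired terms of the cubic sums. *)
Lemma momentum_sqr_le al (x : noise) : momentum fr (noise_coef fr al x) ^+ 2 <= Bform_norm al x.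
Proof.
set a := noise_coef fr al x.
have BE : normc (Bform fr a i0 i0) ^+ 2 = momentum fr a ^+ 2.
  have -> : Bform fr a i0 i0 = ((momentum fr a)%:C)%C.
    rewrite /Bform (reindex_onto (fun i => (i, i)) fst) /=; last first.
      by move=> [i k] /= /eqP/addIr/fr_inj ->.
    rewrite /momentum rmorph_sum; apply: eq_big => [i|i _]; first by rewrite !eqxx.
    by rewrite mulc_conj [RHS]rmorphM [X in _ = X * _]rmorph_int.
  by rewrite normc_real real_normK ?num_real.
rewrite -BE.
have q0E : q i0 = 1 by rewrite fr0 /bracket4 /japanese expr0n addr0 !sqrtr1.
have nn j l : 0 <= (q j ^+ 5)^-1 * (q l ^+ 5)^-1 * normc (Bform fr a j l) ^+ 2.
  by rewrite mulr_ge0 ?sqr_ge0// mulr_ge0 ?invr_ge0 ?exprn_ge0 ?(ltW (q0 _)).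
rewrite /Bform_norm (bigD1 i0)//= (bigD1 i0)//= q0E expr1n invr1 !mul1r -addrA lerDl.
apply: addr_ge0; first by apply: sumr_ge0 => l _; have := nn i0 l; rewrite q0E expr1n invr1 mul1r.
by apply: sumr_ge0 => j _; apply: sumr_ge0 => l _; exact: nn.
Qed.

Variables (k3 k4 k5 m : R).
Hypotheses (k30 : 0 < k3) (k40 : 0 <= k4) (k50 : 0 <= k5) (m0 : 0 < m).
Hypothesis Llarge : (k3 / m + 1) ^+ 2 <= L%:R.

(** Above the cutoff <n>^{3/4} is at least [k3 / m], and <n>^{-2} is <n>^{-3/4} times the weight
    <n>^{-5/4} of [weighted_mass]. *)
Lemma high_weight i : (L < `|fr i|)%N -> (w i ^+ 2)^-1 <= m / k3 * (q i ^+ 5)^-1.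
Proof.
move=> Li; have k30' := k30; have m0' := m0.
have qi := q0 i; have qi1 := q1 i.
have wL : (k3 / m + 1) ^+ 2 <= q i ^+ 4.
  apply: (le_trans Llarge); rewrite bracket4X4; apply: le_trans (int_le_japanese _).
  rewrite -intr_norm -abszE -pmulrn ler_nat; exact: ltnW.
have q2 : k3 / m + 1 <= q i ^+ 2.
  move: wL; rewrite (exprM _ 2 2) ler_sqr ?nnegrE ?sqr_ge0//.
  by rewrite addr_ge0// divr_ge0// ltW.
have q3 : k3 / m <= q i ^+ 3.
  apply: (@le_trans _ _ (q i ^+ 2)); first by lra.
  by rewrite [leRHS]exprS ler_peMl// sqr_ge0.
have -> : (w i ^+ 2)^-1 = (q i ^+ 3)^-1 * (q i ^+ 5)^-1.
  by rewrite -bracket4X4 -invfM -exprD -exprM.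
apply: ler_wpM2r; first by rewrite invr_ge0 exprn_ge0// ltW.
rewrite -[m / k3]invf_div lef_pV2 ?posrE ?exprn_gt0// divr_gt0//.
Qed.

Definition good_noise (y : noise) : Prop :=
  [/\ weighted_mass y <= k3, Bform_norm high_symbol y <= k4,
      Anonpaired_norm high_symbol y <= k5 & Qnoise high_symbol y <= 0].

Definition noise_mass (x : noise) : R := \sum_i h (fr i) x / w i ^+ 2.

Definition noise_cost (x y : noise) : R :=
  \sum_i (((x (fr i)).1 - (y (fr i)).1) ^+ 2 / 2 +
          ((x (fr i)).2 - (y (fr i)).2) ^+ 2 / 2).

(** The splitting is made before multiplication by [c], since the mass condition concerns the field
    itself. The a and b of the overview are [c] times [zhigh y] and [c] times [theta x y]. *)
Let zhigh (y : noise) i : R[i] :=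
  if (`|fr i| <= L)%N then 0 else ((w i)^-1%:C)%C * zc (fr i) y.
Let theta (x y : noise) i : R[i] := ((w i)^-1%:C)%C * zc (fr i) x - zhigh y i.

Let zhighE (y : noise) i : normc (zhigh y i) ^+ 2 =
  if (`|fr i| <= L)%N then 0 else h (fr i) y / w i ^+ 2.
Proof.
rewrite /zhigh; case: ifP => _; first by rewrite ComplexField.Normc.normc0 expr0n.
rewrite ComplexField.Normc.normcM normc_real exprMn real_normK ?num_real//.
by rewrite exprVn mulrC.
Qed.

(** Here the cutoff pays off: [k3] may be large, but the gain [m / k3] of [high_weight] brings the
    mass down to [m]. *)
Lemma zhigh_mass (y : noise) : weighted_mass y <= k3 -> \sum_i normc (zhigh y i) ^+ 2 <= m.
Proof.
move=> yk; apply: (@le_trans _ _ (m / k3 * weighted_mass y)); last first.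
  by rewrite mulrAC ler_pdivrMr// ler_pM2l.
rewrite /weighted_mass mulr_sumr; apply: ler_sum => i _; rewrite zhighE.
case: leqP => Li.
  apply: mulr_ge0; first exact/ltW/divr_gt0.
  by apply: mulr_ge0 (h0 _ _); rewrite invr_ge0 exprn_ge0// ltW.
by rewrite [leLHS]mulrC [leRHS]mulrA; exact: ler_wpM2r (h0 _ _) _ _ (high_weight Li).
Qed.

Lemma theta_mass (x y : noise) : weighted_mass y <= k3 -> noise_mass x < m ->
  \sum_i normc (theta x y i) ^+ 2 <= 4 * m.
Proof.
move=> /zhigh_mass yk /ltW xm.
apply: (@le_trans _ _ (2 * noise_mass x + 2 * \sum_i normc (zhigh y i) ^+ 2)); last by lra.
rewrite !mulr_sumr -big_split; apply: ler_sum => i _ /=.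
apply: (le_trans (normc_sqrD _ _)); rewrite normcN lerD2r ler_pM2l//.
rewrite ComplexField.Normc.normcM normc_real exprMn real_normK ?num_real//.
by rewrite exprVn mulrC.
Qed.

(** The weight <n> cancels the symbol 1 / <n>, so the H^1 norm of [theta] is the distance of the
    noises up to the low frequencies of [y]. There <n>^{5/4} is at most [1 + L ^+ 2], which gives
    the constant. *)
Lemma theta_energy (x y : noise) : weighted_mass y <= k3 ->
  \sum_i (w i * normc (theta x y i)) ^+ 2 <=
  4 * noise_cost x y + 2 * ((1 + L%:R ^+ 2) * k3).
Proof.
move=> yk.
have L0 : 0 <= 1 + L%:R ^+ 2 :> R by rewrite addr_ge0 ?sqr_ge0.
apply: (@le_trans _ _ (4 * noise_cost x y + 2 * ((1 + L%:R ^+ 2) * weighted_mass y)));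
  last by rewrite lerD2l ler_pM2l// ler_wpM2l.
rewrite /noise_cost /weighted_mass !mulr_sumr -big_split; apply: ler_sum => i _ /=.
have E : ((w i)%:C)%C * theta x y i = (zc (fr i) x - zc (fr i) y) +
    (if (`|fr i| <= L)%N then zc (fr i) y else 0).
  have wK z : ((w i)%:C)%C * (((w i)^-1%:C)%C * z) = z.
    by rewrite mulrA -rmorphM /= mulfV ?gt_eqF// mul1r.
  rewrite /theta /zhigh mulrBr wK; case: ifP => _; first by rewrite mulr0 subr0 subrK.
  by rewrite wK addr0.
have -> : w i * normc (theta x y i) = normc (((w i)%:C)%C * theta x y i).
  by rewrite ComplexField.Normc.normcM normc_real gtr0_norm.
rewrite E; apply: (le_trans (normc_sqrD _ _)); apply: lerD.
  rewrite normc_sqr /dotc /=; lra.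
rewrite ler_pM2l//; case: leqP => Li; last first.
  by rewrite ComplexField.Normc.normc0 expr0n mulr_ge0// mulr_ge0// invr_ge0 exprn_ge0// ltW.
rewrite mulrA -[leLHS]mul1r ler_wpM2r//.
rewrite ler_pdivlMr ?exprn_gt0// mul1r.
apply: (@le_trans _ _ (w i ^+ 2)).
  rewrite -bracket4X4 -exprM ler_weXn2l//.
rewrite japanese_sqr lerD2l -real_normK ?num_real// -intr_norm -abszE -pmulrn.
by rewrite lerXn2r ?nnegrE ?ler_nat.
Qed.

Let ch i : normc (((c (fr i))%:C)%C : R[i]) <= M.
Proof. by rewrite normc_real. Qed.

Let high_coefE (y : noise) i :
  noise_coef fr high_symbol y i = ((c (fr i))%:C)%C * zhigh y i.
Proof.
rewrite /noise_coef /high_symbol /zhigh; case: ifP => _; first by rewrite rmorph0 mul0r mulr0.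
by rewrite mulrA -rmorphM.
Qed.

Let full_coefE (x y : noise) i : noise_coef fr full_symbol x i =
  noise_coef fr high_symbol y i + ((c (fr i))%:C)%C * theta x y i.
Proof.
by rewrite high_coefE -mulrDr /theta addrC subrK mulrA -rmorphM.
Qed.

Let symbol_sqr_le z i : normc (((c (fr i))%:C)%C * z) ^+ 2 <= M ^+ 2 * normc z ^+ 2.
Proof.
rewrite ComplexField.Normc.normcM exprMn ler_wpM2r ?sqr_ge0//.
by rewrite lerXn2r ?nnegrE ?ch// ?normc_ge0 ?(ltW M0).
Qed.

(** Since <n>^2 is the eighth power of [q], the squared symbol leaves the weight [q ^- 5] after
    multiplication by at most [q ^+ 3]. The case 2 serves the l2 norm and the case 3 the l1 norm. *)
Let coef_weight y i (k : nat) : (k <= 3)%N ->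
  q i ^+ k * normc (noise_coef fr high_symbol y i) ^+ 2 <=
  M ^+ 2 * ((q i ^+ 5)^-1 * h (fr i) y).
Proof.
move=> k3'.
rewrite normc_noise_coef mulrA [leRHS]mulrA; apply: ler_wpM2r (h0 _ _) _ _ _.
have := al2_le fr (ltW M0) high_symbol_le i.
have qk : q i ^+ k <= q i ^+ 3 by rewrite ler_weXn2l.
have qk0 : 0 <= q i ^+ k by rewrite exprn_ge0// ltW.
move=> /(ler_pM qk0 (sqr_ge0 _) qk) /le_trans; apply.
rewrite mulrCA ler_wpM2l ?sqr_ge0// -bracket4X4 -exprM.
by rewrite (exprD _ 3 5) invfM mulrA mulfV ?mul1r// gt_eqF// exprn_gt0.
Qed.

Let delta := M * Num.sqrt m.
(** One constant for the three norms of a in [Qform_bound]: [kappa5] serves the cubic term, [kappa3]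
    the product of the l2 and l1 norms, [kappa4] the matrix [Bform]. *)
Variable kappa : R.
Hypotheses (kappa0 : 0 <= kappa)
  (kappa5 : 2 * k5 + 2 * (delta ^+ 2 * (2 * Num.sqrt k4 + 4 * delta ^+ 2) ^+ 2) <= kappa ^+ 2)
  (kappa3 : M ^+ 2 * k3 * (1 + Z) <= kappa) (kappa4 : k4 <= kappa ^+ 2).

Definition Q_offset : R :=
  let eps := delta ^+ 2 in
  244 * delta ^+ 2 * M ^+ 2 * (2 * ((1 + L%:R ^+ 2) * k3)) +
  (4 * kappa ^+ 2 / eps + (1280 * kappa ^+ 2 * delta / eps) ^+ 2 / (4 * eps) +
   16 * kappa * delta ^+ 2 * ((4 * kappa + 1) / eps) ^+ 2).

(** [Qform_bound] is used with [eps = delta ^+ 2], which gives 240 + 4 = 244; the factor 4 in front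
    of the cost in [theta_energy] makes it 976. The energy of the low frequencies of [y] goes into
    [Q_offset]. *)
Lemma Qnoise_le (x y : noise) : good_noise y -> noise_mass x < m ->
  Qnoise full_symbol x <= 976 * delta ^+ 2 * M ^+ 2 * noise_cost x y + Q_offset.
Proof.
move=> [y3 y4 y5 Qy] xm.
have d0 : 0 < delta by rewrite mulr_gt0// sqrtr_gt0.
have d2E : delta ^+ 2 = M ^+ 2 * m by rewrite exprMn sqr_sqrtr// ltW.
have Z0 : 0 <= Z.
  apply: le_trans sumZ; apply: sumr_ge0 => i _; by rewrite invr_ge0 exprn_ge0// ltW.
pose a := noise_coef fr high_symbol y.
pose b i := ((c (fr i))%:C)%C * theta x y i.
have am : \sum_i normc (a i) ^+ 2 <= delta ^+ 2.
  rewrite d2E; apply: (@le_trans _ _ (M ^+ 2 * \sum_i normc (zhigh y i) ^+ 2)).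
    by rewrite mulr_sumr; apply: ler_sum => i _; rewrite /a high_coefE.
  by rewrite ler_wpM2l ?sqr_ge0// zhigh_mass.
have bm : \sum_i normc (b i) ^+ 2 <= (2 * delta) ^+ 2.
  rewrite exprMn d2E; apply: (@le_trans _ _ (M ^+ 2 * \sum_i normc (theta x y i) ^+ 2)).
    by rewrite mulr_sumr; apply: ler_sum => i _; exact: symbol_sqr_le.
  have := theta_mass y3 xm; have := sqr_ge0 M; nra.
have P4 : Num.sqrt (\sum_j \sum_l (q j ^+ 5)^-1 * (q l ^+ 5)^-1 *
    normc (Bform fr a j l) ^+ 2) <= kappa.
  rewrite -[leRHS](ger0_norm kappa0) -sqrtr_sqr; apply: ler_wsqrtr.
  exact: le_trans y4 kappa4.
have mom : `|momentum fr a| <= Num.sqrt k4.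
  rewrite -sqrtr_sqr; apply: ler_wsqrtr; apply: le_trans y4; exact: momentum_sqr_le.
have A5 : l2 (fun l => normc (Aform fr a l) / w l) <= kappa.
  apply: l2_le => //; apply: le_trans kappa5; apply: (le_trans (sum_Aform_le _ _)) => //.
  apply: lerD; first by rewrite ler_pM2l.
  have am0 : 0 <= \sum_i normc (a i) ^+ 2 by apply: sumr_ge0 => i _; exact: sqr_ge0.
  rewrite ler_pM2l//; apply: ler_pM => //; first exact: sqr_ge0.
  apply: lerXn2r; rewrite ?nnegrE.
  - by apply: addr_ge0; exact: mulr_ge0.
  - by apply: addr_ge0; apply: mulr_ge0; rewrite ?sqrtr_ge0 ?sqr_ge0.
  - by apply: lerD; rewrite ler_pM2l.
have A3 : l2 (fun i => q i * normc (a i)) * l1 (fun i => (q i)^-1 * normc (a i)) <= kappa.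
  have l2q : l2 (fun i => q i * normc (a i)) ^+ 2 <= M ^+ 2 * k3.
    rewrite sqr_l2; apply: (@le_trans _ _ (M ^+ 2 * weighted_mass y)).
      rewrite mulr_sumr; apply: ler_sum => i _; rewrite exprMn; exact: coef_weight.
    by rewrite ler_wpM2l ?sqr_ge0.
  have l1q : l1 (fun i => (q i)^-1 * normc (a i)) ^+ 2 <= Z * (M ^+ 2 * k3).
    have q50 i : 0 < q i ^+ 5 by rewrite exprn_gt0.
    have -> : l1 (fun i => (q i)^-1 * normc (a i)) =
        \sum_i (Num.sqrt (q i ^+ 5))^-1 * (Num.sqrt (q i ^+ 5) * ((q i)^-1 * normc (a i))).
      by apply: eq_bigr => i _; rewrite mulKf// gt_eqF// sqrtr_gt0.
    apply: (le_trans (sum_cauchy_schwarz _ _ _)); apply: ler_pM.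
    - by apply: sumr_ge0 => i _; exact: sqr_ge0.
    - by apply: sumr_ge0 => i _; exact: sqr_ge0.
    - apply: le_trans sumZ; apply: ler_sum => i _.
      by rewrite exprVn sqr_sqrtr// ltW.
    apply: (@le_trans _ _ (M ^+ 2 * weighted_mass y)).
      rewrite mulr_sumr; apply: ler_sum => i _.
      have -> : (Num.sqrt (q i ^+ 5) * ((q i)^-1 * normc (a i))) ^+ 2 =
          q i ^+ 3 * normc (a i) ^+ 2.
        rewrite exprMn sqr_sqrtr ?(ltW (q50 i))// exprMn mulrA; congr (_ * _).
        by rewrite (exprD _ 3 2) -mulrA -exprMn mulfV ?expr1n ?mulr1// gt_eqF.
      exact: coef_weight.
    by rewrite ler_wpM2l ?sqr_ge0.
  apply: le_trans kappa3.
  have := sqr_ge0 (l2 (fun i => q i * normc (a i)) - l1 (fun i => (q i)^-1 * normc (a i))).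
  have := mulr_ge0 (sqr_ge0 M) (ltW k30).
  nra.
have := @Qform_bound _ _ _ fr_inj sum_resolvent a b delta kappa (delta ^+ 2) kappa0
  (exprn_gt0 2 d0) (l2_le (ltW d0) am) (l2_le (mulr_ge0 (ler0n _ 2) (ltW d0)) bm) Qy A5 A3 P4.
rewrite /Qnoise /Qform.
have -> : noise_coef fr full_symbol x = (fun i => a i + b i).
  by apply/funext => i; exact: full_coefE.
move=> /le_trans; apply.
rewrite /Q_offset [leRHS]addrA lerD2r sqr_l2.
have Xb : \sum_i (w i * normc (b i)) ^+ 2 <=
    M ^+ 2 * (4 * noise_cost x y + 2 * ((1 + L%:R ^+ 2) * k3)).
  apply: (@le_trans _ _ (M ^+ 2 * \sum_i (w i * normc (theta x y i)) ^+ 2)).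
    rewrite mulr_sumr; apply: ler_sum => i _; rewrite !(exprMn _ (w i)).
    rewrite [leRHS]mulrCA; apply: ler_wpM2l; [exact: sqr_ge0|exact: symbol_sqr_le].
  by rewrite ler_wpM2l ?sqr_ge0// theta_energy.
have d20 : 0 <= 244 * delta ^+ 2 by apply: mulr_ge0; [exact: ler0n|exact: sqr_ge0].
have -> : 240 * delta ^+ 2 + 4 * delta ^+ 2 = 244 * delta ^+ 2 by ring.
apply: (le_trans (ler_wpM2l d20 Xb)).
by rewrite le_eqVlt; apply/orP; left; apply/eqP; ring.
Qed.

End pathwise_bound.

(** * Moments and symmetry behind the good event *)

Section good_event.
Context {R : realType}.
Local Notation noise := (g_sigma_algebraType (@cylinders R)).
Variable lam : probability noise R.
Hypothesis lamP : is_white_noise lam.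
Variable C : R.
Hypothesis momentC : forall n,
  (\int[lam]_x ((1 + normc (zc n x) ^+ 2) ^+ 3)%:E <= C%:E)%E.
Variable N : nat.
Local Notation fr := (@freq N).
Local Notation q i := (bracket4 (fr i) : R).

Lemma freq_rev_ord (k : 'I_(N.*2.+1)) : freq (rev_ord k) = - freq k.
Proof. by rewrite /freq /=; have := ltn_ord k; lia. Qed.

Lemma ge0_integral_weighted_sum (I : finType) (F : I -> noise -> R) (v k : I -> R) :
  (forall i, measurable_fun setT (F i)) -> (forall i x, 0 <= F i x) ->
  (forall i, 0 <= v i) -> (forall i, \int[lam]_x (F i x)%:E <= (k i)%:E)%E ->
  (\int[lam]_x (\sum_i v i * F i x)%:E <= (\sum_i v i * k i)%:E)%E.
Proof.
move=> mF F0 v0 Fk.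
have E x : (\sum_i v i * F i x)%:E = (\sum_(i <- index_enum I) (v i)%:E * (F i x)%:E)%E.
  by rewrite -sumEFin; apply: eq_bigr.
under eq_integral do rewrite E.
rewrite ge0_integral_sum//; last 2 first.
- by move=> i; apply: measurable_funeM; exact/measurable_EFinP.
- by move=> i x _; rewrite -EFinM lee_fin mulr_ge0// F0.
rewrite -sumEFin; apply: lee_sum => i _.
rewrite EFinM (ge0_integralZl lam measurableT)//.
- by apply: lee_wpmul2l => //; rewrite lee_fin.
- exact/measurable_EFinP.
- by move=> x _; rewrite lee_fin F0.
- by rewrite lee_fin.
Qed.

Lemma weighted_mass_moment : (\int[lam]_x (weighted_mass fr x)%:E <= (25 * C)%:E)%E.
Proof.
have C0 : 0 <= C.
  rewrite -lee_fin; apply: le_trans (momentC 0); apply: integral_ge0 => x _.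
  by rewrite lee_fin exprn_ge0// addr_ge0// sqr_ge0.
apply: (@le_trans _ _ (\sum_i (q i ^+ 5)^-1 * C)%:E).
  apply: ge0_integral_weighted_sum => [i|i x|i|i].
  - exact: measurable_zc2.
  - exact: sqr_ge0.
  - by rewrite invr_ge0 exprn_ge0// ltW// bracket4_gt0.
  apply: le_trans (momentC (fr i)); apply: ge0_le_integral => //.
  - by move=> x _; rewrite lee_fin sqr_ge0.
  - apply/measurable_EFinP; exact: measurable_zc2.
  - apply/measurable_EFinP; apply: measurable_funX; apply: measurable_funD => //.
    exact: measurable_zc2.
  move=> x _; rewrite lee_fin; have := sqr_ge0 (normc (zc (fr i) x)).
  set y := _ ^+ 2 => y0; have y1 : 1 <= 1 + y by lra.
  by apply: (@le_trans _ _ (1 + y)); [lra|exact: ler_eXnr].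
by rewrite lee_fin -mulr_suml ler_wpM2r// sum_bracket4_freq.
Qed.

Variables (M : R) (al : int -> R).
Hypotheses (M0 : 0 <= M) (alM : forall n, `|al n| <= M / japanese n)
  (alN : forall n, al (- n) = al n).
Local Notation coef := (noise_coef fr al).

Lemma measurable_weighted_mass : measurable_fun setT (fun x : noise => weighted_mass fr x).
Proof.
apply: measurable_sum => i; apply: measurable_funM => //; exact: measurable_zc2.
Qed.

Lemma measurable_normc_Bform j l :
  measurable_fun setT (fun x : noise => normc (Bform fr (coef x) j l) ^+ 2).
Proof.
apply: measurable_normc2; apply: cmeasurable_sum => p _.
apply: cmeasurableM; first exact: cmeasurable_cst.
by apply: cmeasurableM; [|apply: cmeasurableJ]; exact: cmeasurable_noise_coef.
Qed.

Lemma measurable_Bform_norm : measurable_fun setT (fun x : noise => Bform_norm fr al x).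
Proof.
apply: measurable_sum => j; apply: measurable_sum => l.
apply: measurable_funM => //; exact: measurable_normc_Bform.
Qed.

Lemma measurable_Anonpaired_norm :
  measurable_fun setT (fun x : noise => Anonpaired_norm fr al x).
Proof.
apply: measurable_sum => l.
have mA : cmeasurable (fun x : noise => Anonpaired fr (coef x) l).
  by apply: cmeasurable_sum => p _; exact: cmeasurable_Aterm.
rewrite (_ : (fun x => _) = (fun x : noise =>
    normc (Anonpaired fr (coef x) l) ^+ 2 * (japanese (fr l) ^+ 2)^-1)); last first.
  by apply/funext => x; exact: expr_div_n.
by apply: measurable_funM => //; exact: (measurable_normc2 mA).
Qed.

Lemma measurable_Qnoise : measurable_fun setT (fun x : noise => Qnoise fr al x).
Proof.
have [] : cmeasurable (fun x : noise => Qform fr (coef x) (coef x) (coef x) (coef x)) => //.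
apply: cmeasurable_sum => p _; apply: cmeasurableM; first exact: cmeasurable_cst.
apply: cmeasurableM; last exact/cmeasurableJ/cmeasurable_noise_coef.
apply: cmeasurableM; last exact/cmeasurableJ/cmeasurable_noise_coef.
by apply: cmeasurableM; exact: cmeasurable_noise_coef.
Qed.

Lemma Qnoise_reflect (x : noise) : Qnoise fr al (reflect_noise x) = - Qnoise fr al x.
Proof.
have rE i : coef (reflect_noise x) i = coef x (rev_ord i).
  by rewrite /noise_coef freq_rev_ord alN.
have inj : injective (fun p : 'I_(N.*2.+1) * 'I_(N.*2.+1) * ('I_(N.*2.+1) * 'I_(N.*2.+1)) =>
    ((rev_ord p.1.1, rev_ord p.1.2), (rev_ord p.2.1, rev_ord p.2.2))).
  by apply: inv_inj => -[[i j] [k l]] /=; rewrite !rev_ordK.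
rewrite /Qnoise -raddfN; congr complex.Re.
rewrite /Qform /quad_sum (reindex_inj inj) -sumrN.
apply: eq_big => [[[i j] [k l]]|[[i j] [k l]] _].
  by rewrite /resonant !freq_rev_ord -!opprD eqr_opp.
rewrite !rE !rev_ordK !freq_rev_ord -opprD rmorphN mulNr; congr (- (_ * _)).
Qed.

(** Two factors 25 come from the weights of the two indices and one from the bound on each entry. *)
Lemma Bform_norm_moment :
  (\int[lam]_x (Bform_norm fr al x)%:E <= (2 * (M ^+ 4 * C * 25 ^+ 3))%:E)%E.
Proof.
pose v (p : 'I_(N.*2.+1) * 'I_(N.*2.+1)) := (q p.1 ^+ 5)^-1 * (q p.2 ^+ 5)^-1.
have qi i : 0 <= (q i ^+ 5)^-1 by rewrite invr_ge0 exprn_ge0// ltW// bracket4_gt0.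
have C0 : 0 <= C.
  rewrite -lee_fin; apply: le_trans (momentC 0); apply: integral_ge0 => x _.
  by rewrite lee_fin exprn_ge0// addr_ge0// sqr_ge0.
under eq_integral do rewrite /Bform_norm pair_big /=.
apply: (@le_trans _ _ (\sum_p v p * (2 * (M ^+ 4 * C * 25)))%:E).
  apply: (@ge0_integral_weighted_sum _ (fun p x => normc (Bform fr (coef x) p.1 p.2) ^+ 2)
    v) => [p|p x|p|p].
  - exact: measurable_normc_Bform.
  - exact: sqr_ge0.
  - exact: mulr_ge0.
  - apply: (@Bform_moment _ _ lamP _ momentC _ _ (@rev_ord _)) => //.
    + exact: freq_inj.
    + exact: freq_rev_ord.
    + exact: sum_bracket4_freq.
rewrite lee_fin -mulr_suml.
have S : \sum_p v p = (\sum_i (q i ^+ 5)^-1) ^+ 2.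
  by rewrite expr2 big_distrlr /= pair_big.
have S25 : (\sum_i (q i ^+ 5)^-1) ^+ 2 <= 25 ^+ 2.
  by rewrite lerXn2r ?nnegrE ?sumr_ge0// sum_bracket4_freq.
have MC : 0 <= 2 * (M ^+ 4 * C * 25) by rewrite !mulr_ge0// exprn_ge0.
rewrite S; apply: (le_trans (ler_wpM2r MC S25)).
by rewrite le_eqVlt; apply/orP; left; apply/eqP; ring.
Qed.

End good_event.

(** * The exponential moment of the noise *)

Section exponential_bound.
Context {R : realType}.
Local Notation noise := (g_sigma_algebraType (@cylinders R)).
Variable lam : probability noise R.
Hypothesis lamP : is_white_noise lam.
Variable C : R.
Hypotheses (Cgt0 : 0 < C) (momentC : forall n,
  (\int[lam]_x ((1 + normc (zc n x) ^+ 2) ^+ 3)%:E <= C%:E)%E).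
Variable M : R.
Hypothesis M0 : 0 < M.
(** Each threshold is eight times the corresponding first moment, so that the three normalized norms
    have expectations at most 1/8 each. *)
Local Notation k3 := (8 * (25 * C)).
Local Notation k4 := (8 * (2 * (M ^+ 4 * C * 25 ^+ 3))).
Local Notation k5 := (8 * (8 * (M ^+ 6 * C * 25 ^+ 3))).

Section fixed_symbol.
Variables (N : nat) (c : int -> R) (L : nat).
Hypotheses (cM : forall n, `|c n| <= M) (cN : forall n, c n = c (- n)).
Local Notation fr := (@freq N).

Let G := [set y : noise | good_noise fr c L k3 k4 k5 y].
Let al := high_symbol c L.

Let alN n : al (- n) = al n.
Proof. by rewrite /al /high_symbol abszN japaneseN -cN. Qed.

Lemma measurable_good_noise : measurable G.
Proof.
have mle (f : noise -> R) (k : R) : measurable_fun setT f ->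
    measurable [set x | f x <= k].
  move=> mf; have := mf measurableT `]-oo, k]%classic (measurable_itv _).
  by rewrite setTI; congr measurable; apply/seteqP; split => x; rewrite /= in_itv.
have -> : G = [set x | weighted_mass fr x <= k3] `&`
   ([set x | Bform_norm fr al x <= k4] `&` ([set x | Anonpaired_norm fr al x <= k5] `&`
    [set x | Qnoise fr al x <= 0])).
  by apply/seteqP; split=> [x []//|x [? [? []]]].
apply: measurableI; first by apply: mle; exact: measurable_weighted_mass.
apply: measurableI; first by apply: mle; exact: measurable_Bform_norm.
apply: measurableI; first by apply: mle; exact: measurable_Anonpaired_norm.
by apply: mle; exact: measurable_Qnoise.
Qed.

Let Psi (x : noise) := k3^-1 * weighted_mass fr x +
  (k4^-1 * Bform_norm fr al x + k5^-1 * Anonpaired_norm fr al x).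

(** [Psi] adds the three normalized norms, so its mean is at most 3/8 and [Psi <= 1] implies the
    three norm conditions. Integrating [H x + H (reflect_noise x) >= 1] and using the invariance of
    the law yields [2 * (3 / 8 + lam G) >= 1]. *)
Lemma good_noise_ge : (8^-1%:E <= lam G)%E.
Proof.
have k30 : 0 < k3 by rewrite !mulr_gt0.
have k40 : 0 < k4 by rewrite !mulr_gt0// exprn_gt0.
have k50 : 0 < k5 by rewrite !mulr_gt0// exprn_gt0.
have alM n : `|al n| <= M / japanese n by exact: high_symbol_le.
have W0 (x : noise) : 0 <= weighted_mass fr x.
  apply: sumr_ge0 => i _; rewrite mulr_ge0 ?sqr_ge0// invr_ge0 exprn_ge0// ltW//.
  exact: bracket4_gt0.
have B0 x : 0 <= Bform_norm fr al x.
  apply: sumr_ge0 => i _; apply: sumr_ge0 => j _.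
  by rewrite mulr_ge0 ?sqr_ge0// mulr_ge0// invr_ge0 exprn_ge0// ltW// bracket4_gt0.
have A0 x : 0 <= Anonpaired_norm fr al x by apply: sumr_ge0 => i _; exact: sqr_ge0.
have mPsi : measurable_fun setT Psi.
  apply: measurable_funD; first by apply: measurable_funM => //; exact: measurable_weighted_mass.
  apply: measurable_funD; first by apply: measurable_funM => //; exact: measurable_Bform_norm.
  by apply: measurable_funM => //; exact: measurable_Anonpaired_norm.
have Psi0 x : 0 <= Psi x.
  by rewrite !addr_ge0// mulr_ge0 ?invr_ge0 ?W0 ?B0 ?A0// ltW.
have IPsi : (\int[lam]_x (Psi x)%:E <= (3 / 8)%:E)%E.
  pose F (i : 'I_3) (x : noise) := if val i == 0%N then weighted_mass fr x else
    if val i == 1%N then Bform_norm fr al x else Anonpaired_norm fr al x.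
  pose k (i : 'I_3) := if val i == 0%N then k3 else if val i == 1%N then k4 else k5.
  have k0 i : 0 < k i by rewrite /k; case: ifP => // _; case: ifP.
  have E x : Psi x = \sum_i (k i)^-1 * F i x by rewrite !big_ord_recl big_ord0 addr0.
  under eq_integral do rewrite E.
  apply: (@le_trans _ _ (\sum_i (k i)^-1 * (k i / 8))%:E); last first.
    rewrite (eq_bigr (fun=> 8^-1)); last by move=> i _; rewrite mulKf// gt_eqF.
    rewrite sumr_const card_ord lee_fin -mulr_natl; lra.
  apply: ge0_integral_weighted_sum => [i|i x|i|i].
  - rewrite /F; case: (val i == 0%N); first exact: measurable_weighted_mass.
    by case: (val i == 1%N); [exact: measurable_Bform_norm|exact: measurable_Anonpaired_norm].
  - by rewrite /F; case: (val i == 0%N) => //; case: (val i == 1%N).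
  - by rewrite invr_ge0 ltW.
  - have K (r : R) : 8 * r / 8 = r by field.
    rewrite /F /k; case: (val i == 0%N); [|case: (val i == 1%N)]; rewrite K.
    + exact: weighted_mass_moment.
    + exact: (Bform_norm_moment lamP momentC _ (ltW M0) alM).
    + exact: (sum_Anonpaired_moment lamP momentC (@freq_inj N) (ltW M0) alM
        (sum_bracket4_freq N)).
pose H x : R := Psi x + \1_G x.
have H0 x : 0 <= H x by rewrite addr_ge0.
have mH : measurable_fun setT H.
  by apply: measurable_funD => //; apply: measurable_indic; exact: measurable_good_noise.
have small x : Psi x <= 1 -> Qnoise fr al x <= 0 -> G x.
  move=> P1 Qx.
  have a1 := mulr_ge0 (ltW (divr_gt0 ltr01 k30)) (W0 x).
  have a2 := mulr_ge0 (ltW (divr_gt0 ltr01 k40)) (B0 x).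
  have a3 := mulr_ge0 (ltW (divr_gt0 ltr01 k50)) (A0 x).
  rewrite !mul1r in a1 a2 a3.
  have le1 (k v : R) : 0 < k -> k^-1 * v <= 1 -> v <= k.
    by move=> kk; rewrite mulrC ler_pdivrMr// mul1r.
  rewrite /Psi in P1.
  by split => //; apply: le1 => //; lra.
(* If [Psi] is at most 1 at both points, the sign condition holds at one of them, which is therefore
   in [G]; otherwise [Psi] alone exceeds 1 at one of them. *)
have H1 x : 1 <= H x + H (reflect_noise x).
  rewrite /H.
  have [P1|] := leP (Psi x) 1; last first.
    have := Psi0 (reflect_noise x); have i0 (y : noise) : 0 <= \1_G y :> R by [].
    have := i0 x; have := i0 (reflect_noise x); lra.
  have [P2|] := leP (Psi (reflect_noise x)) 1; last first.
    have := Psi0 x; have i0 (y : noise) : 0 <= \1_G y :> R by [].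
    have := i0 x; have := i0 (reflect_noise x); lra.
  have p1 := Psi0 x; have p2 := Psi0 (reflect_noise x).
  have [Q1|Q1] := leP (Qnoise fr al x) 0.
    have -> : \1_G x = 1 :> R by rewrite indicE mem_set//; exact: small.
    have : 0 <= \1_G (reflect_noise x) :> R by []. lra.
  have -> : \1_G (reflect_noise x) = 1 :> R.
    by rewrite indicE mem_set//; apply: small => //; rewrite Qnoise_reflect// oppr_le0 ltW.
  have : 0 <= \1_G x :> R by []. lra.
have EH x : (0 <= (H x)%:E)%E by rewrite lee_fin.
have mHE : measurable_fun setT (fun x => (H x)%:E) by exact/measurable_EFinP.
have rsym := noise_symmetry_reflect lamP.
have IH : (1 <= \int[lam]_x (H x)%:E + \int[lam]_x (H x)%:E)%E.
  rewrite -{2}(integral_symmetry rsym mHE EH).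
  have mHr : measurable_fun setT (fun x => (H (reflect_noise x))%:E).
    by apply: (measurableT_comp mHE); case: rsym.
  rewrite -ge0_integralD//.
  have -> : 1%E = (\int[lam]_x cst 1%E x)%E.
    by rewrite integral_cst// mul1e; exact/esym/(probability_setT lam).
  apply: ge0_le_integral => //; first exact: emeasurable_funD.
  by move=> x _; rewrite -EFinD lee_fin.
have IHG : (\int[lam]_x (H x)%:E = \int[lam]_x (Psi x)%:E + lam G)%E.
  rewrite /H; under eq_integral do rewrite EFinD.
  rewrite ge0_integralD//; last 3 first.
  - by move=> x _; rewrite lee_fin.
  - exact/measurable_EFinP.
  - by apply/measurable_EFinP; apply: measurable_indic; exact: measurable_good_noise.
  by rewrite integral_indic ?setIT//; exact: measurable_good_noise.
move: IH; rewrite IHG.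
have : (lam G < +oo)%E by exact: (le_lt_trans (probability_le1 lam measurable_good_noise) (ltry 1)).
have : (0 <= lam G)%E by exact: measure_ge0.
have : (0 <= \int[lam]_x (Psi x)%:E)%E by apply: integral_ge0 => x _; rewrite lee_fin.
move: IPsi; case: (lam G) => // g; case: (\int[lam]_x _)%E => // s.
by rewrite -!EFinD !lee_fin; lra.
Qed.

End fixed_symbol.

(** The constants are fixed in the order [m], [L], [kappa], before [c] and [N], from [p], [M] and
    the moment constant [C] alone. *)
Lemma noise_exponential_bound (p : R) : 0 < p ->
  exists m K : R, 0 < m /\ forall c : int -> R, (forall n, `|c n| <= M) ->
    (forall n, c n = c (- n)) -> forall N : nat,
    (\int[lam]_x (\1_[set x : noise | noise_mass (@freq N) x < m] x *
       expR (p * (3 / 4 * Qnoise (@freq N) (full_symbol c) x)))%:E <= K%:E)%E.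
Proof.
move=> p0.
(* 732 = 976 * 3 / 4 makes the coefficient of [noise_cost] equal to 1. *)
have [r r0 rE] : exists2 r : R, 0 < r & r = 732 by exists 732; rewrite ?ltr0n.
pose m := (r * (p * M ^+ 4))^-1.
have pM : 0 < r * (p * M ^+ 4) by rewrite mulr_gt0// mulr_gt0// exprn_gt0.
have m0 : 0 < m by rewrite invr_gt0.
have k30 : 0 < k3 by rewrite !mulr_gt0.
have k40 : 0 <= k4 by rewrite !mulr_ge0 ?exprn_ge0 ?ltW.
have k50 : 0 <= k5 by rewrite !mulr_ge0 ?exprn_ge0 ?ltW.
pose L := Num.bound ((k3 / m + 1) ^+ 2).
have Llarge : (k3 / m + 1) ^+ 2 <= L%:R by apply/ltW/archi_boundP; exact: sqr_ge0.
pose delta := M * Num.sqrt m.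
have d2 : delta ^+ 2 = M ^+ 2 * m by rewrite exprMn sqr_sqrtr// ltW.
pose A := 2 * k5 + 2 * (delta ^+ 2 * (2 * Num.sqrt k4 + 4 * delta ^+ 2) ^+ 2).
pose B := M ^+ 2 * k3 * (1 + 25).
have A0 : 0 <= A.
  by apply: addr_ge0; apply: mulr_ge0 => //; apply: mulr_ge0; exact: sqr_ge0.
have B0 : 0 <= B.
  by apply: mulr_ge0; [apply: mulr_ge0; [exact: sqr_ge0|exact: ltW]|exact: addr_ge0].
(* The summand 1 gives [kappa <= kappa ^+ 2], so the same [kappa] dominates [A] and [k4] through its
   square and [B] directly. *)
pose kappa := 1 + (A + B + k4).
have k4k : k4 <= kappa by rewrite /kappa; lra.
have kA : A <= kappa by rewrite /kappa; lra.
have kB : B <= kappa by rewrite /kappa; lra.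
have kappa1 : 1 <= kappa by rewrite /kappa; lra.
have kappa2 : kappa <= kappa ^+ 2 by exact: ler_eXnr.
pose K0 := expR (p * (3 / 4 * Q_offset M L k3 m kappa)).
exists m, (8 * K0); split => // c cM cN N.
pose S := [set x : noise | noise_mass (@freq N) x < m].
pose f (x : noise) := (\1_S x *
       expR (p * (3 / 4 * Qnoise (@freq N) (full_symbol c) x)))%:E.
pose G := [set y : noise | good_noise (@freq N) c L k3 k4 k5 y].
pose g (y : noise) : \bar R := (\1_G y)%:E.
have mG : measurable G by exact: measurable_good_noise.
have mS : measurable S.
  have mm : measurable_fun setT (fun x : noise => noise_mass (@freq N) x).
    apply: measurable_sum => i; apply: measurable_funM => //; exact: measurable_zc2.
  have := mm measurableT `]-oo, m[%classic (measurable_itv _).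
  by rewrite setTI; congr measurable; apply/seteqP; split => x; rewrite /= in_itv.
have mf : measurable_fun setT f.
  apply/measurable_EFinP; apply: measurable_funM; first exact: measurable_indic.
  apply: measurableT_comp => //; apply: measurable_funM => //; apply: measurable_funM => //.
  exact: measurable_Qnoise.
have mg : measurable_fun setT g by apply/measurable_EFinP; exact: measurable_indic.
have f0 x : (0 <= f x)%E by rewrite lee_fin mulr_ge0// expR_ge0.
have g0 x : (0 <= g x)%E by rewrite lee_fin.
have us : uniq [seq freq i | i <- enum 'I_(N.*2.+1)].
  by rewrite map_inj_uniq ?enum_uniq//; exact: freq_inj.
have fg x y : (f x * g y <= (K0 * expR (\sum_(n <- [seq freq i | i <- enum 'I_(N.*2.+1)])
    (((x n).1 - (y n).1) ^+ 2 / 2 + ((x n).2 - (y n).2) ^+ 2 / 2)))%:E)%E.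
  rewrite big_map big_enum /= -/(noise_cost (@freq N) x y).
  rewrite /f /g -EFinM lee_fin.
  have [xS|xS] := pselect (S x); last first.
    by rewrite [\1_S x]indicE memNset// !mul0r mulr_ge0// expR_ge0.
  have [yG|yG] := pselect (G y); last first.
    by rewrite [\1_G y]indicE memNset// mulr0 mulr_ge0// expR_ge0.
  rewrite !indicE !mem_set// mul1r mulr1 /K0 -expRD ler_expR.
  have i0 : @freq N (inord N) = 0.
    by rewrite /freq inordK ?subrr// -addnn ltnS leq_addr.
  have := @Qnoise_le _ _ _ _ (@freq_inj N) i0 (@sum_resolvent_freq _ N) _ _ M0
    (sum_bracket4_freq N) _ cM L _ _ _ _ k30 m0 Llarge kappa (le_trans ler01 kappa1)
    (le_trans kA kappa2) kB (le_trans k4k kappa2) x y yG xS.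
  have -> : 976 * (M * Num.sqrt m) ^+ 2 * M ^+ 2 = 976 / r / p.
    rewrite -/delta d2 /m; field; rewrite !gt_eqF//.
  move=> Qle; apply: (@le_trans _ _ (p * (3 / 4 *
      (976 / r / p * noise_cost (@freq N) x y + Q_offset M L k3 m kappa)))).
    by rewrite ler_pM2l// ler_pM2l.
  rewrite le_eqVlt; apply/orP; left; apply/eqP; rewrite rE; field; rewrite gt_eqF//.
have tau := white_noise_property_tau lamP us (expR_ge0 _) mf mg f0 g0 fg.
(* The expectation of the indicator is bounded below, so dividing it out costs the factor 8 in front
   of [K0]. *)
have gG : (8^-1%:E <= \int[lam]_x g x)%E.
  rewrite integral_indic// setIT; exact: good_noise_ge.
have : ((\int[lam]_x f x) * 8^-1%:E <= K0%:E)%E.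
  by apply: le_trans tau; apply: lee_wpmul2l gG; apply: integral_ge0 => x _; exact: f0.
have : (0 <= \int[lam]_x f x)%E by apply: integral_ge0 => x _; exact: f0.
rewrite -/f; case: (\int[lam]_x f x)%E => //.
  by move=> s _; rewrite -EFinM !lee_fin ler_pdivrMr// mulrC.
by move=> _; rewrite gt0_mulye ?lte_fin.
Qed.

End exponential_bound.

(** * Fourier coefficients *)

Section circle_integrals.
Context {R : realType}.
Local Notation nu := (@circle_measure R).
Implicit Types f g h : R -> R[i].

Definition cintegrable f :=
  nu.-integrable setT (EFin \o (fun x => complex.Re (f x))) /\
  nu.-integrable setT (EFin \o (fun x => complex.Im (f x))).

Lemma integrable_mul_bounded (f h : R -> R) (B : R) :
  nu.-integrable setT (EFin \o f) -> measurable_fun setT h -> (forall x, `|h x| <= B) ->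
  nu.-integrable setT (EFin \o (fun x => f x * h x)).
Proof.
move=> fi mh hB; apply: (@integrableMl _ _ _ nu _ measurableT (EFin \o f) h) => //.
exists B; split; first exact: num_real.
by move=> y By x _; exact: le_trans (hB x) (ltW By).
Qed.

Lemma cintegrableM f h (B : R) : cintegrable f -> cmeasurable h ->
  (forall x, normc (h x) <= B) -> cintegrable (fun x => f x * h x).
Proof.
move=> [f1 f2] [h1 h2] hB.
have hB1 x : `|complex.Re (h x)| <= B.
  apply: le_trans (hB x); case: (h x) => a b /=; rewrite -sqrtr_sqr.
  by apply: ler_wsqrtr; rewrite lerDl sqr_ge0.
have hB2 x : `|complex.Im (h x)| <= B.
  apply: le_trans (hB x); case: (h x) => a b /=; rewrite -sqrtr_sqr.
  by apply: ler_wsqrtr; rewrite lerDr sqr_ge0.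
split.
  have := integrableB measurableT (integrable_mul_bounded f1 h1 hB1)
    (integrable_mul_bounded f2 h2 hB2).
  apply: eq_integrable => // x _ /=; case: (f x) (h x) => ? ? [? ?] //=.
have := integrableD measurableT (integrable_mul_bounded f1 h2 hB2)
    (integrable_mul_bounded f2 h1 hB1).
by apply: eq_integrable => // x _ /=; case: (f x) (h x) => ? ? [? ?].
Qed.

Lemma cintegrableD f g : cintegrable f -> cintegrable g -> cintegrable (fun x => f x + g x).
Proof.
move=> [f1 f2] [g1 g2]; split.
  have := integrableD measurableT f1 g1.
  by apply: eq_integrable => // x _ /=; case: (f x) (g x) => ? ? [? ?].
have := integrableD measurableT f2 g2.
by apply: eq_integrable => // x _ /=; case: (f x) (g x) => ? ? [? ?].
Qed.

Lemma circle_integralD f g : cintegrable f -> cintegrable g ->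
  circle_integral (fun x => f x + g x) = circle_integral f + circle_integral g.
Proof.
move=> [f1 f2] [g1 g2]; apply/eqP; rewrite eq_complex /=.
apply/andP; split; apply/eqP.
  rewrite -RintegralD//; apply: eq_Rintegral => x _.
  by case: (f x) (g x) => ? ? [? ?].
by rewrite -RintegralD//; apply: eq_Rintegral => x _; case: (f x) (g x) => ? ? [? ?].
Qed.

Lemma circle_integralZ (c : R[i]) f : cintegrable f ->
  circle_integral (fun x => c * f x) = c * circle_integral f.
Proof.
move=> [f1 f2]; case: c => a b; apply/eqP; rewrite eq_complex /=.
have If (r : R) : nu.-integrable setT (EFin \o (fun x => r * complex.Re (f x))).
  by have := integrableZl measurableT r f1; apply: eq_integrable.
have Ig (r : R) : nu.-integrable setT (EFin \o (fun x => r * complex.Im (f x))).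
  by have := integrableZl measurableT r f2; apply: eq_integrable.
apply/andP; split; apply/eqP.
  rewrite -!RintegralZl// -RintegralB//; apply: eq_Rintegral => x _.
  by case: (f x).
by rewrite -!RintegralZl// -RintegralD//; apply: eq_Rintegral => x _; case: (f x).
Qed.

Lemma cintegrable_cst (c : R[i]) : cintegrable (fun=> c).
Proof. by split; exact: finite_measure_integrable_cst. Qed.

Lemma cintegrable_bounded h (B : R) : cmeasurable h ->
  (forall x, normc (h x) <= B) -> cintegrable h.
Proof.
move=> mh hB; have := cintegrableM (cintegrable_cst 1) mh hB.
by rewrite (_ : (fun x => _) = h)//; apply/funext => x; rewrite mul1r.
Qed.

Lemma cintegrableZ (c : R[i]) f : cintegrable f -> cintegrable (fun x => c * f x).
Proof.
move=> fi; rewrite (_ : (fun x => _) = (fun x => f x * c)); last first.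
  by apply/funext => x; rewrite mulrC.
by apply: (@cintegrableM _ _ (normc c)) => //; exact: cmeasurable_cst.
Qed.

Lemma cintegrable_sum (I : Type) (r : seq I) (F : I -> R -> R[i]) :
  (forall i, cintegrable (F i)) -> cintegrable (fun x => \sum_(i <- r) F i x).
Proof.
move=> Fi; elim: r => [|i r IH].
  under eq_fun do rewrite big_nil; exact: cintegrable_cst.
under eq_fun do rewrite big_cons; exact: cintegrableD.
Qed.

Lemma circle_integral_sum (I : Type) (r : seq I) (F : I -> R -> R[i]) :
  (forall i, cintegrable (F i)) ->
  circle_integral (fun x => \sum_(i <- r) F i x) = \sum_(i <- r) circle_integral (F i).
Proof.
move=> Fi; elim: r => [|i r IH].
  under eq_fun do rewrite big_nil.
  rewrite big_nil -[RHS](mul0r (circle_integral (fun=> 0))).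
  rewrite -circle_integralZ; last exact: cintegrable_cst.
  by under [in RHS]eq_fun do rewrite mulr0.
under eq_fun do rewrite big_cons; rewrite big_cons -IH.
by apply: circle_integralD => //; exact: cintegrable_sum.
Qed.

Lemma normc_expi (t : R) : normc (expi t) = 1.
Proof. by rewrite /= cos2Dsin2 sqrtr1. Qed.

Lemma expiD (s t : R) : expi (s + t) = expi s * expi t.
Proof.
by rewrite /expi cosD sinD; apply/eqP; rewrite eq_complex /= eqxx (addrC (sin s * _)) eqxx.
Qed.

Lemma expi0 : expi (0 : R) = 1.
Proof. by rewrite /expi cos0 sin0. Qed.

Lemma conjc_expi (t : R) : conjc (expi t) = expi (- t).
Proof. by rewrite /expi cosN sinN. Qed.

Lemma cmeasurable_expi (k : R) : cmeasurable (fun x : R => expi (k * x)).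
Proof.
have ml : measurable_fun setT (fun x : R => k * x) by exact: measurable_funM.
split.
  exact: (measurableT_comp (continuous_measurable_fun (@continuous_cos R)) ml).
exact: (measurableT_comp (continuous_measurable_fun (@continuous_sin R)) ml).
Qed.

Lemma cintegrable_expi (k : R) : cintegrable (fun x : R => expi (k * x)).
Proof.
by apply: (cintegrable_bounded (cmeasurable_expi k) (B := 1)) => x; rewrite normc_expi.
Qed.

Lemma cintegrableM_expi f (k : R) : cintegrable f ->
  cintegrable (fun x => f x * expi (k * x)).
Proof.
move=> fi; apply: (cintegrableM (B := 1) fi (cmeasurable_expi k)) => x.
by rewrite normc_expi.
Qed.

End circle_integrals.

Section orthonormality.
Context {R : realType}.
Local Notation nu := (@circle_measure R).

Lemma expi_period (n : int) : expi (n%:~R * (pi *+ 2)) = 1 :> R[i].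
Proof.
have Pn (m : nat) : expi (m%:R * (pi *+ 2)) = 1 :> R[i].
  elim: m => [|m IH]; first by rewrite mul0r expi0.
  by rewrite -natr1 mulrDl mul1r expiD IH mul1r /expi cos2pi sin2pi.
case: n => n; first exact: Pn.
by rewrite NegzE rmorphN mulNr -conjc_expi (Pn n.+1); exact: rmorph1.
Qed.

(** Stated for nonnegative integrands, to which [integral_uniform] and [continuous_FTC2] apply as
    extended integrals; signed ones are first shifted by a constant. *)
Lemma circle_integral_derive (F f : R -> R) :
  continuous f -> (forall x, 0 <= f x) -> (forall x : R, is_derive x (1 : R) F (f x)) ->
  (\int[nu]_x (f x)%:E = ((pi *+ 2)^-1 * (F (pi *+ 2) - F 0))%:E)%E.
Proof.
move=> cf f0 dF.
have dF1 x : derivable F x 1 by have [] := dF x.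
have cF : continuous F.
  by move=> x; apply: differentiable_continuous; apply/derivable1_diffP.
rewrite integral_uniform//; last first.
  by apply/measurable_EFinP; exact: continuous_measurable_fun.
rewrite subr0 EFinM; congr (_ * _)%E.
rewrite (@continuous_FTC2 _ f F 0 (pi *+ 2) two_pi_gt0)//.
- exact: continuous_subspaceT.
- split => [x _||]; first exact: dF1.
  + exact/cvg_at_right_filter/cF.
  + exact/cvg_at_left_filter/cF.
- by move=> x _; rewrite derive1E; have [] := dF x.
Qed.

(** For [n != 0] the functions [1 + cos (k * x)] and [1 + sin (k * x)] are nonnegative with explicit
    primitives and have mean 1 by periodicity; the constant is then subtracted. *)
Lemma circle_integral_expi (n : int) :
  circle_integral (fun x : R => expi (n%:~R * x)) = (n == 0)%:R.
Proof.
have [->|n0] := eqVneq n 0.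
  rewrite (_ : (fun x => _) = (fun=> 1)); last first.
    by apply/funext => x; rewrite mul0r expi0.
  rewrite /circle_integral !Rintegral_cst//= mul0r.
  rewrite [X in fine X](_ : _ = 1%E); last exact: (probability_setT nu).
  by rewrite mulr1.
pose k : R := n%:~R.
have k0 : k != 0 by rewrite intr_eq0.
have dk (x : R) : is_derive x (1 : R) (fun x : R => k * x) k.
  by have := is_deriveZ k (is_derive_id x 1); rewrite /= /GRing.scale /= mulr1.
have ck : continuous (fun x : R => k * x) by move=> x; exact: mulrl_continuous.
have per : (cos (k * (pi *+ 2)) = 1 :> R) * (sin (k * (pi *+ 2)) = 0 :> R).
  by have := expi_period n => -[].
have int1 (f : R -> R) : continuous f -> (forall x, `|f x| <= 1) ->
    (\int[nu]_x (1 + f x)%:E = 1)%E -> \int[nu]_x f x = 0.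
  move=> cf f1; have mf : measurable_fun setT f by exact: continuous_measurable_fun.
  have fi : nu.-integrable setT (EFin \o f).
    have i1 : nu.-integrable setT (EFin \o (fun=> 1 : R)).
      exact: finite_measure_integrable_cst.
    have := integrable_mul_bounded i1 mf f1.
    by apply: eq_integrable => // x _ /=; rewrite mul1r.
  move=> I1; have : \int[nu]_x (1 + f x) = 1 by rewrite /Rintegral I1.
  rewrite RintegralD//; last exact: finite_measure_integrable_cst.
  rewrite Rintegral_cst// [X in fine X](_ : _ = 1%E); last exact: (probability_setT nu).
  by rewrite mulr1; lra.
have pi0 : pi *+ 2 != 0 :> R by rewrite gt_eqF// two_pi_gt0.
have dcos (x : R) : is_derive x (1 : R) (fun x => x + k^-1 * sin (k * x)) (1 + cos (k * x)).
  have h : is_derive x (1 : R) (fun x => k^-1 * sin (k * x)) (cos (k * x)).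
    apply: (is_derive_eq (is_deriveZ k^-1 (is_derive1_comp (is_derive_sin (k * x)) (dk x)))).
    by rewrite /GRing.scale /= mulrCA mulVf ?mulr1.
  exact: is_deriveD (is_derive_id x 1) h.
have dsin (x : R) : is_derive x (1 : R) (fun x => x + (- k^-1) * cos (k * x)) (1 + sin (k * x)).
  have h : is_derive x (1 : R) (fun x => (- k^-1) * cos (k * x)) (sin (k * x)).
    apply: (is_derive_eq (is_deriveZ (- k^-1) (is_derive1_comp (is_derive_cos (k * x)) (dk x)))).
    by rewrite /GRing.scale /= !mulNr mulrN opprK mulrCA mulVf ?mulr1.
  exact: is_deriveD (is_derive_id x 1) h.
have ccos : continuous (fun x : R => cos (k * x)).
  by move=> x; apply: continuous_comp; [exact: ck|exact: continuous_cos].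
have csin : continuous (fun x : R => sin (k * x)).
  by move=> x; apply: continuous_comp; [exact: ck|exact: continuous_sin].
apply/eqP; rewrite eq_complex /=; apply/andP; split; apply/eqP.
  apply: int1 => //; first by move=> x; rewrite ler_norml cos_geN1 cos_le1.
  rewrite (circle_integral_derive _ _ dcos).
  - by rewrite per mulr0 addr0 mulr0 sin0 mulr0 addr0 subr0 mulVf.
  - by move=> x; apply: cvgD; [exact: cvg_cst|exact: ccos].
  - by move=> x; have := @cos_geN1 _ (k * x); lra.
apply: int1 => //; first by move=> x; rewrite ler_norml sin_geN1 sin_le1.
rewrite (circle_integral_derive _ _ dsin).
- by rewrite per mulr0 cos0 mulr1 add0r opprK subrK mulVf.
- by move=> x; apply: cvgD; [exact: cvg_cst|exact: csin].
- by move=> x; have := @sin_geN1 _ (k * x); lra.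
Qed.

End orthonormality.

Section fourier_coefficients.
Context {R : realType}.
Local Notation nu := (@circle_measure R).
Implicit Types f g : R -> R[i].

Lemma fourierE f n : fourier f n = circle_integral (fun x => f x * expi ((- n)%:~R * x)).
Proof. by rewrite /fourier; under eq_fun do rewrite -mulNr -rmorphN. Qed.

Lemma fourierB f g n : cintegrable f -> cintegrable g ->
  fourier (fun x => f x - g x) n = fourier f n - fourier g n.
Proof.
move=> fi gi; rewrite !fourierE.
have fe := cintegrableM_expi (- n)%:~R fi.
have ge := cintegrableM_expi (- n)%:~R gi.
rewrite -[X in _ - X]mul1r -mulNr -circle_integralZ// -circle_integralD//; last first.
  exact: cintegrableZ.
by congr circle_integral; apply/funext => x; rewrite mulrBl mulN1r.
Qed.

Lemma cintegrable_trig_poly (a : int -> R[i]) N : cintegrable (trig_poly a N).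
Proof. by apply: cintegrable_sum => k; apply: cintegrableZ; exact: cintegrable_expi. Qed.

Lemma fourier_trig_poly (a : int -> R[i]) N (k : 'I_(N.*2.+1)) :
  fourier (trig_poly a N) (freq k) = a (freq k).
Proof.
rewrite fourierE (_ : (fun x => _) = (fun x => \sum_(l < N.*2.+1)
    a (freq l) * expi ((freq l - freq k)%:~R * x))); last first.
  apply/funext => x; rewrite /trig_poly mulr_suml; apply: eq_bigr => l _.
  by rewrite -mulrA -expiD -mulrDl -intrD.
rewrite circle_integral_sum => [|l]; last exact/cintegrableZ/cintegrable_expi.
rewrite (bigD1 k)//= circle_integralZ; last exact: cintegrable_expi.
rewrite circle_integral_expi subrr eqxx mulr1 big1 ?addr0// => l lk.
rewrite circle_integralZ; last exact: cintegrable_expi.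
by rewrite circle_integral_expi subr_eq0 (inj_eq (@freq_inj N)) (negPf lk) mulr0.
Qed.

Lemma circle_integral_conj_trig_poly f (a : int -> R[i]) N : cintegrable f ->
  circle_integral (fun x => f x * conjc (trig_poly a N x)) =
  \sum_(k < N.*2.+1) conjc (a (freq k)) * fourier f (freq k).
Proof.
move=> fi; rewrite (_ : (fun x => _) = (fun x => \sum_(k < N.*2.+1)
    conjc (a (freq k)) * (f x * expi ((- freq k)%:~R * x)))); last first.
  apply/funext => x; rewrite /trig_poly rmorph_sum mulr_sumr; apply: eq_bigr => k _.
  rewrite [X in f x * X](_ : _ = conjc (a (freq k)) * expi ((- freq k)%:~R * x)).
    by rewrite mulrCA.
  by rewrite rmorphN mulNr -conjc_expi; exact: rmorphM.
rewrite circle_integral_sum => [|k]; last exact/cintegrableZ/cintegrableM_expi.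
apply: eq_bigr => k _; rewrite circle_integralZ ?fourierE//; exact: cintegrableM_expi.
Qed.

(** With [p] the partial sum of [f], the pointwise inequality [2 Re (f * conjc p) - |p|^2 <= |f|^2]
    is integrated; its left side has integral [2 S - S]. Only integrability of [f] enters, and the
    L^2 norm may be infinite. *)
Lemma bessel f N : cintegrable f ->
  ((\sum_(k < N.*2.+1) normc (fourier f (freq k)) ^+ 2)%:E <= L2normsq f)%E.
Proof.
move=> fi; rewrite /L2normsq.
set a := fourier f; set S := \sum_(k < _) _.
pose p := trig_poly a N.
have pi : cintegrable p := cintegrable_trig_poly a N.
have mp : cmeasurable p.
  by apply: cmeasurable_sum => k _; apply: cmeasurableM;
    [exact: cmeasurable_cst|exact: cmeasurable_expi].
have pB x : normc (conjc (p x)) <= \sum_(k < N.*2.+1) normc (a (freq k)).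
  rewrite normcJ; apply: (le_trans (normc_sum _ _ _)); apply: ler_sum => k _.
  by rewrite ComplexField.Normc.normcM normc_expi mulr1.
have fp : cintegrable (fun x => f x * conjc (p x)).
  by apply: (cintegrableM fi _ pB); exact: cmeasurableJ.
have pp : cintegrable (fun x => p x * conjc (p x)).
  by apply: (cintegrableM pi _ pB); exact: cmeasurableJ.
have IE : circle_integral (fun x => 2 * (f x * conjc (p x)) + (-1) * (p x * conjc (p x))) =
    (S%:C)%C.
  rewrite circle_integralD ?circle_integralZ//; try exact: cintegrableZ.
  rewrite !circle_integral_conj_trig_poly// -/a -/p.
  have -> : (\sum_(k < N.*2.+1) conjc (a (freq k)) * fourier p (freq k)) =
      \sum_(k < N.*2.+1) conjc (a (freq k)) * a (freq k).
    by apply: eq_bigr => k _; rewrite fourier_trig_poly.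
  rewrite mulN1r mulr_natl mulr2n addrK /S rmorph_sum; apply: eq_bigr => k _.
  by rewrite mulrC mulc_conj.
pose D x := complex.Re (2 * (f x * conjc (p x)) + (-1) * (p x * conjc (p x))).
have ID : \int[nu]_x D x = S by have := congr1 (@complex.Re R) IE.
have Di : nu.-integrable setT (EFin \o D).
  by case: (cintegrableD (cintegrableZ 2 fp) (cintegrableZ (-1) pp)).
have DE : ((S)%:E = \int[nu]_x (D x)%:E)%E.
  by rewrite -ID /Rintegral fineK// integrable_fin_num.
have Df x : D x <= normc (f x) ^+ 2.
  rewrite normc_sqr /dotc /D mulr_natl mulr2n mulN1r.
  case: (f x) (p x) => r s [t v] /=.
  have := sqr_ge0 (r - t); have := sqr_ge0 (s - v); nra.
have mf2 : measurable_fun setT (fun x => (normc (f x) ^+ 2)%:E).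
  apply/measurable_EFinP; apply: measurable_normc2.
  by case: fi => /measurable_int/measurable_EFinP ? /measurable_int/measurable_EFinP ?.
have f20 x : (0 <= (normc (f x) ^+ 2)%:E)%E by rewrite lee_fin sqr_ge0.
have [->|fin] := eqVneq (\int[nu]_x (normc (f x) ^+ 2)%:E)%E +oo%E; first exact: leey.
rewrite DE; apply: le_integral => //.
  apply/integrableP; split => //.
  rewrite ltey; apply: contra_neq fin => <-.
  by apply: eq_integral => x _; rewrite gee0_abs.
by move=> x _; rewrite lee_fin.
Qed.

Lemma cintegrable_class (f g : L2class R) : cintegrable (complex_fun f g).
Proof.
have mrepr (h : {mfun_ nu, measurableTypeR R >-> measurableTypeR R}) :
    measurable_fun setT (h : R -> R).
  exact: (@measurable_funPT _ _ _ _ (repr h)).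
have If (h : L2class R) : nu.-integrable setT (EFin \o (h : R -> R)).
  apply/Lfun1_integrable; apply: (@Lfun_subset12 _ _ _ nu).
    exact: fin_num_measure.
  rewrite inE; apply/andP; split; rewrite inE /=.
    exact: mrepr.
  exact: Lebesgue_finite.
by split; exact: If.
Qed.

Lemma fourier_sobolev_le f (n : int) :
  ((normc (fourier f n) ^+ 2)%:E <= sobolev_normsq 0 f)%E.
Proof.
apply: esum_ge; exists [set n]; first by split.
by rewrite fsbig_set1 mulr0 powRr0 mul1r.
Qed.

Lemma fourier_sub_sobolev_le (u v : Hhalf_minus R) (n : int) :
  ((normc (fourier v n - fourier u n) ^+ 2)%:E <=
   sobolev_normsq 0 (fun x => v x - u x)%R)%E.
Proof. by rewrite -fourierB; [exact: fourier_sobolev_le|exact: cintegrable_class..]. Qed.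

(** A Fourier coefficient is bounded by the norm of H^0, so the preimage of an open ray is open; the
    radius is the distance of the value to the end of the ray. *)
Lemma cmeasurable_fourier (n : int) :
  cmeasurable (fun u : Hhalf_borel R => fourier (u : Hhalf_minus R) n).
Proof.
have key (pr : R[i] -> R) : (forall z w, pr (z - w) = pr z - pr w) ->
    (forall z, `|pr z| <= normc z) ->
    measurable_fun setT (fun u : Hhalf_borel R => pr (fourier (u : Hhalf_minus R) n)).
  move=> prB prn; apply: (measurability _ (RGenOInfty.measurableE R)) => //.
  move=> _ [_ [a ->] <-]; rewrite setTI; apply: sub_sigma_algebra => u /=.
  rewrite in_itv /= andbT => au.
  pose e := pr (fourier (u : Hhalf_minus R) n) - a.
  exists 0, e; split => //; first by rewrite subr_gt0.
  move=> v /(le_lt_trans (fourier_sub_sobolev_le (u : Hhalf_minus R) v n)) ve.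
  rewrite /= in_itv /= andbT.
  have e0 : 0 < e by rewrite subr_gt0.
  have {ve} : normc (fourier v n - fourier (u : Hhalf_minus R) n) < e.
    by rewrite -ltr_sqr ?nnegrE ?normc_ge0 ?(ltW e0)// -lte_fin.
  move=> /(le_lt_trans (prn _)); rewrite prB ltr_norml => /andP[+ _].
  rewrite /e; lra.
split; apply: key.
- by case=> ? ? [].
- case=> a b /=; rewrite -sqrtr_sqr; apply: ler_wsqrtr; by rewrite lerDl sqr_ge0.
- by case=> ? ? [].
- case=> a b /=; rewrite -sqrtr_sqr; apply: ler_wsqrtr; by rewrite lerDr sqr_ge0.
Qed.

(** Convergence in H^0 forces convergence of each coefficient, and that of the partial sums is
    constant once [K] reaches the absolute value of [n]. *)
Lemma gaussian_series_gcoef d (Omega : measurableType d) (P : probability Omega R)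
    (g : int -> Omega -> R[i]) (U : Omega -> Hhalf_borel R) :
  gaussian_series P g U ->
  {ae P, forall w, forall n, gcoef (U w : Hhalf_minus R) n = g n w}.
Proof.
apply: filterS => w /(_ 0) cv n.
have half0 : 0 < 2^-1 :> R by rewrite invr_gt0.
have {}cv := cv half0.
have j0 : japanese n != 0 :> R by rewrite gt_eqF// (lt_le_trans ltr01)// japanese_ge1.
pose a n := g n w / ((japanese n)%:C)%C.
suff E : fourier (U w : Hhalf_minus R) n = a n.
  rewrite /gcoef E /a mulrC divfK//.
  by apply: contra_neq j0 => -[].
pose z := fourier (U w : Hhalf_minus R) n - a n.
have zK (K : nat) : (`|n| <= K)%N ->
    ((normc z ^+ 2)%:E <=
     sobolev_normsq 0 (fun x => (U w : Hhalf_minus R) x - trig_poly a K x)%R)%E.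
  move=> nK; have kl : (absz (n + K%:Z)%R < K.*2.+1)%N by lia.
  have kE : freq (Ordinal kl) = n by rewrite /freq /=; lia.
  rewrite /z -[X in _ - X](_ : fourier (trig_poly a K) n = _); last first.
    by rewrite -kE fourier_trig_poly.
  rewrite -fourierB; [exact: fourier_sobolev_le|exact: cintegrable_class|].
  exact: cintegrable_trig_poly.
have z0 : ((normc z ^+ 2)%:E <= 0)%E.
  apply: (cvge_to_ge cv); exists `|n|%N => // K /= nK; exact: zK.
have zn : normc z = 0.
  by apply/eqP; rewrite -sqrf_eq0 eq_le sqr_ge0 andbT -lee_fin.
by apply/eqP; rewrite -subr_eq0; apply/eqP/ComplexField.Normc.eq0_normc.
Qed.

End fourier_coefficients.

(* No measurability is assumed because that of [L2normsq] is not established. *)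
Lemma ge0_le_integralT d (T : measurableType d) (R : realType)
    (mu : {measure set T -> \bar R}) (f g : T -> \bar R) :
  (forall x, 0 <= f x)%E -> (forall x, f x <= g x)%E ->
  (\int[mu]_x f x <= \int[mu]_x g x)%E.
Proof.
move=> f0 fg; have g0 x : (0 <= g x)%E := le_trans (f0 x) (fg x).
rewrite !ge0_integralTE//; apply: le_ereal_sup => _ [h hf <-].
by exists h => // x; exact: le_trans (hf x) (fg x).
Qed.

Lemma ae_eq_measure d (T : measurableType d) (R : realType)
    (P : {measure set T -> \bar R}) (A B : set T) : measurable A -> measurable B ->
  {ae P, forall x, A x <-> B x} -> P A = P B.
Proof.
move=> mA mB AB; rewrite -[A]setIT -[B]setIT -!integral_indic//.
apply: ae_eq_integral => //.
- exact/measurable_EFinP/measurable_indic.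
- exact/measurable_EFinP/measurable_indic.
apply: filterS AB => x AB _; rewrite !indicE; congr (_%:R%:E).
by congr nat_of_bool; apply/idP/idP => /set_mem/AB/mem_set.
Qed.

(** * From the Gaussian measure to white noise *)

Section gaussian_noise.
Context {R : realType}.
Local Notation pl := (measurableTypeR R * measurableTypeR R)%type.
Local Notation noise := (g_sigma_algebraType (@cylinders R)).

Lemma standard_complex_gaussian_law d (Omega : measurableType d) (P : probability Omega R)
    (Z : Omega -> R[i]) : standard_complex_gaussian P Z ->
  measurable_fun setT (plane \o Z) /\
  forall B, measurable B -> P ((plane \o Z) @^-1` B) = cgauss B.
Proof.
move=> [mX mY XN YN XY].
have mZ : measurable_fun setT (plane \o Z) by exact: measurable_fun_pair.
split => // B mB.
pose N := normal_prob (0 : R) (Num.sqrt 2^-1).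
pose f : {mfun Omega >-> pl} := mfun_Sub (mem_set mZ).
have h := @product_measure_unique _ _ _ _ R N N (pushforward P f).
apply/esym/h => // A1 A2 mA1 mA2.
by apply: (etrans (XY _ _ mA1 mA2)); rewrite (XN _ mA1) (YN _ mA2).
Qed.

Definition noise_of (u : Hhalf_borel R) : noise :=
  fun n => plane (gcoef (u : Hhalf_minus R) n).

Lemma zc_noise_of (u : Hhalf_borel R) n : zc n (noise_of u) = gcoef (u : Hhalf_minus R) n.
Proof. by rewrite /zc /noise_of /plane; case: (gcoef (u : Hhalf_minus R) n). Qed.

Lemma measurable_noise_of : measurable_fun setT noise_of.
Proof.
apply: measurable_noise => n.
have [] : cmeasurable (fun u : Hhalf_borel R => gcoef (u : Hhalf_minus R) n).
  by apply: cmeasurableM; [exact: cmeasurable_cst|exact: cmeasurable_fourier].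
exact: measurable_fun_pair.
Qed.

(** The white noise is the image of [mu] under the coordinates [gcoef]. Its cylinder probabilities
    are computed on the space carrying the [g n], with which these coordinates agree almost
    surely. *)
Lemma gaussian_law_white_noise (mu : probability (Hhalf_borel R) R) : gaussian_law mu ->
  exists2 lam : probability noise R, is_white_noise lam &
    forall f : noise -> \bar R, measurable_fun setT f -> (forall x, 0 <= f x)%E ->
      (\int[mu]_u f (noise_of u) = \int[lam]_x f x)%E.
Proof.
move=> [d [W [P [g [U [gP ind ser muE]]]]]].
pose X : {RV mu >-> noise} := mfun_Sub (mem_set measurable_noise_of).
exists (distribution mu X); last first.
  by move=> f mf f0; rewrite ge0_integral_distribution.
move=> F B mB.
have mC : measurable (noise_of @^-1` cylinder F B).
  by rewrite -[_ @^-1` _]setTI; apply: measurable_noise_of => //; exact: measurable_cylinder.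
apply: (etrans (muE _ mC)).
transitivity (P (\bigcap_(i in [set` F]) ((plane \o g i) @^-1` B i))).
  apply: (@ae_eq_measure _ W R P (U @^-1` (noise_of @^-1` cylinder F B))).
  - by rewrite -[_ @^-1` _]setTI; apply: (@measurable_funPT _ _ _ _ U).
  - apply: fin_bigcap_measurable; first exact: finite_fset.
    move=> i _; rewrite -[_ @^-1` _]setTI.
    by apply: (standard_complex_gaussian_law (gP i)).1.
  apply: filterS (gaussian_series_gcoef ser) => w gw.
  by split => FB i iF; have := FB i iF; rewrite /= /noise_of gw.
rewrite ind//; apply: eq_bigr => i _.
by rewrite (standard_complex_gaussian_law (gP i)).2.
Qed.

Lemma noise_mass_le (u : Hhalf_borel R) N :
  ((noise_mass (@freq N) (noise_of u))%:E <= L2normsq (u : Hhalf_minus R))%E.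
Proof.
apply: le_trans (bessel N (cintegrable_class _ _)); rewrite lee_fin.
rewrite le_eqVlt; apply/orP; left; apply/eqP; apply: eq_bigr => k _.
have j0 : 0 < japanese (freq k) :> R by rewrite (lt_le_trans ltr01)// japanese_ge1.
rewrite zc_noise_of /gcoef ComplexField.Normc.normcM normc_real exprMn.
by rewrite (gtr0_norm j0) mulrAC mulfV ?mul1r// gt_eqF// exprn_gt0.
Qed.

(** On the diagonal the exchange of the first two slots shows that the weights [fr i] and [fr j]
    contribute equally. This turns the factor 3/2 of the chaos into 3/4. *)
Lemma Qform_diag (I : finType) (fr : I -> int) (x : I -> R[i]) : Qform fr x x x x =
  2 * quad_sum fr (fun i j k l => (fr i)%:~R * (x i * x j * conjc (x k) * conjc (x l))).
Proof.
rewrite mulr_natl mulr2n {2}quad_sum_swap12 /quad_sum -big_split.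
apply: eq_bigr => p _ /=; rewrite intrD mulrDl.
by rewrite [x p.1.2 * x p.1.1]mulrC.
Qed.

Lemma S4_Qnoise (c : int -> R) N (u : Hhalf_borel R) :
  S4 c N (u : Hhalf_minus R) = 3 / 4 * Qnoise (@freq N) (full_symbol c) (noise_of u).
Proof.
set X := noise_coef (@freq N) (full_symbol c) (noise_of u).
have XE i : X i = (c (freq i))%:C%C * gcoef (u : Hhalf_minus R) (freq i) /
    (japanese (freq i))%:C%C.
  by rewrite /X /noise_coef zc_noise_of /full_symbol rmorphM fmorphV mulrAC.
have XJ i : conjc (X i) = (c (freq i))%:C%C * conjc (gcoef (u : Hhalf_minus R) (freq i)) /
    (japanese (freq i))%:C%C.
  have conjV (z : R[i]) : conjc (z^-1) = (conjc z)^-1 by exact: fmorphV.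
  have conjM (y z : R[i]) : conjc (y * z) = conjc y * conjc z by exact: rmorphM.
  by rewrite XE !conjM conjV !conjc_real.
have SA : S4C c N (u : Hhalf_minus R) = 3 / 2 * quad_sum (@freq N) (fun i j k l =>
    (freq i)%:~R * (X i * X j * conjc (X k) * conjc (X l))).
  rewrite /S4C quad_sumE; congr (_ * _).
  apply: eq_bigr => i _; apply: eq_bigr => j _; apply: eq_bigr => k _.
  apply: eq_bigr => l _; rewrite /S4term !XJ !XE.
  move: (gcoef _ (freq i)) (gcoef _ (freq j)) (conjc (gcoef _ (freq k)))
    (conjc (gcoef _ (freq l))) => g1 g2 g3 g4.
  rewrite !rmorphM !invfM rmorph_int; ring.
rewrite /S4 SA /Qnoise -/X Qform_diag.
move: (quad_sum _ _) => A.
have -> : 3 / 2 * A = ((3 / 4)%:C)%C * (2 * A).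
  have -> : ((3 / 4 : R)%:C)%C = 3 / 4 by rewrite rmorphM fmorphV !rmorph_nat.
  by field.
by case: (2 * A) => a b /=; rewrite mul0r subr0.
Qed.

End gaussian_noise.

Theorem theorem3p3 (R : realType) (mu : probability (Hhalf_borel R) R)
    (hmu : gaussian_law mu) (M p : R) (hM : 0 < M) (hp : 1 <= p) :
  exists m C : R, 0 < m /\
    forall c : int -> R,
      (forall n, `|c n| <= M) -> (forall n, c n = c (- n)) ->
      forall N : nat,
        (\int[mu]_u ((\1_[set v : Hhalf_borel R |
             (L2normsq (v : Hhalf_minus R) < m%:E)%E] u)%:E
           * (expR (p * S4 c N (u : Hhalf_minus R)))%:E) <= C%:E)%E.
Proof.
have [lam lamP muE] := gaussian_law_white_noise hmu.
have [C C0 momentC] := noise_moment lamP.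
have [m [K [m0 bound]]] :=
  noise_exponential_bound lamP C0 momentC hM (lt_le_trans ltr01 hp).
exists m, K; split => // c cM cN N; apply: le_trans (bound c cM cN N).
pose S := [set x | noise_mass (@freq N) x < m].
have mS : measurable S.
  have mm : measurable_fun setT (fun x : g_sigma_algebraType (@cylinders R) =>
      noise_mass (@freq N) x).
    apply: measurable_sum => i; apply: measurable_funM => //; exact: measurable_zc2.
  have := mm measurableT `]-oo, m[%classic (measurable_itv _).
  by rewrite setTI; congr measurable; apply/seteqP; split => x; rewrite /= in_itv.
rewrite -muE; last 2 first.
- apply/measurable_EFinP; apply: measurable_funM; first exact: measurable_indic.
  apply: measurableT_comp => //; apply: measurable_funM => //; apply: measurable_funM => //.
  exact: measurable_Qnoise.
- by move=> x; rewrite lee_fin mulr_ge0// expR_ge0.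
(* By [noise_mass_le] the mass of the truncated field is at most the full mass, so the indicator in
   the theorem is dominated pointwise by the one for the noise. *)
apply: ge0_le_integralT => u; first by rewrite -EFinM lee_fin mulr_ge0// expR_ge0.
rewrite -EFinM lee_fin S4_Qnoise ler_wpM2r ?expR_ge0//.
rewrite !indicE; have [um|] := boolP (u \in _); last by rewrite mulr0n.
rewrite mem_set//= -lte_fin; apply: le_lt_trans (noise_mass_le u N) _.
by move: um; rewrite inE.
Qed.
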